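(* Let $k$ be a field of characteristic zero and $\mathfrak g$ a Lie algebra over $k$. Then the $2$-bracket on $H^*(\mathcal Rep(\mathfrak g))$ is zero.
   Context: $\mathcal Rep(\mathfrak g)$ is the tensor category of $U(\mathfrak g)$-modules. **Cohomology.** For a tensor ($k$-linear monoidal) category $\mathcal C$, $Id_{\mathcal C}^{\otimes n}(X_1,\dots,X_n)=X_1\otimes(X_2\otimes(\cdots\otimes X_n)\cdots)$ and $E(\mathcal C)(n)=End(Id_{\mathcal C}^{\otimes n})$ is a cosimplicial monoid (algebra) with, up to conjugation with canonical constraints, $\partial_0(a)=1_{X_1}\otimes a_{X_2,\dots,X_{n+1}}$, $\partial_i(a)=a_{X_1,\dots,X_i\otimes X_{i+1},\dots,X_{n+1}}$ ($1\le i\le n$), $\partial_{n+1}(a)=a_{X_1,\dots,X_n}\otimes1_{X_{n+1}}$, $\sigma_i(a)=a_{X_1,\dots,X_i,I,X_{i+1},\dots,X_{n-1}}$. $H^*(\mathcal C)$ is the cohomology of the (normalised) complex $\mathcal E^*(\mathcal C)$ of $E(\mathcal C)$, with differential $\sum_i(-1)^i\partial_i$. For $\mathcal C=\mathcal Rep(\mathfrak g)$, $E(\mathcal C)(n)$ is the centraliser of the diagonal image of $U(\mathfrak g)$ in $U(\mathfrak g)^{\otimes n}$. **$2$-bracket.** It is the bracket $H^m(\mathcal C)\otimes H^n(\mathcal C)\to H^{m+n-2}(\mathcal C)$ of the natural $E_3$-algebra structure on $\mathcal E^*(\mathcal C)$, i.e. the operation given by a generator of the second homology of the arity two component of the following $E_3$-operad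 acting on $\mathcal E^*(\mathcal C)$. (In degree $(2,2)$ it is $ba-ab$.) Let $\langle n\rangle$ be the poset $0<\dots<n$ as a category and $\square$ the funny tensor product of categories (morphisms generated by $(f,id)$ and $(id,g)$, functorial in each variable, no interchange relation). $\mathcal L(n_1,\dots,n_k;m)$ is the set of end-point preserving functors $\psi:\langle m+1\rangle\to\langle n_1+1\rangle\square\cdots\square\langle n_k+1\rangle$, and $\mathcal L^{(3)}$ is the suboperad of those $\psi$ whose projections to any two coordinates change direction at most $3$ times. Since $E=E(\mathcal C)$ is a $2$-commutative cosimplicial monoid, $\psi\in\mathcal L^{(3)}(n_1,\dots,n_k;m)$ acts by $x_1\otimes\cdots\otimes x_k\mapsto E(f_{\sigma(1)})(x_{\sigma(1)})\cdots E(f_{\sigma(k)})(x_{\sigma(k)})$, where $f_i:[n_i]\to[m]$, $f_i(j)=l$ iff $\psi_i(l)\le j<\psi_i(l+1)$, is Joyal dual to the $i$-th coordinate $\psi_i$, and $\sigma$ is the order in which the directions first occur along $\psi$. With $\delta(n)$ the normalised simplicial chains of the $n$-simplex and $Tot_\delta(X)=\int_{[n]\in\Delta}X(n)^{\delta(n)}$, the operad with components $Tot_\delta\big(\int^{n_1,\dots,n_k}\mathcal L^{(3)}(n_1,\dots,n_k;-)\otimes\delta(n_1)\otimes\cdots\otimes\delta(n_k)\big)$ is an $E_3$-operad (weakly equivalent to chains on the little $3$-cubes operad) acting on $\mathcal E^*(\mathcal C)=Tot_\delta(E(\mathcal C))$. *)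

(* Defs.v *)
From HB Require Import structures.
From mathcomp Require Import all_boot all_algebra.
From mathcomp.classical Require Import boolp.

Set Implicit Arguments.
Unset Strict Implicit.
Unset Printing Implicit Defensive.

Import GRing.Theory.
Local Open Scope ring_scope.
Local Open Scope quotient_scope.

(* A formal sum of pairs [v1 (x) w1 + ... + vr (x) wr] is a sequence of pairs;
   [teq] is the smallest additive congruence making [(x)] bilinear.  Opposites
   exist in the quotient because [-(v (x) w) = (- v) (x) w]. *)
Inductive teq (k : fieldType) (V W : lmodType k) :
    seq (V * W) -> seq (V * W) -> Prop :=
| teq_refl s : teq s s
| teq_sym s t : teq s t -> teq t s
| teq_trans s t u : teq s t -> teq t u -> teq s u
| teq_cat s s' t t' : teq s s' -> teq t t' -> teq (s ++ t) (s' ++ t')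
| teq_comm s t : teq (s ++ t) (t ++ s)
| teq_zero w : teq [:: (0, w)] [::]
| teq_addl v v' w : teq [:: (v + v', w)] [:: (v, w); (v', w)]
| teq_addr v w w' : teq [:: (v, w + w')] [:: (v, w); (v, w')]
| teq_scale a v w : teq [:: (a *: v, w)] [:: (v, a *: w)].

Section Tensor.
Variables (k : fieldType) (V W : lmodType k).
Implicit Types (s t u : seq (V * W)).

Definition teqb s t : bool := `[< teq s t >].

Lemma teqb_refl : reflexive teqb.
Proof. by move=> s; apply/asboolP; exact: teq_refl. Qed.

Lemma teqb_sym : symmetric teqb.
Proof. by move=> s t; apply/asboolP/asboolP; exact: teq_sym. Qed.

Lemma teqb_trans : transitive teqb.
Proof.
by move=> s t u /asboolP ts /asboolP su; apply/asboolP; exact: teq_trans su.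
Qed.

Canonical teq_equiv := EquivRel teqb teqb_refl teqb_sym teqb_trans.

Definition tens : Type := {eq_quot teq_equiv}.
HB.instance Definition _ := Choice.on tens.

Lemma tensP s t : \pi_tens s = \pi_tens t <-> teq s t.
Proof.
by split=> [/eqquotP/asboolP //|st]; apply/eqquotP/asboolP.
Qed.

Lemma teq_repr s : teq (repr (\pi_tens s)) s.
Proof. by apply/tensP; rewrite reprK. Qed.

Definition tscales (a : k) s := [seq (a *: p.1, p.2) | p <- s].

Lemma teq_tscales a s t : teq s t -> teq (tscales a s) (tscales a t).
Proof.
elim=> {s t} /=.
- by move=> s; exact: teq_refl.
- by move=> s t _; exact: teq_sym.
- by move=> s t u _ h _; exact: teq_trans.
- by move=> s s' t t' _ h _ h'; rewrite /tscales !map_cat; exact: teq_cat.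
- by move=> s t; rewrite /tscales !map_cat; exact: teq_comm.
- by move=> w; rewrite /tscales/= scaler0; exact: teq_zero.
- by move=> v v' w; rewrite /tscales/= scalerDr; exact: teq_addl.
- by move=> v w w'; exact: teq_addr.
- by move=> b v w; rewrite /tscales/= scalerA mulrC -scalerA; exact: teq_scale.
Qed.

Definition tzero : tens := \pi_tens [::].
Definition tadd (x y : tens) : tens := \pi_tens (repr x ++ repr y).
Definition tscale (a : k) (x : tens) : tens := \pi_tens (tscales a (repr x)).
Definition topp (x : tens) : tens := tscale (-1) x.

Lemma tadd_pi s t : tadd (\pi s) (\pi t) = \pi_tens (s ++ t).
Proof. by apply/tensP; apply: teq_cat; exact: teq_repr. Qed.

Lemma tscale_pi a s : tscale a (\pi s) = \pi_tens (tscales a s).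
Proof. by apply/tensP; apply: teq_tscales; exact: teq_repr. Qed.

Lemma tens_pi (x : tens) : exists s, x = \pi_tens s.
Proof. by exists (repr x); rewrite reprK. Qed.

Lemma taddA : associative tadd.
Proof.
move=> x y z; have [s ->] := tens_pi x; have [t ->] := tens_pi y.
have [u ->] := tens_pi z.
by rewrite (tadd_pi t u) (tadd_pi s t) (tadd_pi s) (tadd_pi _ u) catA.
Qed.

Lemma taddC : commutative tadd.
Proof.
move=> x y; have [s ->] := tens_pi x; have [t ->] := tens_pi y.
by rewrite (tadd_pi s t) (tadd_pi t s); apply/tensP; exact: teq_comm.
Qed.

Lemma tadd0 : left_id tzero tadd.
Proof. by move=> x; have [s ->] := tens_pi x; rewrite tadd_pi. Qed.

Lemma teq_swap s t u u' : teq ((s ++ t) ++ (u ++ u')) ((s ++ u) ++ (t ++ u')).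
Proof.
rewrite -!catA; apply: teq_cat; first exact: teq_refl.
by rewrite !catA; apply: teq_cat (teq_comm _ _) (teq_refl _).
Qed.

Lemma tscalesDl a b s : teq (tscales (a + b) s) (tscales a s ++ tscales b s).
Proof.
elim: s => [|[v w] s IHs] /=; first exact: teq_refl.
apply: (@teq_trans _ _ _ _ ([:: (a *: v, w); (b *: v, w)] ++
                             (tscales a s ++ tscales b s))).
  rewrite -cat1s scalerDl; apply: teq_cat => //; exact: teq_addl.
exact: (teq_swap [:: _] [:: _]).
Qed.

Lemma tscalesA a b s : tscales a (tscales b s) = tscales (a * b) s.
Proof.
by rewrite /tscales -map_comp; apply: eq_map => p /=; rewrite scalerA.
Qed.

Lemma tscales1 s : tscales 1 s = s.
Proof.
rewrite /tscales -[RHS]map_id; apply: eq_map => -[v w].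
by rewrite /= scale1r.
Qed.

Lemma tscales0 s : teq (tscales 0 s) [::].
Proof.
elim: s => [|[v w] s IHs] /=; first exact: teq_refl.
rewrite scale0r -cat1s -[X in teq _ X]cats0; apply: teq_cat => //.
exact: teq_zero.
Qed.

Lemma taddN : left_inverse tzero topp tadd.
Proof.
move=> x; have [s ->] := tens_pi x.
rewrite /topp tscale_pi tadd_pi; apply/tensP.
rewrite -[X in _ ++ X]tscales1; apply: teq_trans (teq_sym (tscalesDl _ _ _)) _.
by rewrite addNr; exact: tscales0.
Qed.

HB.instance Definition _ := GRing.isZmodule.Build tens taddA taddC tadd0 taddN.

Lemma tscaleA a b x : tscale a (tscale b x) = tscale (a * b) x.
Proof.
have [s ->] := tens_pi x.
by rewrite (tscale_pi b) (tscale_pi a) tscale_pi tscalesA.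
Qed.

Lemma tscale1 : left_id 1 tscale.
Proof. by move=> x; have [s ->] := tens_pi x; rewrite tscale_pi tscales1. Qed.

Lemma tscaleDr : right_distributive tscale +%R.
Proof.
move=> a x y; have [s ->] := tens_pi x; have [t ->] := tens_pi y.
rewrite /GRing.add/= (tadd_pi s t) (tscale_pi a s) (tscale_pi a t).
by rewrite tscale_pi tadd_pi /tscales map_cat.
Qed.

Lemma tscaleDl x : {morph tscale^~ x : a b / a + b}.
Proof.
have [s ->] := tens_pi x; move=> a b.
rewrite [RHS]/GRing.add/= !tscale_pi tadd_pi.
by apply/tensP; exact: tscalesDl.
Qed.

HB.instance Definition _ := GRing.Zmodule_isLmodule.Build k tens
  tscaleA tscale1 tscaleDr tscaleDl.

Lemma add_pi s t :
  (\pi_tens s : tens) + (\pi_tens t : tens) = \pi_tens (s ++ t).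
Proof. exact: tadd_pi. Qed.

Lemma scale_pi a s : a *: (\pi_tens s : tens) = \pi_tens (tscales a s).
Proof. exact: tscale_pi. Qed.

Definition tpure (v : V) (w : W) : tens := \pi_tens [:: (v, w)].

(* The map [V (x) W -> M] induced by a bilinear [b : V -> W -> M]. *)
Definition tlift (M : lmodType k) (b : V -> W -> M) (x : tens) : M :=
  \sum_(p <- repr x) b p.1 p.2.

Section Lift.
Variables (M : lmodType k) (b : V -> W -> M).
Hypothesis b_linl : forall w, linear (b^~ w).
Hypothesis b_linr : forall v, linear (b v).

Lemma teq_sum s t :
  teq s t -> \sum_(p <- s) b p.1 p.2 = \sum_(p <- t) b p.1 p.2.
Proof.
elim=> {s t} //.
- by move=> s t u _ -> _ ->.
- by move=> s s' t t' _ e _ e'; rewrite !big_cat/= e e'.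
- by move=> s t; rewrite !big_cat/= addrC.
- move=> w; rewrite big_seq1 big_nil/=.
  have := b_linl w (-1) 0 0; rewrite scaler0 addr0 => ->.
  by rewrite scaleN1r addNr.
- move=> v v' w; rewrite !big_cons !big_nil/= !addr0.
  by have := b_linl w 1 v v'; rewrite !scale1r.
- move=> v w w'; rewrite !big_cons !big_nil/= !addr0.
  by have := b_linr v 1 w w'; rewrite !scale1r.
- move=> a v w; rewrite !big_seq1/=.
  have b0l : b 0 w = 0.
    have := b_linl w (-1) 0 0; rewrite scaler0 addr0 => ->.
    by rewrite scaleN1r addNr.
  have b0r : b v 0 = 0.
    have := b_linr v (-1) 0 0; rewrite scaler0 addr0 => ->.
    by rewrite scaleN1r addNr.
  have := b_linl w a v 0; rewrite b0l !addr0 => ->.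
  by have := b_linr v a w 0; rewrite b0r !addr0 => ->.
Qed.

Lemma tlift_pi s : tlift b (\pi_tens s) = \sum_(p <- s) b p.1 p.2.
Proof. by apply: teq_sum; exact: teq_repr. Qed.

Lemma tlift_pure v w : tlift b (tpure v w) = b v w.
Proof. by rewrite tlift_pi big_seq1. Qed.

Lemma tlift_linear : linear (tlift b).
Proof.
move=> a x y; have [s ->] := tens_pi x; have [t ->] := tens_pi y.
rewrite scale_pi add_pi !tlift_pi big_cat/=.
congr (_ + _); rewrite /tscales big_map scaler_sumr.
apply: eq_bigr => -[v w] _ /=.
have b0 : b 0 w = 0.
  have := b_linl w (-1) 0 0; rewrite scaler0 addr0 => ->.
  by rewrite scaleN1r addNr.
by have := b_linl w a v 0; rewrite b0 !addr0.
Qed.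

End Lift.

Lemma pure_linl w : linear (tpure^~ w).
Proof.
move=> a v v'; rewrite scale_pi add_pi.
by apply/tensP; exact: teq_addl.
Qed.

Lemma pure_linr v : linear (tpure v).
Proof.
move=> a w w'; rewrite scale_pi add_pi.
apply/tensP; apply: teq_trans (teq_addr _ _ _) _.
rewrite -cat1s -[in X in teq _ X]cat1s; apply: teq_cat; last exact: teq_refl.
exact: teq_sym (teq_scale _ _ _).
Qed.

Lemma tens_pure_sum (x : tens) : x = \sum_(p <- repr x) tpure p.1 p.2.
Proof.
rewrite -[LHS]reprK; elim: (repr x) => [|[v w] s IHs]; first by rewrite big_nil.
by rewrite big_cons -IHs /= add_pi.
Qed.

End Tensor.

Notation "v *t w" := (tpure v w) (at level 40, left associativity).

Record lieAlgebra (k : fieldType) := LieAlgebra {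
  lie_sort :> lmodType k;
  lie_br : lie_sort -> lie_sort -> lie_sort;
  lie_linl : forall y, linear (lie_br^~ y);
  lie_linr : forall x, linear (lie_br x);
  lie_alt : forall x, lie_br x x = 0;
  lie_jacobi : forall x y z,
    lie_br x (lie_br y z) + lie_br y (lie_br z x) + lie_br z (lie_br x y) = 0
}.

(* A module over the enveloping algebra [U(g)] is the same thing as a
   representation of [g]: a vector space with a Lie action of [g]. *)
Record rep (k : fieldType) (g : lieAlgebra k) := Rep {
  rep_sort :> lmodType k;
  rep_act : g -> rep_sort -> rep_sort;
  act_linl : forall v, linear (rep_act^~ v);
  act_linr : forall x, linear (rep_act x);
  act_br : forall x y v,
    rep_act (lie_br x y) v = rep_act x (rep_act y v) - rep_act y (rep_act x v)
}.

Record rep_hom (k : fieldType) (g : lieAlgebra k) (X Y : rep g) := Hom {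
  hom_fun :> X -> Y;
  hom_linear : linear hom_fun;
  hom_act : forall x v, hom_fun (rep_act x v) = rep_act x (hom_fun v)
}.

(* The monoidal structure: [g] acts on [X (x) Y] through the coproduct
   [x |-> x (x) 1 + 1 (x) x], and trivially on the unit object [k]. *)
Section Monoidal.
Variables (k : fieldType) (g : lieAlgebra k).
Implicit Types X Y Z : rep g.

Definition tact X Y (x : g) : tens X Y -> tens X Y :=
  tlift (fun v w => rep_act x v *t w + v *t rep_act x w).

Lemma tact_bl X Y (x : g) w :
  linear (fun v : X => rep_act x v *t w + v *t rep_act x (w : Y)).
Proof. by move=> a v v'; rewrite act_linr !pure_linl scalerDr addrACA. Qed.

Lemma tact_br0 X Y (x : g) v :
  linear (fun w : Y => rep_act x (v : X) *t w + v *t rep_act x w).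
Proof. by move=> a w w'; rewrite act_linr !pure_linr scalerDr addrACA. Qed.

Lemma tact_linr X Y x : linear (@tact X Y x).
Proof. by apply: tlift_linear; [exact: tact_bl|exact: tact_br0]. Qed.

Lemma tact_pure X Y x (v : X) (w : Y) :
  tact x (v *t w) = rep_act x v *t w + v *t rep_act x w.
Proof. by apply: tlift_pure; [exact: tact_bl|exact: tact_br0]. Qed.

Lemma tact_linl X Y t : linear ((@tact X Y)^~ t).
Proof.
move=> a x y; rewrite /tact /tlift scaler_sumr -big_split/=.
apply: eq_bigr => -[v w] _ /=.
by rewrite !act_linl pure_linl pure_linr scalerDr addrACA.
Qed.

Lemma lin_sub (V M : lmodType k) (f : V -> M) :
  linear f -> forall u v, f (u - v) = f u - f v.
Proof.
by move=> fl u v; rewrite addrC -scaleN1r fl scaleN1r addrC.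
Qed.

Lemma tact0 X Y x : @tact X Y x 0 = 0.
Proof.
have := tact_linr x (-1) (0 : tens X Y) 0; rewrite scaler0 addr0 => ->.
by rewrite scaleN1r addNr.
Qed.

Lemma tactD X Y x : {morph @tact X Y x : t u / t + u}.
Proof. by move=> t u; have := tact_linr x 1 t u; rewrite !scale1r. Qed.

Lemma act_br_AC (M : zmodType) (A B C E F G : M) :
  A - B + (C - E) = A + F + (G + C) - (B + G + (F + E)).
Proof.
have -> : A + F + (G + C) = A + C + (F + G).
  by rewrite [LHS](AC (2*2) ((1*4)*(2*3))).
have -> : B + G + (F + E) = B + E + (F + G).
  by rewrite [LHS](AC (2*2) ((1*4)*(3*2))).
by rewrite opprD [RHS]addrACA subrr addr0 opprD addrACA.
Qed.

Lemma tact_brE X Y x y (t : tens X Y) :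
  tact (lie_br x y) t = tact x (tact y t) - tact y (tact x t).
Proof.
rewrite (tens_pure_sum t); elim: (repr t) => [|[v w] s IHs].
  by rewrite big_nil !tact0 subr0.
rewrite big_cons /= !tactD IHs !tact_pure !tactD !tact_pure !act_br.
rewrite (lin_sub (pure_linl _)) (lin_sub (pure_linr _)).
rewrite [in RHS]opprD [RHS]addrACA; congr (_ + _).
exact: act_br_AC.
Qed.

Definition rep_tens X Y : rep g :=
  Rep (@tact_linl X Y) (@tact_linr X Y) (@tact_brE X Y).

Definition unit_act (x : g) (c : k^o) : k^o := 0.

Lemma unit_act_linl c : linear (unit_act^~ c).
Proof. by move=> a x y; rewrite /unit_act scaler0 addr0. Qed.

Lemma unit_act_linr x : linear (unit_act x).
Proof. by move=> a c d; rewrite /unit_act scaler0 addr0. Qed.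

Lemma unit_act_br x y c :
  unit_act (lie_br x y) c =
  unit_act x (unit_act y c) - unit_act y (unit_act x c).
Proof. by rewrite /unit_act subr0. Qed.

Definition rep_unit : rep g := Rep unit_act_linl unit_act_linr unit_act_br.

Local Notation "X ** Y" := (rep_tens X Y) (at level 40, left associativity).

Definition tmap X X' Y Y' (f : X -> X') (h : Y -> Y') : X ** Y -> X' ** Y' :=
  tlift (fun v w => f v *t h w).

Definition tassoc X Y Z : X ** (Y ** Z) -> X ** Y ** Z :=
  tlift (fun u => tlift (fun v w => u *t v *t w)).

Definition tassoc_inv X Y Z : X ** Y ** Z -> X ** (Y ** Z) :=
  tlift (fun t w => tlift (fun u v => u *t (v *t w)) t).

Definition tlunit X : rep_unit ** X -> X := tlift (fun (c : k^o) v => c *: v).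

Definition tlunit_inv X (v : X) : rep_unit ** X := (1 : k^o) *t v.

(* [Tpow [:: X1; ...; Xn]] is [X1 (x) (... (x) (Xn (x) k))]: the functor
   [Id^(x n)] up to the right unit constraint. *)
Fixpoint Tpow (Xs : seq (rep g)) : rep g :=
  if Xs is X :: Xs' then X ** Tpow Xs' else rep_unit.

(* The canonical isomorphism (and its inverse)
   [Tpow Xs -> Tpow (X1, ..., Xi) (x) Tpow (Xi+1, ..., Xn)]. *)
Fixpoint tsplit (i : nat) (Xs : seq (rep g)) {struct Xs} :
    Tpow Xs -> Tpow (take i Xs) ** Tpow (drop i Xs) :=
  match Xs, i return Tpow Xs -> Tpow (take i Xs) ** Tpow (drop i Xs) with
  | X :: Xs', i'.+1 => fun t => tassoc (tmap id (@tsplit i' Xs') t)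
  | [::], _ => fun t => tlunit_inv t
  | _ :: _, 0%N => fun t => tlunit_inv t
  end.

Fixpoint tjoin (i : nat) (Xs : seq (rep g)) {struct Xs} :
    Tpow (take i Xs) ** Tpow (drop i Xs) -> Tpow Xs :=
  match Xs, i return Tpow (take i Xs) ** Tpow (drop i Xs) -> Tpow Xs with
  | X :: Xs', i'.+1 => fun t => tmap id (@tjoin i' Xs') (tassoc_inv t)
  | [::], _ => fun t => tlunit t
  | _ :: _, 0%N => fun t => tlunit t
  end.

(* For block lengths [bs = [:: b1; ...; bn]], cut [Xs] into consecutive blocks
   [B1, ..., Bn] of these lengths and a remainder [R].  [tgroup] is the
   canonical isomorphism [Tpow Xs -> Tpow (Tpow B1, ..., Tpow Bn) (x) Tpow R],
   and [tungroup] its inverse. *)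
Fixpoint blocks (bs : seq nat) (Xs : seq (rep g)) : seq (rep g) :=
  if bs is b :: bs' then Tpow (take b Xs) :: blocks bs' (drop b Xs) else [::].

Fixpoint remainder (bs : seq nat) (Xs : seq (rep g)) : seq (rep g) :=
  if bs is b :: bs' then remainder bs' (drop b Xs) else Xs.

Fixpoint tgroup (bs : seq nat) (Xs : seq (rep g)) :
    Tpow Xs -> Tpow (blocks bs Xs) ** Tpow (remainder bs Xs) :=
  match bs return Tpow Xs -> Tpow (blocks bs Xs) ** Tpow (remainder bs Xs) with
  | [::] => fun t => tlunit_inv t
  | b :: bs' => fun t => tassoc (tmap id (@tgroup bs' (drop b Xs)) (tsplit b t))
  end.

Fixpoint tungroup (bs : seq nat) (Xs : seq (rep g)) :
    Tpow (blocks bs Xs) ** Tpow (remainder bs Xs) -> Tpow Xs :=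
  match bs return Tpow (blocks bs Xs) ** Tpow (remainder bs Xs) -> Tpow Xs with
  | [::] => fun t => tlunit t
  | b :: bs' => fun t =>
      tjoin (tmap id (@tungroup bs' (drop b Xs)) (tassoc_inv t))
  end.

Fixpoint rep_homs (Xs Ys : seq (rep g)) : Type :=
  match Xs, Ys with
  | [::], [::] => unit
  | X :: Xs', Y :: Ys' => rep_hom X Y * rep_homs Xs' Ys'
  | _, _ => False
  end.

Fixpoint Tpow_map (Xs Ys : seq (rep g)) :
    rep_homs Xs Ys -> Tpow Xs -> Tpow Ys :=
  match Xs, Ys return rep_homs Xs Ys -> Tpow Xs -> Tpow Ys with
  | [::], [::] => fun _ t => t
  | X :: Xs', Y :: Ys' => fun fs =>
      tmap (fs.1 : rep_hom X Y) (@Tpow_map Xs' Ys' fs.2)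
  | _, _ => fun fs => False_rect _ fs
  end.

(* An element of [E(n) = End (Id^(x n))] is a family satisfying [natEnd n];
   only its values on sequences of [n] objects are relevant. *)
Definition endofam := forall Xs : seq (rep g), Tpow Xs -> Tpow Xs.

Definition natEnd (n : nat) (a : endofam) : Prop :=
  [/\ forall Xs, size Xs = n -> linear (a Xs),
      forall Xs x t, size Xs = n -> a Xs (rep_act x t) = rep_act x (a Xs t)
    & forall Xs Ys (fs : rep_homs Xs Ys) t, size Xs = n ->
        a Ys (Tpow_map fs t) = Tpow_map fs (a Xs t)].

(* [E(f) : E(n) -> E(m)] for a monotone [f : [n] -> [m]]: up to canonical
   constraints, [E(f)(a)] at [X1, ..., Xm] is [1 (x) a_(Y1, ..., Yn) (x) 1] with
   [Yj] the tensor product of the [Xi] for [f (j - 1) < i <= f j]. *)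
Definition Emap (n : nat) (f : nat -> nat) (a : endofam) : endofam :=
  fun Xs t =>
    let bs := [seq (f j.+1 - f j)%N | j <- iota 0 n] in
    let Ys := drop (f 0%N) Xs in
    tjoin (tmap id
      (fun u : Tpow Ys => tungroup (tmap (a (blocks bs Ys)) id (tgroup bs u)))
      (tsplit (f 0%N) t)).

(* [bump i] and [unbump i] are the coface [d^i : [n] -> [n + 1]] and the
   codegeneracy [s^i : [n + 1] -> [n]]. *)
Definition Ecoface (n i : nat) (a : endofam) : endofam := Emap n (bump i) a.
Definition Ecodegen (n i : nat) (a : endofam) : endofam := Emap n (unbump i) a.

Definition Ediff (n : nat) (a : endofam) : endofam :=
  fun Xs t => \sum_(i < n.+2) (-1) ^+ i *: Ecoface n i a t.

Definition Enormalised (n : nat) (a : endofam) : Prop :=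
  forall i Xs (t : Tpow Xs), (i < n)%N -> (size Xs).+1 = n ->
    Ecodegen n i a t = 0.

Definition cochain (n : nat) (a : endofam) : Prop :=
  natEnd n a /\ Enormalised n a.

Definition cocycle (n : nat) (a : endofam) : Prop :=
  cochain n a /\ forall Xs (t : Tpow Xs), size Xs = n.+1 -> Ediff n a t = 0.

Definition coboundary (n : nat) (a : endofam) : Prop :=
  if n is n'.+1 then
    exists c, cochain n' c /\
      forall Xs (t : Tpow Xs), size Xs = n -> a Xs t = Ediff n' c t
  else forall Xs (t : Tpow Xs), size Xs = n -> a Xs t = 0.

End Monoidal.

(* An end-point preserving functor [psi : <m + 1> -> <n1 + 1> [] <n2 + 1>] is
   the sequence of the images of the [m + 1] generating arrows of [<m + 1>].
   An arrow of the funny tensor product is a word in the unit steps of the two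
   directions, [true] (first) and [false] (second); there are [n1 + 1] and
   [n2 + 1] steps in total. *)
Definition lpath := seq (seq bool).

Definition dir_changes (w : seq bool) : nat :=
  count id (pairmap addb (head true w) w).

Definition in_L3 (n1 n2 m : nat) (psi : lpath) : bool :=
  [&& size psi == m.+1, count_mem true (flatten psi) == n1.+1,
      count_mem false (flatten psi) == n2.+1
    & (dir_changes (flatten psi) <= 3)%N].

(* The simplicial structure in [n1] (or [n2]) is given by composing with the
   Joyal duals of the maps of ordinals: the [i]-th face collapses the [i]-th
   step in that direction and the [i]-th degeneracy doubles it. *)
Definition nondegenerate (psi : lpath) : bool :=
  all (sorted (fun x y : bool => x != y)) psi.

Fixpoint del_step (d : bool) (i : nat) (w : seq bool) : seq bool :=
  if w is x :: w' then
    if x == d then if i is i'.+1 then x :: del_step d i' w' else w'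
    else x :: del_step d i w'
  else [::].

Fixpoint face (d : bool) (i : nat) (psi : lpath) : lpath :=
  if psi is w :: psi' then
    if (i < count_mem d w)%N then del_step d i w :: psi'
    else w :: face d (i - count_mem d w) psi'
  else [::].

(* Likewise the cosimplicial structure in [m]: the [i]-th coface sends the
   [i]-th generating arrow to an identity, the [i]-th codegeneracy composes
   the [i]-th and the [(i + 1)]-st arrow. *)
Definition coface (i : nat) (psi : lpath) : lpath :=
  take i psi ++ [::] :: drop i psi.

Definition codegen (i : nat) (psi : lpath) : lpath :=
  take i psi ++ (nth [::] psi i ++ nth [::] psi i.+1) :: drop i.+2 psi.

(* The nondegenerate elements of [L^(3)(n1, n2; m)], a basis of the component
   of bidegree [(n1, n2)] of the coend
   [Y(m) = \int^(n1, n2) L^(3)(n1, n2; m) (x) delta(n1) (x) delta(n2)].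
   No arrow can have more than [n1 + n2 + 2] steps. *)
Definition L3_pred (n1 n2 m : nat)
    (psi : m.+1.-tuple ((n1 + n2).+2.-bseq bool)) : bool :=
  let p := [seq bseqval w | w <- psi] in in_L3 n1 n2 m p && nondegenerate p.

Definition L3 (n1 n2 m : nat) := {psi | @L3_pred n1 n2 m psi}.

Definition path_of (n1 n2 m : nat) (psi : L3 n1 n2 m) : lpath :=
  [seq bseqval w | w <- val psi].

Section TwoBracket.
Variable k : fieldType.

(* [Tot_delta(Y)] is the total complex of the conormalisation of [Y]: since a
   natural transformation on [delta] is determined by its values on the top
   simplices, an element of degree [d] is a family of elements of
   [Y(m)_(m + d)], [m >= 0], that are killed by all codegeneracies.  It is
   recorded by its coefficients on the nondegenerate lattice paths with
   [n1 + n2 = m + d]. *)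
Definition pchain := lpath -> k.

(* The linear extension of [F] to normalised chains; evaluated at nondegenerate
   [psi'], so that degenerate images are discarded. *)
Definition pushfwd (n1 n2 m : nat) (F : lpath -> lpath) (c : pchain)
    (psi' : lpath) : k :=
  \sum_(psi : L3 n1 n2 m | F (path_of psi) == psi') c (path_of psi).

Definition is_tot (d : nat) (c : pchain) : Prop :=
  forall n1 n2 m i (psi : L3 n1 n2 m), (n1 + n2 = m.+1 + d)%N -> (i < m.+1)%N ->
    pushfwd n1 n2 m.+1 (codegen i) c (path_of psi) = 0.

(* [d (x (x) y) = d x (x) y + (-1)^n1 x (x) d y] on [delta(n1) (x) delta(n2)]. *)
Definition int_diff (n1 n2 m : nat) (c : pchain) (psi : lpath) : k :=
  \sum_(i < n1.+2) (-1) ^+ i * pushfwd n1.+1 n2 m (face true i) c psi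
  + (-1) ^+ n1 *
    \sum_(i < n2.+2) (-1) ^+ i * pushfwd n1 n2.+1 m (face false i) c psi.

Definition cosimp_diff (n1 n2 m : nat) (c : pchain) (psi : lpath) : k :=
  if m is m'.+1 then
    \sum_(i < m.+1) (-1) ^+ i * pushfwd n1 n2 m' (coface i) c psi
  else 0.

(* [D phi = d_Y phi - (-1)^d phi d_delta] for [phi] of degree [d]. *)
Definition tot_diff (d n1 n2 m : nat) (c : pchain) (psi : lpath) : k :=
  int_diff n1 n2 m c psi - (-1) ^+ d * cosimp_diff n1 n2 m c psi.

Definition tot_cycle2 (z : pchain) : Prop :=
  is_tot 2 z /\
  forall n1 n2 m (psi : L3 n1 n2 m), (n1 + n2 = m.+1)%N ->
    tot_diff 2 n1 n2 m z (path_of psi) = 0.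

(* [z] is a cycle whose class generates the second homology. *)
Definition H2_generator (z : pchain) : Prop :=
  tot_cycle2 z /\
  forall z', tot_cycle2 z' -> exists (a : k) (w : pchain), is_tot 3 w /\
    forall n1 n2 m (psi : L3 n1 n2 m), (n1 + n2 = m + 2)%N ->
      z' (path_of psi) =
      a * z (path_of psi) + tot_diff 3 n1 n2 m w (path_of psi).

(* [coord d psi l] is [psi_d(l)], and [joyal d psi j] is the [l] in [0 .. m]
   such that [psi_d(l) <= j < psi_d(l + 1)]. *)
Definition coord (d : bool) (psi : lpath) (l : nat) : nat :=
  count_mem d (flatten (take l psi)).

Definition joyal (d : bool) (psi : lpath) (j : nat) : nat :=
  find (fun l => (coord d psi l <= j < coord d psi l.+1)%N)
       (iota 0 (size psi)).

Variable g : lieAlgebra k.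

(* the product of [E(n)] is composition of endomorphisms *)
Definition path_act (n1 n2 : nat) (psi : lpath) (a b : endofam g) : endofam g :=
  let a' := Emap n1 (joyal true psi) a in
  let b' := Emap n2 (joyal false psi) b in
  fun Xs t =>
    if head true (flatten psi) then a' Xs (b' Xs t) else b' Xs (a' Xs t).

(* The action of a degree 2 element [z] on [a] in [E(m)] and [b] in [E(n)],
   with value in [E(p)], where [m + n = p + 2]; the sign comes from moving [b]
   past a simplex of dimension [m]. *)
Definition two_bracket (z : pchain) (m n p : nat) (a b : endofam g) :
    endofam g :=
  fun Xs t => (-1) ^+ (m * n) *:
    \sum_(psi : L3 m n p)
      z (path_of psi) *: path_act m n (path_of psi) a b t.

End TwoBracket.

(* Main.v *)
From HB Require Import structures.
Require Import Defs.
From mathcomp Require Import all_boot all_algebra.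
From mathcomp Require Import ring.
From mathcomp.classical Require Import boolp.

Set Implicit Arguments.
Unset Strict Implicit.
Unset Printing Implicit Defensive.

Import GRing.Theory.
Local Open Scope ring_scope.

(** * Deciding identities in modules *)

Section ModuleExpr.
Variables (k : fieldType) (M : lmodType k).

Inductive mexpr :=
  | MVar of nat | MZero | MAdd of mexpr & mexpr | MOpp of mexpr
  | MScale of k & mexpr.

Fixpoint meval (env : seq M) (e : mexpr) : M :=
  match e with
  | MVar i => nth 0 env i
  | MZero => 0
  | MAdd e1 e2 => meval env e1 + meval env e2
  | MOpp e1 => - meval env e1
  | MScale c e1 => c *: meval env e1
  end.

Fixpoint mcoef (i : nat) (e : mexpr) : k :=
  match e with
  | MVar j => if eqn j i then 1 else 0
  | MZero => 0
  | MAdd e1 e2 => mcoef i e1 + mcoef i e2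
  | MOpp e1 => - mcoef i e1
  | MScale c e1 => c * mcoef i e1
  end.

Fixpoint msame (n : nat) (e1 e2 : mexpr) : Prop :=
  if n is n'.+1 then msame n' e1 e2 /\ mcoef n' e1 = mcoef n' e2 else True.

Lemma mevalE env e :
  meval env e = \sum_(i < size env) mcoef i e *: nth 0 env i.
Proof.
elim: e => [j||e1 IH1 e2 IH2|e1 IH1|c e1 IH1] /=; rewrite ?IH1 ?IH2.
- have [lt|le] := ltnP j (size env).
    rewrite (bigD1 (Ordinal lt)) //= (introT eqnP (erefl j)) scale1r big1 ?addr0 // => i ne.
    by case: eqnP => [e|_]; [rewrite -val_eqE /= e eqxx in ne | rewrite scale0r].
  rewrite nth_default // big1 // => i _; case: eqnP => [e|_]; last exact: scale0r.
  by move: (ltn_ord i); rewrite -e ltnNge le.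
- by rewrite big1 // => i _; rewrite scale0r.
- by rewrite -big_split; apply: eq_bigr => i _; rewrite scalerDl.
- by rewrite -sumrN; apply: eq_bigr => i _; rewrite scaleNr.
- by rewrite scaler_sumr; apply: eq_bigr => i _; rewrite scalerA.
Qed.

Lemma meval_eq env e1 e2 :
  msame (size env) e1 e2 -> meval env e1 = meval env e2.
Proof.
rewrite !mevalE => h; apply: eq_bigr => i _.
congr (_ *: _); case: i => i /=; elim: (size env) h => //= n IHn [h e].
by rewrite ltnS leq_eqVlt => /orP [/eqP -> //|]; apply: IHn.
Qed.

End ModuleExpr.

Ltac mhead t := lazymatch t with ?f _ => mhead f | _ => t end.

(* Atoms are compared up to conversion, since the structures inferred for them
   may differ. *)
Ltac msame_atom a x :=
  match goal with
  | _ => constr_eq a x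
  | _ => let f := mhead a in let h := mhead x in constr_eq f h; unify a x
  end.

Ltac mindex x env :=
  lazymatch env with
  | cons ?a ?env' =>
    match goal with
    | _ => let _ := match goal with _ => msame_atom a x end in constr:(0%N)
    | _ => let i := mindex x env' in constr:(S i)
    end
  end.

Ltac matoms e env :=
  lazymatch e with
  | (?a + ?b)%R => let env1 := matoms a env in matoms b env1
  | (- ?a)%R => matoms a env
  | (_ *: ?a)%R => matoms a env
  | (0)%R => env
  | _ => match goal with
         | _ => let _ := mindex e env in env
         | _ => constr:(cons e env)
         end
  end.

Ltac mreify k e env :=
  lazymatch e with
  | (?a + ?b)%R => let x := mreify k a env in let y := mreify k b env in
                   constr:(@MAdd k x y)
  | (- ?a)%R => let x := mreify k a env in constr:(@MOpp k x)
  | (?c *: ?a)%R => let x := mreify k a env in constr:(@MScale k c x)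
  | (0)%R => constr:(@MZero k)
  | _ => let i := mindex e env in constr:(@MVar k i)
  end.

(* Equality of two linear combinations, the coefficients being compared by
   [ring]. *)
Ltac module_in k M :=
  lazymatch goal with
  | |- ?a = ?b =>
    let env0 := matoms a constr:(@nil M) in
    let env := matoms b env0 in
    let x := mreify k a env in
    let y := mreify k b env in
    refine (@meval_eq k M env x y _); cbn [msame mcoef size eqn];
    repeat split; rewrite ?exprS; ring
  end.

(** * Algebras with quadratic relations *)

Section PresentedAlgebra.
Local Open Scope quotient_scope.
Variables (k : fieldType) (V : lmodType k) (br : option (V -> V -> V)).

Definition admissible (M : lmodType k) (f : seq V -> M) : Prop :=
  (forall l r c x y,
     f (l ++ (c *: x + y) :: r) = c *: f (l ++ x :: r) + f (l ++ y :: r)) /\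
  (if br is Some b then forall l r x y,
     f (l ++ b x y :: r) = f (l ++ x :: y :: r) - f (l ++ y :: x :: r)
   else True).

Definition fsum (M : lmodType k) (f : seq V -> M) (s : seq (k * seq V)) : M :=
  \sum_(p <- s) p.1 *: f p.2.

Definition peq (s t : seq (k * seq V)) : bool :=
  `[< forall (M : lmodType k) (f : seq V -> M),
        admissible f -> fsum f s = fsum f t >].

Lemma peq_refl : reflexive peq.
Proof. by move=> s; apply/asboolP. Qed.

Lemma peq_sym : symmetric peq.
Proof. by move=> s t; apply/asboolP/asboolP => h M f fa; rewrite h. Qed.

Lemma peq_trans : transitive peq.
Proof.
by move=> s t u /asboolP ts /asboolP su; apply/asboolP => M f fa; rewrite ts ?su.
Qed.

Canonical peq_equiv := EquivRel peq peq_refl peq_sym peq_trans.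

Definition palg : Type := {eq_quot peq_equiv}.
HB.instance Definition _ := Choice.on palg.

Lemma palgP s t : \pi_palg s = \pi_palg t <->
  forall (M : lmodType k) (f : seq V -> M),
    admissible f -> fsum f s = fsum f t.
Proof.
by split=> [/eqquotP/asboolP //|st]; apply/eqquotP/asboolP.
Qed.

(** The linear map induced by an admissible function on words. *)
Definition plift (M : lmodType k) (f : seq V -> M) (x : palg) : M :=
  locked (fsum f (repr x)).

Lemma pliftE (M : lmodType k) (f : seq V -> M) (x : palg) :
  plift f x = fsum f (repr x).
Proof. by rewrite /plift -lock. Qed.

Lemma plift_pi (M : lmodType k) (f : seq V -> M) s :
  admissible f -> plift f (\pi_palg s) = fsum f s.
Proof. by move=> fa; rewrite pliftE; apply: (palgP _ _).1 => //; rewrite reprK. Qed.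

Definition fscale (a : k) (s : seq (k * seq V)) := [seq (a * p.1, p.2) | p <- s].

Lemma fsum_cat (M : lmodType k) (f : seq V -> M) s t :
  fsum f (s ++ t) = fsum f s + fsum f t.
Proof. by rewrite /fsum big_cat. Qed.

Lemma fsum_scale (M : lmodType k) (f : seq V -> M) a s :
  fsum f (fscale a s) = a *: fsum f s.
Proof.
rewrite /fsum big_map scaler_sumr.
by apply: eq_bigr => p _; rewrite scalerA.
Qed.

Definition pzero : palg := locked (\pi_palg [::]).
Definition padd (x y : palg) : palg := locked (\pi_palg (repr x ++ repr y)).
Definition pscale (a : k) (x : palg) : palg := locked (\pi_palg (fscale a (repr x))).
Definition popp (x : palg) : palg := pscale (-1) x.

Lemma pext (x y : palg) :
  (forall (M : lmodType k) (f : seq V -> M),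
     admissible f -> plift f x = plift f y) -> x = y.
Proof.
move=> h; rewrite -[x]reprK -[y]reprK; apply/palgP => M f fa.
by rewrite -!pliftE h.
Qed.

Lemma plift0 (M : lmodType k) (f : seq V -> M) :
  admissible f -> plift f pzero = 0.
Proof. by move=> fa; rewrite /pzero -lock plift_pi // /fsum big_nil. Qed.

Lemma plift_add (M : lmodType k) (f : seq V -> M) x y :
  admissible f -> plift f (padd x y) = plift f x + plift f y.
Proof. by move=> fa; rewrite /padd -lock plift_pi // fsum_cat -!pliftE. Qed.

Lemma plift_scale (M : lmodType k) (f : seq V -> M) a x :
  admissible f -> plift f (pscale a x) = a *: plift f x.
Proof. by move=> fa; rewrite /pscale -lock plift_pi // fsum_scale -pliftE. Qed.

Lemma paddA : associative padd.
Proof. by move=> x y z; apply: pext => M f fa; rewrite !plift_add // addrA. Qed.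

Lemma paddC : commutative padd.
Proof. by move=> x y; apply: pext => M f fa; rewrite !plift_add // addrC. Qed.

Lemma padd0 : left_id pzero padd.
Proof.
by move=> x; apply: pext => M f fa; rewrite !plift_add // plift0 // add0r.
Qed.

Lemma paddN : left_inverse pzero popp padd.
Proof.
move=> x; apply: pext => M f fa.
by rewrite plift_add // plift_scale // plift0 // scaleN1r addNr.
Qed.

HB.instance Definition _ := GRing.isZmodule.Build palg paddA paddC padd0 paddN.

Lemma pscaleA a b x : pscale a (pscale b x) = pscale (a * b) x.
Proof. by apply: pext => M f fa; rewrite !plift_scale // scalerA. Qed.

Lemma pscale1 : left_id 1 pscale.
Proof. by move=> x; apply: pext => M f fa; rewrite !plift_scale // scale1r. Qed.

Lemma pscaleDr : right_distributive pscale +%R.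
Proof.
move=> a x y; apply: pext => M f fa.
by rewrite !(plift_scale, plift_add) // scalerDr.
Qed.

Lemma pscaleDl x : {morph pscale^~ x : a b / a + b}.
Proof.
move=> a b; apply: pext => M f fa.
by rewrite !(plift_scale, plift_add) // scalerDl.
Qed.

HB.instance Definition _ := GRing.Zmodule_isLmodule.Build k palg
  pscaleA pscale1 pscaleDr pscaleDl.

Lemma plift_linear (M : lmodType k) (f : seq V -> M) :
  admissible f -> linear (plift f).
Proof. by move=> fa a x y; rewrite plift_add // plift_scale. Qed.

Definition pword (w : seq V) : palg := locked (\pi_palg [:: (1, w)]).

Lemma plift_word (M : lmodType k) (f : seq V -> M) w :
  admissible f -> plift f (pword w) = f w.
Proof. by move=> fa; rewrite /pword -lock plift_pi // /fsum big_seq1 scale1r. Qed.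

Lemma pword_admissible : admissible pword.
Proof.
split=> [l r c x y|].
  apply: pext => M f fa; rewrite plift_add // plift_scale // !plift_word //.
  by case: fa.
case eb : br => [b|//] l r x y.
apply: pext => M f fa; rewrite plift_add // plift_scale // !plift_word //.
by case: (fa) => _; rewrite eb scaleN1r.
Qed.

Lemma palg_sum (x : palg) : x = \sum_(p <- repr x) p.1 *: pword p.2.
Proof.
apply: pext => M f fa; rewrite [LHS]pliftE.
have fl := plift_linear fa.
suff -> (s : seq (k * seq V)) :
    plift f (\sum_(p <- s) p.1 *: pword p.2 : palg) = fsum f s by [].
elim: s => [|p s IHs].
  by rewrite big_nil /fsum big_nil plift0.
by rewrite big_cons fl IHs plift_word // /fsum big_cons.
Qed.

Lemma palg_ind (P : palg -> Prop) :
  P 0 -> (forall a w x, P x -> P (a *: pword w + x)) -> forall x, P x.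
Proof.
move=> P0 PS x; rewrite (palg_sum x).
by elim: (repr x) => [|p s IHs]; rewrite ?big_nil ?big_cons //; apply: PS.
Qed.

Lemma admissible_ctx (M : lmodType k) (f : seq V -> M) l r :
  admissible f -> admissible (fun w => f (l ++ w ++ r)).
Proof.
case=> fl fb; split=> [l' r' c x y|].
  by rewrite -!catA !cat_cons !(catA l) fl.
move: fb; case: br => [b|//] fb l' r' x y.
by rewrite -!catA !cat_cons !(catA l) fb.
Qed.

Definition pmul (x y : palg) : palg :=
  locked (plift (fun w => plift (fun w' => pword (w ++ w')) y) x).

Lemma pmulE x y :
  pmul x y = plift (fun w => plift (fun w' => pword (w ++ w')) y) x.
Proof. by rewrite /pmul -lock. Qed.

Lemma pword_catl w : admissible (fun w' => pword (w ++ w')).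
Proof.
have := @admissible_ctx _ _ w [::] pword_admissible.
by under eq_fun do rewrite cats0.
Qed.

Lemma pmul_adm y : admissible (fun w => plift (fun w' => pword (w ++ w')) y).
Proof.
split=> [l r c x x'|].
  rewrite !pliftE /fsum scaler_sumr -big_split; apply: eq_bigr => p _ /=.
  rewrite -!catA !cat_cons pword_admissible.1.
  by rewrite scalerDr scalerA mulrC -scalerA.
have := pword_admissible.2; case: br => [b|//] bP l r x x'.
rewrite !pliftE /fsum -sumrB; apply: eq_bigr => p _.
by rewrite -!catA !cat_cons bP scalerBr.
Qed.

Lemma pmul_word w w' : pmul (pword w) (pword w') = pword (w ++ w').
Proof.
rewrite pmulE plift_word; last exact: pmul_adm.
by rewrite plift_word //; exact: pword_catl.
Qed.

Lemma pmul_linl y : linear (pmul^~ y).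
Proof.
move=> a x x'; rewrite !pmulE.
exact: (plift_linear (pmul_adm y)).
Qed.

Lemma lin0 (M N : lmodType k) (f : M -> N) : linear f -> f 0 = 0.
Proof. by move=> fl; rewrite -(subrr 0) (lin_sub fl) subrr. Qed.

Lemma pmul_linr x : linear (pmul x).
Proof.
move=> c y y'; elim/palg_ind: x => [|a w x IHx].
  by rewrite !(lin0 (pmul_linl _)) scaler0 addr0.
have e z : pmul (pword w) z = plift (fun w' => pword (w ++ w')) z.
  by rewrite pmulE plift_word //; exact: pmul_adm.
rewrite !pmul_linl IHx !e (plift_linear (pword_catl _)).
by rewrite !scalerDr !scalerA mulrC addrACA.
Qed.

Lemma pmulA : associative pmul.
Proof.
move=> x y z; elim/palg_ind: x => [|a w x IHx].
  by rewrite !(lin0 (pmul_linl _)).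
rewrite !pmul_linl IHx; congr (_ *: _ + _) => {IHx x}.
elim/palg_ind: y => [|b w' y IHy].
  by rewrite (lin0 (pmul_linl _)) !(lin0 (pmul_linr _)) (lin0 (pmul_linl _)).
rewrite !(pmul_linl, pmul_linr) IHy; congr (_ *: _ + _) => {IHy y}.
elim/palg_ind: z => [|c w'' z IHz]; first by rewrite !(lin0 (pmul_linr _)).
by rewrite !pmul_linr IHz !pmul_word catA.
Qed.

Lemma pmul1l : left_id (pword [::]) pmul.
Proof.
move=> x; elim/palg_ind: x => [|a w x IHx]; first exact: lin0 (pmul_linr _).
by rewrite pmul_linr IHx pmul_word.
Qed.

Lemma pmul1r : right_id (pword [::]) pmul.
Proof.
move=> x; elim/palg_ind: x => [|a w x IHx]; first exact: lin0 (pmul_linl _).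
by rewrite pmul_linl IHx pmul_word cats0.
Qed.

Lemma pmulDl : left_distributive pmul +%R.
Proof. by move=> x y z; have := pmul_linl z 1 x y; rewrite !scale1r. Qed.

Lemma pmulDr : right_distributive pmul +%R.
Proof. by move=> x y z; have := pmul_linr x 1 y z; rewrite !scale1r. Qed.

(** The coefficient of the empty word. *)
Definition paug : palg -> k^o := plift (fun w => (w == [::])%:R).

Lemma paug_adm : admissible (fun w : seq V => (w == [::])%:R : k^o).
Proof.
have e (l r : seq V) x : (l ++ x :: r == [::]) = false by case: l.
split=> [l r c x y|]; first by rewrite !e scaler0 addr0.
by case: br => [b|//] l r x y; rewrite !e subr0.
Qed.

Lemma pone_neq0 : pword [::] != 0.
Proof.
apply/eqP => /(congr1 paug).
rewrite /paug plift_word ?(lin0 (plift_linear _)); try exact: paug_adm.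
by apply/eqP; rewrite oner_eq0.
Qed.

HB.instance Definition _ := GRing.Zmodule_isNzRing.Build palg
  pmulA pmul1l pmul1r pmulDl pmulDr pone_neq0.

Lemma pscaleAl a (x y : palg) : a *: (x * y) = a *: x * y.
Proof.
have := pmul_linl y a x 0; rewrite addr0 => e.
by rewrite [RHS]e (lin0 (pmul_linl _)) addr0.
Qed.

Lemma pscaleAr a (x y : palg) : a *: (x * y) = x * (a *: y).
Proof.
have := pmul_linr x a y 0; rewrite addr0 => e.
by rewrite [RHS]e (lin0 (pmul_linr _)) addr0.
Qed.

HB.instance Definition _ := GRing.Lmodule_isLalgebra.Build k palg pscaleAl.
HB.instance Definition _ := GRing.Lalgebra_isAlgebra.Build k palg pscaleAr.

Definition pgen (v : V) : palg := pword [:: v].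

Lemma pgen_is_linear : linear pgen.
Proof. by move=> c x y; rewrite /pgen (pword_admissible.1 [::] [::]). Qed.

HB.instance Definition _ := GRing.isLinear.Build k V palg _ pgen pgen_is_linear.

Lemma pword_nil : pword [::] = 1. Proof. by []. Qed.

Lemma pword_cons v w : pword (v :: w) = pgen v * pword w.
Proof. by rewrite [RHS]pmul_word. Qed.

(** Induction on the length of words. *)
Lemma palg_rect (P : palg -> Prop) :
  P 1 -> (forall v x, P x -> P (pgen v * x)) ->
  (forall a x y, P x -> P y -> P (a *: x + y)) -> forall x, P x.
Proof.
move=> P1 PM PL; have P0 : P 0 by have := PL (-1) 1 1 P1 P1; rewrite scaleN1r addNr.
elim/palg_ind => // a w x Px; apply: PL => //.
by elim: w => [|v w Pw] //; rewrite pword_cons; apply: PM.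
Qed.

End PresentedAlgebra.

(** * Linear and bilinear maps *)

Definition bilin (k : fieldType) (M N P : lmodType k) (B : M -> N -> P) : Prop :=
  (forall y, linear (B^~ y)) /\ (forall x, linear (B x)).

Section Linearity.
Variables (k : fieldType).
Implicit Types (M N P : lmodType k) (A : algType k).

Lemma lin_id M : linear (fun x : M => x).
Proof. by []. Qed.

Lemma lin_zero M N : linear (fun _ : M => 0 : N).
Proof. by move=> c x y; rewrite scaler0 addr0. Qed.

Lemma lin_add M N (f g : M -> N) :
  linear f -> linear g -> linear (fun x => f x + g x).
Proof. by move=> fl gl c x y; rewrite fl gl scalerDr addrACA. Qed.

Lemma lin_opp M N (f : M -> N) : linear f -> linear (fun x => - f x).
Proof. by move=> fl c x y; rewrite fl opprD scalerN. Qed.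

Lemma lin_scale M N a (f : M -> N) : linear f -> linear (fun x => a *: f x).
Proof. by move=> fl c x y; rewrite fl scalerDr !scalerA mulrC. Qed.

Lemma lin_scal M N (f : M -> k^o) (v : N) :
  linear f -> linear (fun x => f x *: v).
Proof. by move=> fl c x y; rewrite fl scalerDl scalerA. Qed.

Lemma lin_mull M A a (f : M -> A) : linear f -> linear (fun x => a * f x).
Proof. by move=> fl c x y; rewrite fl mulrDr scalerAr. Qed.

Lemma lin_mulr M A a (f : M -> A) : linear f -> linear (fun x => f x * a).
Proof. by move=> fl c x y; rewrite fl mulrDl scalerAl. Qed.

Lemma lin_sum M N I (r : seq I) (F : I -> M -> N) :
  (forall i, linear (F i)) -> linear (fun x => \sum_(i <- r) F i x).
Proof.
move=> Fl c x y; rewrite scaler_sumr -big_split.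
by apply: eq_bigr => i _; rewrite Fl.
Qed.

Lemma lin_ap M N P (f : {linear N -> P}) (h : M -> N) :
  linear h -> linear (fun x => f (h x)).
Proof. by move=> hl c x y; rewrite hl linearP. Qed.

Lemma lin_comp M N P (f : N -> P) (h : M -> N) :
  linear f -> linear h -> linear (fun x => f (h x)).
Proof. by move=> fl hl c x y; rewrite hl fl. Qed.

Lemma lin_bl M N P (Q : lmodType k) (B : N -> P -> Q) (y : P) (h : M -> N) :
  bilin B -> linear h -> linear (fun x => B (h x) y).
Proof. by move=> Bl hl c x y'; rewrite hl Bl.1. Qed.

Lemma lin_br M N P (Q : lmodType k) (B : N -> P -> Q) (y : N) (h : M -> P) :
  bilin B -> linear h -> linear (fun x => B y (h x)).
Proof. by move=> Bl hl c x y'; rewrite hl Bl.2. Qed.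

Lemma bilin_linr M N P (B : M -> N -> P) x : bilin B -> linear (B x).
Proof. by case. Qed.

Lemma linD M N (f : M -> N) : linear f -> {morph f : x y / x + y}.
Proof. by move=> fl x y; have := fl 1 x y; rewrite !scale1r. Qed.

Lemma linZ M N (f : M -> N) : linear f -> forall a, {morph f : x / a *: x}.
Proof. by move=> fl a x; have := fl a x 0; rewrite (lin0 fl) !addr0. Qed.

Lemma linN M N (f : M -> N) : linear f -> {morph f : x / - x}.
Proof. by move=> fl x; rewrite -scaleN1r (linZ fl) scaleN1r. Qed.

Lemma lin_sumE M N I (r : seq I) (F : I -> M) (f : M -> N) :
  linear f -> f (\sum_(i <- r) F i) = \sum_(i <- r) f (F i).
Proof. by move=> fl; apply: (big_morph f (linD fl) (lin0 fl)). Qed.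

End Linearity.

(* Decides linearity of an expression built from linear maps in canonical
   form, products, scalings and sums. *)
Ltac lin :=
  lazymatch goal with
  | |- bilin _ => split=> ? /=; lin
  | |- forall _, _ => move=> ? /=; lin
  | _ => first
    [ assumption | apply: lin_id | apply: lin_zero
    | apply: lin_add; lin | apply: lin_opp; lin
    | apply: lin_sum; lin
    | apply: lin_mull; lin | apply: lin_mulr; lin
    | apply: lin_scale; lin | apply: lin_scal; lin
    | apply: lin_ap; lin 
    | (apply: lin_bl; [ assumption | lin]) | (apply: lin_br; [assumption | lin])]
  end.

(** * The tensor algebra *)

Notation talg V := (@palg _ V None).

Section TensorAlgebra.
Variables (k : fieldType) (V : lmodType k).
Implicit Types (v : V) (x y t : talg V).
Local Notation T := (talg V).
Local Notation "[ v ]" := (@pgen k V None v) (at level 0, v at level 99).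

Section Case.
Variables (M : lmodType k) (m0 : M) (F : V -> T -> M).

Definition tcase_word (w : seq V) : M :=
  if w is v :: w' then F v (pword None w') else m0.

Lemma tcase_adm : bilin F -> admissible None tcase_word.
Proof.
move=> [Fl Fr]; split=> //; elim=> [|v l _] r c x y /=; first exact: Fl.

by rewrite (pword_admissible None).1 Fr.
Qed.

(** Definition by cases along [T = k (+) V (x) T]; the guard makes it linear
    unconditionally. *)
Definition tcase : T -> M :=
  if `[< bilin F >] then plift tcase_word else fun _ => 0.

Lemma tcase_is_linear : linear tcase.
Proof.
rewrite /tcase; case: asboolP => [Fb|_]; last exact: lin_zero.
exact/plift_linear/tcase_adm.
Qed.

HB.instance Definition _ := GRing.isLinear.Build k T M _ tcase tcase_is_linear.

Lemma tcase1 : bilin F -> tcase 1 = m0.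
Proof.
by move=> Fb; rewrite /tcase asboolT // plift_word //; apply: tcase_adm.
Qed.

Lemma tcaseM v x : bilin F -> tcase ([v] * x) = F v x.
Proof.
move=> Fb; elim/palg_ind: x => [|a w x IHx].
  by rewrite mulr0 linear0 (lin0 (Fb.2 v)).
rewrite mulrDr -scalerAr tcase_is_linear Fb.2 IHx; congr (_ *: _ + _).
rewrite -pword_cons /tcase asboolT //.
by rewrite plift_word //; apply: tcase_adm.
Qed.

End Case.

Lemma tcase_linF (M N : lmodType k) (G : N -> V -> T -> M) t :
  (forall z, bilin (G z)) -> (forall v x, linear (fun z => G z v x)) ->
  linear (fun z => tcase 0 (G z) t).
Proof.
move=> Gb Gl c z z'; elim/palg_rect: t => [|v x _|a x y IHx IHy].
- by rewrite !tcase1 // scaler0 addr0.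
- by rewrite !tcaseM // Gl.
- rewrite !(tcase_is_linear _ _ a) IHx IHy !scalerDr !scalerA (mulrC a).
  by rewrite addrACA.
Qed.

(** The derivation of [T] extending a linear endomorphism of [V]. *)
Section Derivation.
Variables (D : V -> V) (Dl : linear D).

Fixpoint der_word (w : seq V) : T :=
  if w is v :: w' then [D v] * pword None w' + [v] * der_word w' else 0.

Lemma der_adm : admissible None der_word.
Proof.
have gl := @pgen_is_linear k V None.
split=> //; elim=> [|v l IHl] r c x y /=.
  by rewrite Dl !gl !mulrDl -!scalerAl scalerDr addrACA.
rewrite IHl (pword_admissible None).1 !mulrDr -!scalerAr.
by rewrite scalerDr addrACA.
Qed.

Definition der : T -> T := plift der_word.

Lemma der_is_linear : linear der.
Proof. exact/plift_linear/der_adm. Qed.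

Lemma der1 : der 1 = 0.
Proof. by rewrite /der plift_word //; apply: der_adm. Qed.

Lemma derC v t : der ([v] * t) = [D v] * t + [v] * der t.
Proof.
elim/palg_ind: t => [|a w t IHt].
  by rewrite !mulr0 !(lin0 der_is_linear) mulr0 addr0.
rewrite !mulrDr -!scalerAr !der_is_linear IHt -pword_cons /der !plift_word.
- by rewrite /= !scalerDr mulrDr -scalerAr addrACA.
- exact: der_adm.
- exact: der_adm.
Qed.

End Derivation.

(** The span of the words [v1 ... vn] with [vi] in the [i]-th subset. *)
Inductive tspan : seq (V -> Prop) -> T -> Prop :=
| ts_nil a : tspan [::] (a *: 1)
| ts_cons P Ps v x : P v -> tspan Ps x -> tspan (P :: Ps) ([v] * x)
| ts_zero Ps : tspan Ps 0
| ts_lin Ps a x y : tspan Ps x -> tspan Ps y -> tspan Ps (a *: x + y).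

Lemma tspan_nil x : tspan [::] x -> exists a, x = a *: 1.
Proof.
move eP : [::] => Ps h; elim: h eP => // {Ps x}.
- by move=> a _; exists a.
- by move=> Ps _; exists 0; rewrite scale0r.
- move=> Ps a x y _ IHx _ IHy eP; have [b ->] := IHx eP; have [c ->] := IHy eP.
  by exists (a * b + c); rewrite scalerDl scalerA.
Qed.

Lemma tspan_cons_ind P Ps (Q : T -> Prop) :
  Q 0 -> (forall a x y, Q x -> Q y -> Q (a *: x + y)) ->
  (forall v x, P v -> tspan Ps x -> Q ([v] * x)) ->
  forall x, tspan (P :: Ps) x -> Q x.
Proof.
move=> Q0 QL QM x; move eP : (P :: Ps) => Ps' h; elim: h eP => // {Ps' x}.
- by move=> P' Ps' v x Pv Psx _ [eP ePs]; apply: QM; rewrite ?eP ?ePs.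
- move=> Ps' a x y _ IHx _ IHy eP; exact: QL (IHx eP) (IHy eP).
Qed.

Lemma tspan_eq P Ps (M : lmodType k) (f g : T -> M) :
  linear f -> linear g ->
  (forall v x, P v -> tspan Ps x -> f ([v] * x) = g ([v] * x)) ->
  forall x, tspan (P :: Ps) x -> f x = g x.
Proof.
move=> fl gl; apply: tspan_cons_ind; first by rewrite !lin0.
by move=> a x y ex ey; rewrite fl gl ex ey.
Qed.

Lemma tspan_map P Ps Qs (f : T -> T) :
  linear f ->
  (forall v x, P v -> tspan Ps x -> tspan Qs (f ([v] * x))) ->
  forall x, tspan (P :: Ps) x -> tspan Qs (f x).
Proof.
move=> fl; apply: tspan_cons_ind; first by rewrite lin0 //; apply: ts_zero.
by move=> a x y ex ey; rewrite fl; apply: ts_lin.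
Qed.

Lemma tspanD Ps x y : tspan Ps x -> tspan Ps y -> tspan Ps (x + y).
Proof. by move=> sx sy; rewrite -[x]scale1r; apply: ts_lin. Qed.

Lemma tspanZ Ps a x : tspan Ps x -> tspan Ps (a *: x).
Proof. by move=> sx; rewrite -[_ *: _]addr0; apply: ts_lin (ts_zero _). Qed.

Lemma tspanN Ps x : tspan Ps x -> tspan Ps (- x).
Proof. by move=> sx; rewrite -scaleN1r; apply: tspanZ. Qed.

Lemma tspan_sum Ps I (r : seq I) (F : I -> T) :
  (forall i, tspan Ps (F i)) -> tspan Ps (\sum_(i <- r) F i).
Proof.
by move=> h; elim/big_rec: _ => [|i x _ sx]; [apply: ts_zero | apply: tspanD].
Qed.

Lemma tspan_cat Ps Qs x y :
  tspan Ps x -> tspan Qs y -> tspan (Ps ++ Qs) (x * y).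
Proof.
elim=> {Ps x} [a|P Ps v x Pv _ IHx|Ps|Ps a x x' _ IHx _ IHx'] sy /=.
- by rewrite -scalerAl mul1r; apply: tspanZ.
- by rewrite -mulrA; apply: ts_cons => //; apply: IHx.
- by rewrite mul0r; apply: ts_zero.
- by rewrite mulrDl -scalerAl; apply: ts_lin; [apply: IHx | apply: IHx'].
Qed.

Lemma tspan1 : tspan [::] 1.
Proof. by rewrite -[1]scale1r; apply: ts_nil. Qed.

(* The homogeneous component of degree [n]. *)
Definition homog n : T -> Prop := tspan (nseq n (fun=> True)).

Lemma tspan_sub Ps Qs x :
  size Ps = size Qs ->
  (forall i v, nth (fun=> True) Ps i v -> nth (fun=> True) Qs i v) ->
  tspan Ps x -> tspan Qs x.
Proof.
move=> sz sub h; elim: h Qs sz sub => {Ps x} [a|P Ps v x Pv _ IHx|Ps|Ps a x x' _ IHx _ IHx'] Qs sz sub.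
- by rewrite (size0nil (esym sz)); apply: ts_nil.
- case: Qs sz sub => // Q Qs [sz] sub; apply: ts_cons; first exact: (sub 0%N).
  by apply: IHx => // i; apply: (sub i.+1).
- exact: ts_zero.
- by apply: ts_lin; [apply: IHx | apply: IHx'].
Qed.

Lemma tspan_homog Ps x : tspan Ps x -> homog (size Ps) x.
Proof.
by apply: tspan_sub => [|i v _]; rewrite ?size_nseq // nth_nseq if_same.
Qed.

End TensorAlgebra.

(** * The enveloping algebra and its coproduct *)

Notation ualg g := (palg (Some (@lie_br _ g))).

Section Enveloping.
Variables (k : fieldType) (g : lieAlgebra k).
Local Notation U := (ualg g).
Implicit Types (x y : g) (u : U).

Definition ugen : g -> U := pgen (Some (@lie_br _ g)).
HB.instance Definition _ := GRing.Linear.on ugen.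

Lemma ugen_lin : linear ugen.
Proof. exact: pgen_is_linear. Qed.

Lemma ugen_br x y : ugen (lie_br x y) = ugen x * ugen y - ugen y * ugen x.
Proof.
have := (pword_admissible (Some (@lie_br _ g))).2 [::] [::] x y.
by rewrite !pword_cons pword_nil !mulr1.
Qed.

Lemma u_ind (P : U -> Prop) :
  P 1 -> (forall y u, P u -> P (ugen y * u)) ->
  (forall a u v, P u -> P v -> P (a *: u + v)) -> forall u, P u.
Proof. exact: palg_rect. Qed.

Definition uact y u : U := ugen y * u.

Lemma uact_linl u : linear (uact^~ u).
Proof. by rewrite /uact; lin. Qed.

Lemma uact_linr y : linear (uact y).
Proof. by rewrite /uact; lin. Qed.

Lemma uact_br x y u :
  uact (lie_br x y) u = uact x (uact y u) - uact y (uact x u).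
Proof. by rewrite /uact ugen_br mulrBl !mulrA. Qed.

Definition urep : rep g := Rep uact_linl uact_linr uact_br.

(** [ev v u] is the action of [u] on [v]: the representation [urep] is freely
    generated by [1]. *)
Section Evaluation.
Variable X : rep g.

Definition ev (v : X) : U -> X :=
  plift (fun w => foldr (@rep_act _ _ X) v w).

Lemma ev_adm v : admissible (Some (@lie_br _ g)) (fun w => foldr (@rep_act _ _ X) v w).
Proof.
split=> [l r c x y|l r x y].
  by elim: l => [|z l IHl] /=; rewrite ?act_linl // IHl act_linr.
by elim: l => [|z l IHl] /=; rewrite ?act_br // IHl (lin_sub (act_linr _)).
Qed.

Lemma ev_is_linear v : linear (ev v).
Proof. exact/plift_linear/ev_adm. Qed.

HB.instance Definition _ v := GRing.isLinear.Build k U X _ (ev v) (ev_is_linear v).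

Lemma ev1 v : ev v 1 = v.
Proof. by rewrite /ev plift_word //; apply: ev_adm. Qed.

Lemma evM v y u : ev v (ugen y * u) = rep_act y (ev v u).
Proof.
elim/palg_ind: u => [|a w u IHu].
  by rewrite mulr0 !linear0 (lin0 (act_linr y)).
rewrite mulrDr -scalerAr !ev_is_linear act_linr IHu; congr (_ *: _ + _).
by rewrite -pword_cons /ev !plift_word //; apply: ev_adm.
Qed.

Lemma ev_linr u : linear (ev^~ u).
Proof.
move=> c v w; elim/u_ind: u => [|y u IHu|a u u' IHu IHu'].
- by rewrite !ev1.
- by rewrite !evM IHu act_linr.
- rewrite !(ev_is_linear _ a) IHu IHu' !scalerDr !scalerA (mulrC a).
  by rewrite addrACA.
Qed.

Definition ev_hom v : rep_hom urep X := @Defs.Hom k g urep X (ev v) (ev_is_linear v) (fun y u => evM v y u).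

End Evaluation.

Lemma ev_urep u v : ev (v : urep) u = u * v.
Proof.
elim/u_ind: u => [|y u IHu|a u u' IHu IHu'].
- by rewrite ev1 mul1r.
- by rewrite evM IHu /= /uact mulrA.
- by rewrite ev_is_linear IHu IHu' mulrDl scalerAl.
Qed.

Definition eps : U -> k^o := @paug k g (Some (@lie_br _ g)).

Lemma eps_is_linear : linear eps.
Proof. exact/plift_linear/paug_adm. Qed.
HB.instance Definition _ := GRing.isLinear.Build k U k^o _ eps eps_is_linear.

Lemma eps1 : eps 1 = 1.
Proof. by rewrite /eps /paug plift_word //; apply: paug_adm. Qed.

Lemma eps_gen y u : eps (ugen y * u) = 0.
Proof.
elim/palg_ind: u => [|a w u IHu]; first by rewrite mulr0 linear0.
rewrite mulrDr -scalerAr eps_is_linear IHu -pword_cons /eps /paug.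
by rewrite plift_word ?scaler0 ?addr0 //; apply: paug_adm.
Qed.

Lemma epsM u v : eps (u * v) = eps u * eps v.
Proof.
elim/u_ind: u => [|y u IHu|a u u' IHu IHu'].
- by rewrite mul1r eps1 mul1r.
- by rewrite -mulrA !eps_gen mul0r.
- by rewrite mulrDl -scalerAl !eps_is_linear IHu IHu' mulrDl scalerAl.
Qed.

Definition delta : U -> tens U U := ev ((1 : urep) *t (1 : urep) : rep_tens urep urep).

End Enveloping.

(** [\sum B u' u''] over the coproduct [\sum u' (x) u''] of [u]; this is linear
    in [u] as soon as [B] is bilinear. *)
HB.lock Definition csum (k : fieldType) (g : lieAlgebra k) (M : lmodType k)
    (B : ualg g -> ualg g -> M) (u : ualg g) : M :=
  \sum_(p <- repr (delta u)) B p.1 p.2.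

Section CoproductSums.
Variables (k : fieldType) (g : lieAlgebra k).
Local Notation U := (ualg g).
Implicit Types (x y : g) (u v : U).

Section Csum.
Variables (M : lmodType k).
Implicit Types (B C : U -> U -> M).

Lemma csumE B u : csum B u = tlift B (delta u). Proof. by rewrite unlock. Qed.

Lemma csum_linear B : bilin B -> linear (csum B).
Proof.
move=> Bb c u v; rewrite !csumE {1}/delta (ev_is_linear _ c u v).
by rewrite (tlift_linear Bb.1 Bb.2).
Qed.

Lemma csumP B c u v :
  bilin B -> csum B (c *: u + v) = c *: csum B u + csum B v.
Proof. by move=> Bb; apply: csum_linear. Qed.

Lemma csum_lin B (N : lmodType k) (h : N -> U) :
  bilin B -> linear h -> linear (fun z => csum B (h z)).
Proof. by move=> Bb hl c z t; rewrite hl csum_linear. Qed.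

Lemma csum_linB (N : lmodType k) (B : N -> U -> U -> M) u :
  (forall a b, linear (fun z => B z a b)) -> linear (fun z => csum (B z) u).
Proof. by move=> Bl; rewrite unlock; apply: lin_sum => p; apply: Bl. Qed.

Lemma csum1 B : bilin B -> csum B 1 = B 1 1.
Proof. by move=> Bb; rewrite csumE /delta ev1 (tlift_pure Bb.1 Bb.2). Qed.

Lemma csumM B y u : bilin B ->
  csum B (ugen y * u) = csum (fun a b => B (ugen y * a) b + B a (ugen y * b)) u.
Proof.
move=> Bb; rewrite [LHS]csumE /delta evM /= unlock.
rewrite /tact {2}/tlift (lin_sumE _ _ (tlift_linear Bb.1 Bb.2)).
apply: eq_bigr => p _.
by rewrite (linD (tlift_linear Bb.1 Bb.2)) !(tlift_pure Bb.1 Bb.2).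
Qed.

Lemma eq_csum B C u : (forall a b, B a b = C a b) -> csum B u = csum C u.
Proof. by move=> e; rewrite unlock; apply: eq_bigr => p _; apply: e. Qed.

Lemma csumD B C u : csum (fun a b => B a b + C a b) u = csum B u + csum C u.
Proof. by rewrite unlock big_split. Qed.

Lemma csumN B u : csum (fun a b => - B a b) u = - csum B u.
Proof. by rewrite unlock sumrN. Qed.

Lemma csum0 u : csum (fun _ _ => 0 : M) u = 0.
Proof. by rewrite unlock big1. Qed.

Lemma csumZ B u c : csum (fun a b => c *: B a b) u = c *: csum B u.
Proof. by rewrite unlock scaler_sumr. Qed.

End Csum.

Lemma csum_ap (M N : lmodType k) (B : U -> U -> M) (f : M -> N) u :
  linear f -> f (csum B u) = csum (fun a b => f (B a b)) u.
Proof. by rewrite unlock; apply: lin_sumE. Qed.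

End CoproductSums.

Ltac linc :=
  lazymatch goal with
  | |- bilin _ => split=> ? /=; linc
  | |- forall _, _ => move=> ? /=; linc
  | _ => first
    [ assumption | apply: lin_id | apply: lin_zero
    | apply: lin_add; linc | apply: lin_opp; linc
    | apply: csum_linB; linc
    | (apply: csum_lin; linc)
    | apply: lin_sum; linc
    | apply: lin_mull; linc | apply: lin_mulr; linc
    | apply: lin_scale; linc | apply: lin_scal; linc
    | match goal with H : linear _ |- _ => apply: (lin_comp H); linc end
    | (apply: lin_bl; [ assumption | linc]) | (apply: lin_br; [assumption | linc])
    | apply: lin_ap; linc ]
  end.

Section Coproduct.
Variables (k : fieldType) (g : lieAlgebra k).
Local Notation U := (ualg g).
Implicit Types (x y : g) (u v : U).

Lemma csumC (M : lmodType k) (B : U -> U -> M) u :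
  bilin B -> csum B u = csum (fun a b => B b a) u.
Proof.
elim/u_ind: u M B => [|y u IHu|c u v IHu IHv] M B Bb.
- by rewrite !csum1 //; linc.
- rewrite !csumM //; last by linc.
  by rewrite IHu; [apply: eq_csum => a b; rewrite addrC | linc].
- have Bb' : bilin (fun a b => B b a) by linc.
  by rewrite !csumP // (IHu _ _ Bb) (IHv _ _ Bb).
Qed.

Definition trilin (M : lmodType k) (C : U -> U -> U -> M) : Prop :=
  [/\ forall b c, linear (fun a => C a b c),
      forall a c, linear (fun b => C a b c) &
      forall a b, linear (fun c => C a b c)].

Lemma trilinP (M : lmodType k) (C : U -> U -> U -> M) : trilin C ->
  [/\ forall c, bilin (fun a b => C a b c), forall a, bilin (C a),
      bilin (fun a b => csum (fun a' a'' => C a' a'' b) a) &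
      bilin (fun a b => csum (C a) b)].
Proof.
case=> C1 C2 C3.
have Cl c : bilin (fun a b => C a b c) by split=> ?; [apply: C1 | apply: C2].
have Cr a : bilin (C a) by split=> ?; [apply: C2 | apply: C3].
split=> //; split=> z.
- exact: csum_linear (Cl z).
- by apply: (@csum_linB _ _ _ _ (fun b a' a'' => C a' a'' b)) => a b; apply: C3.
- by apply: (@csum_linB _ _ _ _ C) => a b; apply: C1.
- exact: csum_linear (Cr z).
Qed.

Lemma csumA (M : lmodType k) (C : U -> U -> U -> M) u : trilin C ->
  csum (fun a b => csum (fun a' a'' => C a' a'' b) a) u =
  csum (fun a b => csum (C a) b) u.
Proof.
elim/u_ind: u M C => [|y u IHu|c u v IHu IHv] M C Ct;
  have [Cl Cr Bl Br] := trilinP Ct.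
- by rewrite !csum1.
- rewrite !csumM //.
  transitivity (csum (fun a b => csum (fun a' a'' =>
    C (ugen y * a') a'' b + C a' (ugen y * a'') b + C a' a'' (ugen y * b)) a) u).
    by apply: eq_csum => a b; rewrite csumM // -csumD.
  rewrite (IHu _ (fun a b c => C (ugen y * a) b c + C a (ugen y * b) c + C a b (ugen y * c))).
    by apply: eq_csum => a b; rewrite csumM // -csumD; apply: eq_csum => ? ?; rewrite addrA.
  case: Ct => C1 C2 C3; have hl := lin_mull (ugen y) (@lin_id _ U).
  by split=> a b; (apply: lin_add; [apply: lin_add|]);
    first [exact: C1 | exact: C2 | exact: C3 | exact: lin_comp (C1 a b) hl
          | exact: lin_comp (C2 a b) hl | exact: lin_comp (C3 a b) hl].
- by rewrite !csumP // (IHu _ _ Ct) (IHv _ _ Ct).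
Qed.

Lemma csum_mul (M : lmodType k) (B : U -> U -> M) u v : bilin B ->
  csum B (u * v) = csum (fun a b => csum (fun c d => B (a * c) (b * d)) v) u.
Proof.
elim/u_ind: u M B => [|y u IHu|c u w IHu IHw] M B Bb.
- rewrite csum1 ?mul1r; last by linc.
  by apply: eq_csum => a b; rewrite !mul1r.
- rewrite -mulrA csumM // IHu; last by linc.
  rewrite csumM; last by linc.
  apply: eq_csum => a b; rewrite -csumD; apply: eq_csum => c d.
  by rewrite !mulrA.
- by rewrite mulrDl -scalerAl !csumP ?IHu ?IHw //; linc.
Qed.

Lemma csum_epsl (M : lmodType k) (f : U -> M) u :
  linear f -> csum (fun a b => eps a *: f b) u = f u.
Proof.
elim/u_ind: u M f => [|y u IHu|c u w IHu IHw] M f fl.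
- by rewrite csum1 ?eps1 ?scale1r //; linc.
- rewrite csumM; last by linc.
  rewrite -(IHu _ (fun v => f (ugen y * v))); last by linc.
  by apply: eq_csum => a b; rewrite eps_gen scale0r add0r.
- by rewrite csumP ?(IHu _ _ fl) ?(IHw _ _ fl) ?fl //; linc.
Qed.

Lemma csum_epsr (M : lmodType k) (f : U -> M) u :
  linear f -> csum (fun a b => eps b *: f a) u = f u.
Proof. by move=> fl; rewrite csumC; [rewrite csum_epsl | linc]. Qed.

Definition uad y u : U := ugen y * u - u * ugen y.

Lemma uad_is_linear y : linear (uad y).
Proof. by rewrite /uad; linc. Qed.
HB.instance Definition _ y := GRing.isLinear.Build k U U _ (uad y) (uad_is_linear y).

Lemma uad1 y : uad y 1 = 0.
Proof. by rewrite /uad mulr1 mul1r subrr. Qed.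

Lemma uadM y u v : uad y (u * v) = uad y u * v + u * uad y v.
Proof. by rewrite /uad mulrBl mulrBr !mulrA addrA subrK. Qed.

Lemma eps_uad y u : eps (uad y u) = 0.
Proof. by rewrite /uad (lin_sub (@eps_is_linear _ g)) !epsM mulrC subrr. Qed.

Lemma csum_gen (M : lmodType k) (B : U -> U -> M) y :
  bilin B -> csum B (ugen y) = B (ugen y) 1 + B 1 (ugen y).
Proof.
by move=> Bb; rewrite -[ugen y]mulr1 csumM // csum1 ?mulr1 //; linc.
Qed.

Lemma csum_uad (M : lmodType k) (B : U -> U -> M) y u : bilin B ->
  csum B (uad y u) = csum (fun a b => B (uad y a) b + B a (uad y b)) u.
Proof.
move=> Bb; rewrite /uad (lin_sub (csum_linear Bb)) csumM // csum_mul //.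
rewrite -csumN -csumD; apply: eq_csum => a b.
rewrite csum_gen ?mulr1; last by linc.
by rewrite (lin_sub (Bb.1 _)) (lin_sub (Bb.2 _)) opprD addrACA.
Qed.

End Coproduct.

(** * The Eulerian projection *)

Section Eulerian.
Variables (k : fieldType) (g : lieAlgebra k).
Local Notation U := (ualg g).
Implicit Types (x y : g) (u v : U).

Definition psi : U -> U := csum (fun a b => a * b).

Lemma mul_bilin : bilin (fun a b : U => a * b).
Proof. by linc. Qed.

Lemma psi_is_linear : linear psi.
Proof. exact/csum_linear/mul_bilin. Qed.
HB.instance Definition _ := GRing.isLinear.Build k U U _ psi psi_is_linear.

Lemma psi1 : psi 1 = 1.
Proof. by rewrite /psi csum1 ?mulr1 //; exact: mul_bilin. Qed.

Lemma psi_gen y : psi (ugen y) = 2%:R *: ugen y.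
Proof.
by rewrite /psi csum_gen ?mulr1 ?mul1r ?scaler_nat ?mulr2n //; exact: mul_bilin.
Qed.

Lemma psiM y u :
  psi (ugen y * u) = 2%:R *: (ugen y * psi u) - csum (fun a b => uad y a * b) u.
Proof.
rewrite /psi csumM; last exact: mul_bilin.
rewrite (csum_ap _ _ (lin_mull (ugen y) (@lin_id _ U))) -csumZ -csumN -csumD.
apply: eq_csum => a b; rewrite /uad mulrBl opprB scaler_nat mulr2n.
by rewrite !mulrA addrACA subrr addr0.
Qed.

Lemma psi_uad y u : psi (uad y u) = uad y (psi u).
Proof.
rewrite /psi csum_uad; last exact: mul_bilin.
rewrite (csum_ap _ _ (@uad_is_linear _ _ y)).
by apply: eq_csum => a b; rewrite uadM.
Qed.

Lemma eps_psi u : eps (psi u) = eps u.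
Proof.
rewrite -[RHS](csum_epsl u (@eps_is_linear k g)) /psi.
rewrite (csum_ap _ _ (@eps_is_linear k g)).
by apply: eq_csum => a b; rewrite epsM.
Qed.

(** [Fl n] is spanned by the words of length less than [n]. *)
Inductive Fl : nat -> U -> Prop :=
| Fl_zero n : Fl n 0
| Fl_one n : Fl n.+1 1
| Fl_gen n y u : Fl n u -> Fl n.+1 (ugen y * u)
| Fl_lin n a u v : Fl n u -> Fl n v -> Fl n (a *: u + v).

Lemma FlW n m u : (n <= m)%N -> Fl n u -> Fl m u.
Proof.
move=> le h; elim: h m le => {n u} [n|n|n y u _ IHu|n a u v _ IHu _ IHv] m le.
- exact: Fl_zero.
- by case: m le => // m _; apply: Fl_one.
- by case: m le => // m le; apply: Fl_gen; apply: IHu.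
- by apply: Fl_lin; [apply: IHu | apply: IHv].
Qed.

Lemma Fl0 u : Fl 0 u -> u = 0.
Proof.
move e : 0%N => n h; elim: h e => //= {n u} n a u v _ IHu _ IHv e.
by rewrite IHu // IHv // scaler0 addr0.
Qed.

Lemma FlD n u v : Fl n u -> Fl n v -> Fl n (u + v).
Proof. by rewrite -{2}[u]scale1r; apply: Fl_lin. Qed.

Lemma FlZ n a u : Fl n u -> Fl n (a *: u).
Proof. by move=> h; rewrite -[_ *: _]addr0; apply: Fl_lin (Fl_zero _). Qed.

Lemma FlB n u v : Fl n u -> Fl n v -> Fl n (u - v).
Proof. by move=> fu fv; rewrite addrC -scaleN1r; apply: Fl_lin. Qed.

Lemma Fl_sum n (I : eqType) (r : seq I) (F : I -> U) :
  (forall i, i \in r -> Fl n (F i)) -> Fl n (\sum_(i <- r) F i).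
Proof.
move=> h; rewrite big_seq; elim/big_rec: _ => [|i x ir sx]; first exact: Fl_zero.
by apply: FlD => //; apply: h.
Qed.

Lemma Fl_exists u : exists n, Fl n u.
Proof.
elim/u_ind: u => [|y u [n fu]|a u v [n fu] [m fv]].
- by exists 1%N; apply: Fl_one.
- by exists n.+1; apply: Fl_gen.
- exists (n + m)%N; apply: Fl_lin; [move: fu|move: fv]; apply: FlW.
    exact: leq_addr.
  exact: leq_addl.
Qed.

Lemma Fl_ugen y : Fl 2 (ugen y).
Proof. by rewrite -[ugen y]mulr1; apply/Fl_gen/Fl_one. Qed.

Lemma Fl_mul n m u v : Fl n u -> Fl m.+1 v -> Fl (n + m) (u * v).
Proof.
move=> h fv; elim: h => {n u} [n|n|n y u _ IHu|n a u w _ IHu _ IHw].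
- by rewrite mul0r; apply: Fl_zero.
- by rewrite mul1r; apply: FlW fv; rewrite addSn ltnS leq_addl.
- by rewrite -mulrA addSn; apply: Fl_gen.
- by rewrite mulrDl -scalerAl; apply: Fl_lin.
Qed.

Lemma Fl_mulr n m u v : Fl n.+1 u -> Fl m v -> Fl (n + m) (u * v).
Proof.
case: m => [|m] fu fv; first by rewrite (Fl0 fv) mulr0; apply: Fl_zero.
by rewrite -addSnnS; apply: Fl_mul.
Qed.

Lemma uad_gen y x : uad y (ugen x) = ugen (lie_br y x).
Proof. by rewrite /uad ugen_br. Qed.

Lemma Fl_uad n y u : Fl n u -> Fl n (uad y u).
Proof.
elim=> {n u} [n|n|n x u fu IHu|n a u v _ IHu _ IHv].
- by rewrite linear0; apply: Fl_zero.
- by rewrite uad1; apply: Fl_zero.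
- by rewrite uadM uad_gen; apply: FlD; apply: Fl_gen.
- by rewrite (uad_is_linear y); apply: Fl_lin.
Qed.

Lemma Fl2P u : Fl 2 u -> exists a y, u = a *: 1 + ugen y.
Proof.
have F1 v : Fl 1 v -> exists a, v = a *: 1.
  move e : 1%N => n h; elim: h e => {n v} [n|n|n y w fw _|n a w w' _ IHu _ IHv] e.
  - by exists 0; rewrite scale0r.
  - by exists 1; rewrite scale1r.
  - by case: e fw => <- /Fl0 ->; exists 0; rewrite mulr0 scale0r.
  - have [b ->] := IHu e; have [c ->] := IHv e.
    by exists (a * b + c); rewrite scalerDl scalerA.
move e : 2%N => n h; elim: h e => {n u} [n|n|n y u fu _|n a u v _ IHu _ IHv] e.
- by exists 0, 0; rewrite scale0r linear0 addr0.
- by exists 1, 0; rewrite scale1r linear0 addr0.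
- case: e fu => <- /F1 [a ->]; exists 0, (a *: y).
  by rewrite scale0r add0r linearZ /= -scalerAr mulr1.
- have [b [y ->]] := IHu e; have [c [z ->]] := IHv e.
  exists (a * b + c), (a *: y + z).
  by rewrite scalerDl (@ugen_lin _ g) scalerDr scalerA addrACA.
Qed.

(** The terms of the coproduct of a word of length [n], sorted by the length of
    their left factor: 0, 1, or at least 2. *)
Lemma Fl_csum n u : Fl n u -> exists (s1 : seq (g * U)) (s2 : seq (U * U)),
  [/\ forall (M : lmodType k) (B : U -> U -> M), bilin B ->
        csum B u = B 1 u + \sum_(p <- s1) B (ugen p.1) p.2 +
                   \sum_(p <- s2) B p.1 p.2,
      forall p, p \in s1 -> Fl n.-1 p.2,
      Fl n.-1 (\sum_(p <- s1) ugen p.1 * p.2 - (n.-1)%:R *: u) &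
      forall p, p \in s2 -> exists i j,
        [/\ Fl i.+3 p.1, Fl j p.2 & (i.+2 + j <= n)%N]].
Proof.
have z m : exists (s1 : seq (g * U)) (s2 : seq (U * U)),
  [/\ forall (M : lmodType k) (B : U -> U -> M), bilin B ->
        csum B 0 = B 1 0 + \sum_(p <- s1) B (ugen p.1) p.2 +
                   \sum_(p <- s2) B p.1 p.2,
      forall p, p \in s1 -> Fl m.-1 p.2,
      Fl m.-1 (\sum_(p <- s1) ugen p.1 * p.2 - (m.-1)%:R *: 0) &
      forall p, p \in s2 -> exists i j,
        [/\ Fl i.+3 p.1, Fl j p.2 & (i.+2 + j <= m)%N]].
  exists [::], [::]; split=> //; last by rewrite big_nil scaler0 subr0; apply: Fl_zero.
  move=> M B Bb; rewrite (lin0 (csum_linear Bb)) (lin0 (Bb.2 _)).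
  by rewrite !big_nil !addr0.
elim=> {n u} [n|n|n y u fu [s1 [s2 [cs f1 e1 f2]]]|n a u v _ [s1 [s2 [cs f1 e1 f2]]] _ [t1 [t2 [ct h1 d1 h2]]]].
- exact: z.
- exists [::], [::]; split=> //.
  + by move=> M B Bb; rewrite csum1 // !big_nil !addr0.
  + rewrite big_nil; case: n => [|n] /=; last by apply: FlB; [apply: Fl_zero|apply/FlZ/Fl_one].
    by rewrite scale0r subr0; apply: Fl_zero.
- case: n fu f1 e1 f2 => [/Fl0 -> f1 e1 f2|n fu f1 e1 f2]; first by rewrite mulr0; apply: z.
  exists ((y, u) :: [seq (p.1, ugen y * p.2) | p <- s1]),
    ([seq (ugen y * ugen p.1, p.2) | p <- s1] ++
     ([seq (ugen y * p.1, p.2) | p <- s2] ++ [seq (p.1, ugen y * p.2) | p <- s2])).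
  split.
  + move=> M B Bb; rewrite csumM // cs; last by linc.
    rewrite big_cons !big_cat !big_map /= !big_split /= mulr1.
    set S := \sum_(_ <- _) _; set S' := \sum_(_ <- _) _.
    set S2 := \sum_(_ <- _) _; set S2' := \sum_(_ <- _) _.
    rewrite (addrC (B (ugen y) u)) -!addrA; congr (_ + (_ + _)).
    by rewrite [LHS]addrCA.
  + move=> p; rewrite inE => /predU1P [-> //|/mapP [q /f1 fq ->]] /=.
    exact: Fl_gen.
  + rewrite big_cons big_map /=.
    rewrite -natr1 scalerDl scale1r [X in X - _]addrC [X in _ - X]addrC addrKA.
    have -> : \sum_(j <- s1) ugen j.1 * (ugen y * j.2) =
       ugen y * (\sum_(p <- s1) ugen p.1 * p.2) + \sum_(p <- s1) ugen (lie_br p.1 y) * p.2.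
      rewrite mulr_sumr -big_split; apply: eq_bigr => p _ /=.
      by rewrite ugen_br mulrBl !mulrA addrC subrK.
    rewrite addrAC; apply: FlD.
      by rewrite scalerAr -mulrBr; apply: Fl_gen.
    by apply: Fl_sum => p /f1 fp; apply: Fl_gen.
  + move=> p; rewrite !mem_cat => /orP [/mapP [q /f1 fq ->]|/orP [/mapP [q /f2 [i [j [fi fj le]]] ->]|/mapP [q /f2 [i [j [fi fj le]]] ->]]] /=.
    * by exists 0%N, n; split=> //; exact/Fl_gen/Fl_ugen.
    * by exists i.+1, j; split=> //; apply: Fl_gen.
    * by exists i, j.+1; split=> //; [apply: Fl_gen | rewrite addnS].
- exists ([seq (a *: p.1, p.2) | p <- s1] ++ t1), ([seq (a *: p.1, p.2) | p <- s2] ++ t2).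
  split.
  + move=> M B Bb; rewrite csumP // cs // ct // !big_cat !big_map /=.
    rewrite Bb.2 !scalerDr !scaler_sumr.
    have e1' : \sum_(p <- s1) a *: B (ugen p.1) p.2 = \sum_(p <- s1) B (ugen (a *: p.1)) p.2.
      by apply: eq_bigr => p _; rewrite linearZ (linZ (Bb.1 _)).
    have e2' : \sum_(p <- s2) a *: B p.1 p.2 = \sum_(p <- s2) B (a *: p.1) p.2.
      by apply: eq_bigr => p _; rewrite (linZ (Bb.1 _)).
    by rewrite e1' e2' [LHS]addrACA; congr (_ + _); rewrite addrACA.
  + by move=> p; rewrite mem_cat => /orP [/mapP [q /f1 fq ->]|/h1].
  + rewrite big_cat big_map /= scalerDr opprD addrACA; apply: FlD => //.
    rewrite scalerA mulrC -scalerA -scalerN.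
    have -> : \sum_(j <- s1) ugen (a *: j.1) * j.2 = a *: \sum_(p <- s1) ugen p.1 * p.2.
      by rewrite scaler_sumr; apply: eq_bigr => p _; rewrite linearZ scalerAl.
    by rewrite -scalerDr; apply: FlZ.
  + move=> p; rewrite mem_cat => /orP [/mapP [q /f2 [i [j [fi fj le]]] ->]|/h2 //] /=.
    by exists i, j; split=> //; apply: FlZ.
Qed.

Lemma Fl_psi n u : Fl n.+1 u -> Fl n (psi u - (2 ^ n)%:R *: u).
Proof.
move e : n.+1 => m h; elim: h n e => {m u} [m|m|m y u fu IHu|m a u v _ IHu _ IHv] n e.
- by rewrite linear0 scaler0 subr0; apply: Fl_zero.
- rewrite psi1; case: n e => [|n] _; first by rewrite scale1r subrr; apply: Fl_zero.
  by apply: FlB; [|apply: FlZ]; apply: Fl_one.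
- case: e fu IHu => <- fu IHu; case: n fu IHu => [/Fl0 ->|n fu IHu].
    by rewrite mulr0 linear0 scaler0 subr0 => _; apply: Fl_zero.
  rewrite psiM expnS natrM -scalerA addrAC -scalerBr scalerAr -mulrBr.
  apply: FlB; first by apply/FlZ/Fl_gen; apply: IHu.
  have [s1 [s2 [cs f1 _ f2]]] := Fl_csum fu; rewrite cs; last by linc.
  rewrite uad1 mul0r add0r; apply: FlD; apply: Fl_sum => p.
    by move/f1 => fp; rewrite uad_gen; apply: Fl_gen.
  move/f2 => [i [j [fi fj le]]]; apply: FlW le _.
  by apply: Fl_mulr fj; apply: Fl_uad.
- rewrite psi_is_linear scalerDr opprD addrACA scalerA mulrC -scalerA -scalerBr.
  by apply: Fl_lin; [apply: IHu | apply: IHv].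
Qed.

Lemma Fl_psiW n u : Fl n u -> Fl n (psi u).
Proof.
case: n => [|n] fu; first by rewrite (Fl0 fu) linear0; apply: Fl_zero.
rewrite -[psi u](subrK ((2 ^ n)%:R *: u)); apply: FlD; last exact: FlZ.
by apply: FlW (Fl_psi fu); apply: leqnSn.
Qed.

Hypothesis char0 : [pchar k] =i pred0.

Lemma natr_inj m n : m%:R = n%:R :> k -> m = n.
Proof.
move=> e; wlog le : m n e / (m <= n)%N.
  by move=> h; case/orP: (leq_total m n) => /h; [apply | move/(_ (esym e)) ->].
have : (n - m)%:R = 0 :> k by rewrite natrB // e subrr.
move/eqP; rewrite ((pcharf0P k).1 char0) subn_eq0 => le'.
by apply/eqP; rewrite eqn_leq le.
Qed.

Lemma natr_neq m n : m <> n -> m%:R - n%:R != 0 :> k.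
Proof. by move=> ne; rewrite subr_eq0; apply/eqP => /natr_inj. Qed.

Lemma pow2_neq i : i <> 1%N -> 2%:R - (2 ^ i)%:R != 0 :> k.
Proof.
by move=> ne; apply: natr_neq => e; apply/ne/esym/(@expnI 2 isT 1 i).
Qed.

Fixpoint eproj n u : U :=
  if n is n'.+1 then
    if n' == 1%N then eproj n' u
    else eproj n' ((2%:R - (2 ^ n')%:R)^-1 *: (psi u - (2 ^ n')%:R *: u))
  else u.

Lemma eproj_is_linear n : linear (eproj n).
Proof.
elim: n => [|n IHn] c u v //=; case: ifP => _; first exact: IHn.
have hl a b : linear (fun u => a *: (psi u - b *: u)) by linc.
exact: (lin_comp IHn (hl _ _)).
Qed.
HB.instance Definition _ n := GRing.isLinear.Build k U U _ (eproj n) (eproj_is_linear n).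

Lemma eproj_comm (f : U -> U) n u : linear f -> (forall v, psi (f v) = f (psi v)) ->
  eproj n (f u) = f (eproj n u).
Proof.
move=> fl fp; elim: n u => //= n IHn u; case: ifP => _ //.
by rewrite fp -(linZ fl) -(lin_sub fl) -(linZ fl) IHn.
Qed.

Lemma eproj_psi n u : Fl n u -> psi (eproj n u) = 2%:R *: eproj n u.
Proof.
elim: n u => [|n IHn] u /= fu; first by rewrite (Fl0 fu) linear0 scaler0.
case: ifP => [/eqP en|_]; last by apply/IHn/FlZ/Fl_psi.
have := Fl_psi fu; rewrite en expn1 => f1.
have := Fl0 (Fl_psi f1); rewrite expn0 scale1r => /eqP.
rewrite (lin_sub psi_is_linear) (linZ psi_is_linear) subr_eq0 => /eqP e.
rewrite /= expn0 (_ : 2%:R - 1%:R = 1 :> k) ?invr1 ?scale1r -?natrB //.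
rewrite (lin_sub psi_is_linear).
rewrite -[psi (psi u)](subrK (2%:R *: psi u)) e addrAC [_ - _ - _]addrAC.
by rewrite subrr add0r addrC scalerBr.
Qed.

Lemma eproj_eq2 n p : psi p = 2%:R *: p -> eproj n p = p.
Proof.
move=> e; elim: n => //= n IHn; case: ifP => [_ //|/eqP ne].
by rewrite e -scalerBl scalerA mulVf ?scale1r ?IHn //; apply: pow2_neq.
Qed.

Lemma eprojS n u : Fl n u -> eproj n.+1 u = eproj n u.
Proof.
move=> fu /=; case: ifP => [_ //|/eqP ne].
rewrite (linZ (@eproj_is_linear n)) (lin_sub (@eproj_is_linear n)).
rewrite (linZ (@eproj_is_linear n)) eproj_comm //; last exact: psi_is_linear.
by rewrite eproj_psi // -scalerBl scalerA mulVf ?scale1r //; apply: pow2_neq.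
Qed.

Lemma eproj_stable n m u : Fl n u -> (n <= m)%N -> eproj m u = eproj n u.
Proof.
move=> fu; elim: m => [|m IHm]; first by rewrite leqn0 => /eqP ->.
rewrite leq_eqVlt ltnS => /orP [/eqP -> //|le].
by rewrite eprojS ?IHm //; apply: FlW fu.
Qed.

(** The projection onto the eigenspace of [psi] for the eigenvalue 2. *)
Definition euler u : U := eproj (projT1 (cid (Fl_exists u))) u.

Lemma eulerE n u : Fl n u -> euler u = eproj n u.
Proof.
rewrite /euler; case: cid => m /= fm fn.
by rewrite -(eproj_stable fm (leq_maxl m n)) (eproj_stable fn) // leq_maxr.
Qed.

Lemma euler_is_linear : linear euler.
Proof.
move=> c u v; have [n fu] := Fl_exists u; have [m fv] := Fl_exists v.
have fu' : Fl (n + m) u by apply: FlW fu; apply: leq_addr.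
have fv' : Fl (n + m) v by apply: FlW fv; apply: leq_addl.
rewrite (eulerE fu') (eulerE fv') (eulerE (Fl_lin c fu' fv')).
exact: eproj_is_linear.
Qed.
HB.instance Definition _ := GRing.isLinear.Build k U U _ euler euler_is_linear.

Lemma psi_euler u : psi (euler u) = 2%:R *: euler u.
Proof. by have [n fu] := Fl_exists u; rewrite (eulerE fu) eproj_psi. Qed.

Lemma euler_eq2 p : psi p = 2%:R *: p -> euler p = p.
Proof. by move=> e; have [n fu] := Fl_exists p; rewrite (eulerE fu) eproj_eq2. Qed.

Lemma euler_psi u : euler (psi u) = 2%:R *: euler u.
Proof.
have [n fu] := Fl_exists u; rewrite (eulerE fu) (eulerE (Fl_psiW fu)).
by rewrite eproj_comm ?eproj_psi //; apply: psi_is_linear.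
Qed.

Lemma euler_uad y u : euler (uad y u) = uad y (euler u).
Proof.
have [n fu] := Fl_exists u; rewrite (eulerE fu) (eulerE (Fl_uad y fu)).
by rewrite eproj_comm //; [apply: uad_is_linear | apply: psi_uad].
Qed.

(** Degree considerations force the 2-eigenspace of [psi] into [g]. *)
Lemma euler_ugen u : exists y, euler u = ugen y.
Proof.
set p := euler u; have ep : psi p = 2%:R *: p by apply: psi_euler.
have [n fp] := Fl_exists p; have {fp} : Fl 2 p.
  elim: n fp => [|n IHn] fp; first exact: FlW fp.
  case: n IHn fp => [|[|n]] IHn fp; try exact: FlW fp.
  apply: IHn; have := Fl_psi fp; rewrite ep -scalerBl => h.
  have ne : 2%:R - (2 ^ n.+2)%:R != 0 :> k by apply: pow2_neq.
  by rewrite -[p]scale1r -(mulVf ne) -scalerA; apply: FlZ.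
move/Fl2P => [a [y ey]]; exists y; rewrite ey.
have : eps p = 0.
  apply/eqP; have := eps_psi p; rewrite ep (linZ (@eps_is_linear k g)).
  rewrite scaler_nat mulr2n => /eqP; rewrite -subr_eq0 addrK => /eqP ->.
  by rewrite eqxx.
rewrite ey (linD (@eps_is_linear k g)) (linZ (@eps_is_linear k g)) eps1.
rewrite -[ugen y]mulr1 eps_gen addr0 mulr1 => ea.
by rewrite (_ : a = 0) ?scale0r ?add0r // -ea [RHS]mulr1.
Qed.

Lemma euler_gen y : euler (ugen y) = ugen y.
Proof. exact/euler_eq2/psi_gen. Qed.

Lemma euler_eq0 c u : psi u = c *: u -> c != 2%:R -> euler u = 0.
Proof.
move=> e ne; have := euler_psi u; rewrite e (linZ euler_is_linear) => /eqP.
by rewrite -subr_eq0 -scalerBl scaler_eq0 subr_eq0 (negPf ne) => /eqP.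
Qed.

Lemma euler1 : euler 1 = 0.
Proof.
apply: (@euler_eq0 1); first by rewrite psi1 scale1r.
by rewrite -subr_eq0 -oppr_eq0 opprB (@natr_neq 2 1).
Qed.

Lemma two_neq0 : 2%:R != 0 :> k.
Proof. by have := @natr_neq 2 0; rewrite subr0; apply. Qed.

Definition isg (p : U) : Prop := exists y, p = ugen y.

Lemma isg_euler u : isg (euler u). Proof. exact: euler_ugen. Qed.

(** [nu] is the weight operator up to terms of lower length. *)
Definition nu : U -> U := csum (fun a b => euler a * b).

Lemma nu_bilin : bilin (fun a b : U => euler a * b).
Proof. by linc. Qed.

Lemma nu_is_linear : linear nu.
Proof. exact/csum_linear/nu_bilin. Qed.
HB.instance Definition _ := GRing.isLinear.Build k U U _ nu nu_is_linear.

Lemma nu_uad y u : nu (uad y u) = uad y (nu u).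
Proof.
rewrite /nu csum_uad ?(csum_ap _ _ (@uad_is_linear _ _ y)); last exact: nu_bilin.
by apply: eq_csum => a b; rewrite euler_uad uadM.
Qed.

Lemma isg_eps p : isg p -> eps p = 0.
Proof. by case=> y ->; rewrite -[ugen y]mulr1 eps_gen. Qed.

Lemma eps_nu u : eps (nu u) = 0.
Proof.
rewrite /nu (csum_ap _ _ (@eps_is_linear k g)) -[RHS](csum0 _ u).
by apply: eq_csum => a b; rewrite epsM (isg_eps (isg_euler a)) mul0r.
Qed.

Lemma Fl_nu n u : Fl n.+1 u -> Fl n (nu u - n%:R *: u).
Proof.
move=> fu; have [s1 [s2 [cs f1 e1 f2]]] := Fl_csum fu.
rewrite /nu cs ?euler1 ?mul0r ?add0r; last exact: nu_bilin.
have -> : \sum_(p <- s1) euler (ugen p.1) * p.2 = \sum_(p <- s1) ugen p.1 * p.2.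
  by apply: eq_bigr => p _; rewrite euler_gen.
rewrite addrAC; apply: FlD => //; apply: Fl_sum => p /f2 [i [j [_ fj le]]].
apply: (@FlW (1 + j)); first by rewrite -ltnS; apply: leq_trans le; rewrite !addSn !ltnS leq_addl.
by apply: Fl_mulr fj; have [y ->] := euler_ugen p.1; apply: Fl_ugen.
Qed.

(** [nu] is diagonalisable on the augmentation ideal, with positive integers
    as eigenvalues. *)
Lemma nu_eigen n u : Fl n.+1 u -> eps u = 0 ->
  exists f : nat -> U, u = \sum_(i < n) f i /\ forall i, nu (f i) = i.+1%:R *: f i.
Proof.
elim: n u => [|n IHn] u fu eu.
  exists (fun=> 0); split; last by move=> i; rewrite (lin0 nu_is_linear) scaler0.
  rewrite big_ord0; have [a [y ey]] := Fl2P (FlW (isT : 1 <= 2)%N fu).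
  have := Fl_nu fu; rewrite scale0r subr0 => /Fl0.
  have [b eb] : exists b, u = b *: 1.
    have := Fl_psi fu; rewrite expn0 scale1r => /Fl0 /eqP.
    rewrite ey (linD psi_is_linear) (linZ psi_is_linear) psi1 psi_gen opprD.
    rewrite addrACA subrr add0r scaler_nat mulr2n addrK => /eqP ->.
    by exists a; rewrite addr0.
  move: eu; rewrite eb (linZ (@eps_is_linear k g)) eps1 => e0 _.
  by rewrite (_ : b = 0) ?scale0r // -e0 [RHS]mulr1.
pose v := nu u - n.+1%:R *: u.
have fv : Fl n.+1 v by apply: Fl_nu.
have ev : eps v = 0.
  by rewrite (lin_sub (@eps_is_linear k g)) (linZ (@eps_is_linear k g)) eps_nu eu scaler0 subr0.
have [f [vf fE]] := IHn v fv ev.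
pose h i := (i.+1%:R - n.+1%:R)^-1 *: f i.
pose w := u - \sum_(i < n) h i.
have hE i : nu (h i) = i.+1%:R *: h i.
  by rewrite (linZ nu_is_linear) fE !scalerA mulrC.
have wE : nu w = n.+1%:R *: w.
  pose D t := nu t - n.+1%:R *: t.
  have Dl : linear D by apply: lin_add; [exact: nu_is_linear | linc].
  apply/eqP; rewrite -subr_eq0 -/(D w) /w (lin_sub Dl) (lin_sumE _ _ Dl).
  rewrite -[D u]/v vf -sumrB big1 // => i _.
  rewrite /D hE -scalerBl scalerA mulfV ?scale1r ?subrr //.
  by apply: natr_neq => -[ein]; move: (ltn_ord i); rewrite ein ltnn.
exists (fun i => if (i < n)%N then h i else if i == n then w else 0); split.
  rewrite big_ord_recr /= ltnn eqxx.
  rewrite (eq_bigr (fun i : 'I_n => h i)) => [|i _]; last by rewrite ltn_ord.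
  by rewrite /w addrC subrK.
move=> i; case: ifP => // _; case: ifP => [/eqP -> //|_].
by rewrite (lin0 nu_is_linear) scaler0.
Qed.

End Eulerian.

(** * The cobar complex *)

Ltac lint :=
  lazymatch goal with
  | |- bilin _ => split=> ? /=; lint
  | |- GRing.linear_for _ (fun x => x) => apply: lin_id
  | |- GRing.linear_for _ (fun x => GRing.zero) => apply: lin_zero
  | |- GRing.linear_for _ (fun x => GRing.add (@?f x) (@?h x)) => apply: lin_add; lint
  | |- GRing.linear_for _ (fun x => GRing.opp (@?f x)) => apply: lin_opp; lint
  | |- GRing.linear_for _ (fun x => csum (@?f x) (@?h x)) =>
      first [apply: csum_linB; lint | apply: csum_lin; lint]
  | |- GRing.linear_for _ (csum _) => apply: csum_linear; lint
  | |- GRing.linear_for _ (tcase _ _) => apply: tcase_is_linear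
  | |- GRing.linear_for _ (GRing.mul _) => apply: (lin_mull _ (@lin_id _ _))
  | |- GRing.linear_for _ (GRing.scale _) => apply: (lin_scale _ (@lin_id _ _))
  | |- GRing.linear_for _ (fun x => tcase (@?m x) (@?f x) (@?h x)) =>
      first [apply: lin_ap; lint | apply: tcase_linF; lint]
  | |- GRing.linear_for _ (fun x => bigop _ _ (@?f x)) => apply: lin_sum; lint
  | |- GRing.linear_for _ (fun x => GRing.mul (@?f x) (@?h x)) =>
      first [apply: lin_mull; lint | apply: lin_mulr; lint]
  | |- GRing.linear_for _ (fun x => GRing.scale (@?f x) (@?h x)) =>
      first [apply: lin_scale; lint | apply: lin_scal; lint]
  | |- GRing.linear_for _ _ => first
    [ assumption | apply: linearP
    | match goal with H : linear _ |- _ => apply: (lin_comp H); lint end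
    | (apply: lin_bl; [ solve [auto with bilin nocore] | lint])
    | (apply: lin_br; [ solve [auto with bilin nocore] | lint])
    | (apply: bilin_linr; solve [auto with bilin nocore])
    | apply: lin_ap; lint ]
  | |- forall _, _ => move=> ? /=; lint
  end.

Create HintDb bilin.

Section Cobar.
Variables (k : fieldType) (g : lieAlgebra k).
Hypothesis char0 : [pchar k] =i pred0.
Local Notation U := (ualg g).
Local Notation T := (talg (ualg g)).
Local Notation lt := (@pgen k (ualg g) None).
Local Notation euler := (@euler k g).
Local Notation nu := (@nu k g).
Implicit Types (y : g) (u v : U) (t : T).

Ltac modT := module_in k (T : lmodType k).

Lemma linear_csum (M N : lmodType k) (f : {linear M -> N}) (B : U -> U -> M) u :
  f (csum B u) = csum (fun a b => f (B a b)) u.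
Proof. by apply: csum_ap; apply: linearP. Qed.

(* The reduced coproduct of the first letter. *)
Definition rcop u t : T :=
  csum (fun a b => lt a * (lt b * t)) u - lt u * (lt 1 * t) - lt 1 * (lt u * t).

Lemma rcop_bilin : bilin rcop.
Proof. by rewrite /rcop; lint. Qed.
Hint Resolve rcop_bilin : bilin.

(** The cobar differential on the first [n] letters. *)
Fixpoint dd (n : nat) : T -> T :=
  if n is n'.+1 then tcase 0 (fun u t => - (rcop u t + lt u * dd n' t))
  else fun=> 0.

Lemma dd_is_linear n : linear (dd n).
Proof. by case: n => [|n]; [apply: lin_zero | apply: tcase_is_linear]. Qed.
HB.instance Definition _ n := GRing.isLinear.Build k T T _ (dd n) (dd_is_linear n).

Lemma ddC n u t : dd n.+1 (lt u * t) = - (rcop u t + lt u * dd n t).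
Proof. by rewrite /= tcaseM //; lint. Qed.

Lemma dd0 t : dd 0 t = 0. Proof. by []. Qed.
Arguments dd : simpl never.

(** Left multiplication by a primitive element, on the first [n] letters. *)
Fixpoint lmulp (n : nat) (p : U) : T -> T :=
  if n is n'.+1 then tcase 0 (fun u t => lt (p * u) * t + lt u * lmulp n' p t)
  else fun=> 0.

Lemma lmulp_is_linear n p : linear (lmulp n p).
Proof. by case: n => [|n]; [apply: lin_zero | apply: tcase_is_linear]. Qed.
HB.instance Definition _ n p := GRing.isLinear.Build k T T _ (lmulp n p) (lmulp_is_linear n p).

Lemma lmulpC n p u t :
  lmulp n.+1 p (lt u * t) = lt (p * u) * t + lt u * lmulp n p t.
Proof. by rewrite /= tcaseM //; lint. Qed.

Lemma lmulp_bilin n : bilin (lmulp n).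
Proof.
elim: n => [|n IHn]; first by split=> ?; apply: lin_zero.
by split=> [t|p]; [rewrite /=; lint | apply: lmulp_is_linear].
Qed.
Hint Resolve lmulp_bilin : bilin.

Lemma lmulp0 p t : lmulp 0 p t = 0. Proof. by []. Qed.
Arguments lmulp : simpl never.

(** Insertion of a letter in position [n]. *)
Fixpoint ins (n : nat) (p : U) : T -> T :=
  if n is n'.+1 then tcase 0 (fun u t => lt u * ins n' p t)
  else fun t => lt p * t.

Lemma ins_is_linear n p : linear (ins n p).
Proof. by case: n => [|n] /=; [lint | apply: tcase_is_linear]. Qed.
HB.instance Definition _ n p := GRing.isLinear.Build k T T _ (ins n p) (ins_is_linear n p).

Lemma insC n p u t : ins n.+1 p (lt u * t) = lt u * ins n p t.
Proof. by rewrite /= tcaseM //; lint. Qed.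

Lemma ins_bilin n : bilin (ins n).
Proof.
elim: n => [|n IHn]; first by rewrite /=; lint.
by split=> [t|p]; [rewrite /=; lint | apply: ins_is_linear].
Qed.
Hint Resolve ins_bilin : bilin.

Lemma ins0 p t : ins 0 p t = lt p * t. Proof. by []. Qed.
Arguments ins : simpl never.

(** The homotopy. *)
Fixpoint ss (n : nat) : T -> T :=
  if n is n'.+1 then
    tcase 0 (fun u t => - (lmulp n' (euler u) t + lt u * ss n' t))
  else fun=> 0.

Lemma ss_is_linear n : linear (ss n).
Proof. by case: n => [|n]; [apply: lin_zero | apply: tcase_is_linear]. Qed.
HB.instance Definition _ n := GRing.isLinear.Build k T T _ (ss n) (ss_is_linear n).

Lemma ssC n u t : ss n.+1 (lt u * t) = - (lmulp n (euler u) t + lt u * ss n t).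
Proof. by rewrite /= tcaseM //; lint. Qed.

Lemma ss0 t : ss 0 t = 0. Proof. by []. Qed.
Arguments ss : simpl never.

Fixpoint nun (n : nat) : T -> T :=
  if n is n'.+1 then tcase 0 (fun u t => lt (nu u) * t + lt u * nun n' t)
  else fun=> 0.

Lemma nun_is_linear n : linear (nun n).
Proof. by case: n => [|n]; [apply: lin_zero | apply: tcase_is_linear]. Qed.
HB.instance Definition _ n := GRing.isLinear.Build k T T _ (nun n) (nun_is_linear n).

Lemma nunC n u t : nun n.+1 (lt u * t) = lt (nu u) * t + lt u * nun n t.
Proof. by rewrite /= tcaseM //; lint. Qed.

Lemma nun0 t : nun 0 t = 0. Proof. by []. Qed.
Arguments nun : simpl never.

(** Each of the first [n] letters in turn is moved past the others and replaced
    by its primitive part. *)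
Fixpoint tt (n : nat) : T -> T :=
  if n is n'.+1 then
    tcase 0 (fun u t => (-1) ^+ n' *: ins n' (euler u) t + lt u * tt n' t)
  else fun=> 0.

Lemma tt_is_linear n : linear (tt n).
Proof. by case: n => [|n]; [apply: lin_zero | apply: tcase_is_linear]. Qed.
HB.instance Definition _ n := GRing.isLinear.Build k T T _ (tt n) (tt_is_linear n).

Lemma ttC n u t :
  tt n.+1 (lt u * t) = (-1) ^+ n *: ins n (euler u) t + lt u * tt n t.
Proof. by rewrite /= tcaseM //; lint. Qed.

Lemma tt0 t : tt 0 t = 0. Proof. by []. Qed.
Arguments tt : simpl never.

Lemma tspan_eqn n Ps (M : lmodType k) (f h : T -> M) :
  linear f -> linear h ->
  (forall Ps' u t, (n <= size Ps')%N -> tspan Ps' t -> f (lt u * t) = h (lt u * t)) ->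
  forall t, (n < size Ps)%N -> tspan Ps t -> f t = h t.
Proof.
move=> fl hl e t; case: Ps => // P Ps; rewrite ltnS => le.
by apply: tspan_eq => // u x _ sx; apply: e sx.
Qed.

Lemma rcop_lmulp n p u t : isg p ->
  lmulp n.+2 p (rcop u t) =
  rcop (p * u) t + rcop u (lmulp n p t) - lt u * (lt p * t) - lt p * (lt u * t).
Proof.
move=> [y ->]; rewrite /rcop !raddfB /= linear_csum csumM; last by lint.
have -> : csum (fun a b => lmulp n.+2 (ugen y) (lt a * (lt b * t))) u =
   csum (fun a b => lt (ugen y * a) * (lt b * t) + lt a * (lt (ugen y * b) * t)) u +
   csum (fun a b => lt a * (lt b * lmulp n (ugen y) t)) u.
  rewrite -csumD; apply: eq_csum => a b; rewrite !lmulpC !mulrDr; modT.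
rewrite !lmulpC !mulr1 !mulrDr; modT.
Qed.

Lemma lmulp_dd n Ps p t : isg p -> (n <= size Ps)%N -> tspan Ps t ->
  lmulp n.+1 p (dd n t) =
  dd n (lmulp n p t) + lt p * t - (-1) ^+ n *: ins n p t.
Proof.
move=> pg; move: t; elim: n Ps => [|n IHn] Ps.
  by move=> t _ _; rewrite dd0 lmulp0 linear0 expr0 scale1r ins0 !linear0 add0r subrr.
apply: tspan_eqn; [by lint | by lint | move=> {}Ps u t le st /=].
rewrite ddC lmulpC insC (linN (lmulp_is_linear _ _)) (linD (lmulp_is_linear _ _)).
rewrite rcop_lmulp // lmulpC (IHn _ _ le st) (linD (@dd_is_linear _)) !ddC !mulrDr !mulrN -!scalerAr; modT.
Qed.

Lemma ss_rcop n u t :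
  ss n.+2 (rcop u t) = rcop u (ss n t) + lt (euler u) * t - lt (nu u) * t.
Proof.
have l0 m x : lmulp m (euler 1) x = 0 by rewrite euler1 // (lin0 ((lmulp_bilin m).1 x)).
have sc : csum (fun a b => ss n.+2 (lt a * (lt b * t))) u =
   csum (fun a b => lt a * lmulp n (euler b) t) u
   - csum (fun a b => lt b * lmulp n (euler a) t) u
   + csum (fun a b => lt a * (lt b * ss n t)) u
   - csum (fun a b => lt (euler a * b) * t) u.
  rewrite -!csumN -!csumD; apply: eq_csum => a b.
  by rewrite !ssC lmulpC !mulrN mulrDr; modT.
rewrite /rcop !(lin_sub (ss_is_linear _)) linear_csum sc.
rewrite (csumC (B := fun a b => lt b * lmulp n (euler a) t)); last by lint.
rewrite -(csum_ap _ _ (lin_mulr t (linearP lt))) -/(nu u).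
rewrite !ssC !l0 !lmulpC !mulr1 !mulrN !mulrDr !mulr0; modT.
Qed.

Lemma ddC_pred n u t (f : nat -> T -> T) : f 0%N t = 0 ->
  dd n (lt u * f n t) = - (rcop u (f n t) + lt u * dd n.-1 (f n t)).
Proof.
move=> f0; case: n => [|n]; last by rewrite ddC.
by rewrite !dd0 f0 (lin0 (rcop_bilin.2 _)) mulr0 addr0 oppr0.
Qed.

Lemma homotopy n Ps t : (n <= size Ps)%N -> tspan Ps t ->
  ss n.+1 (dd n t) + dd n.-1 (ss n t) = nun n t - tt n t.
Proof.
move: t; elim: n Ps => [|n IHn] Ps.
  move=> t _ _; rewrite dd0 ss0 nun0 tt0.
  by rewrite (lin0 (@ss_is_linear _)) (lin0 (@dd_is_linear _)) subrr addr0.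
apply: tspan_eqn; [by lint | by lint | move=> {}Ps u t le st /=].
rewrite ddC !ssC nunC ttC !(linN (@ss_is_linear _)) (linD (@ss_is_linear _)) ss_rcop.
rewrite ssC (lmulp_dd (isg_euler char0 u) le st).
rewrite (linN (@dd_is_linear _)) (linD (@dd_is_linear _)) (@ddC_pred _ _ _ ss) //.
have e : lt u * ss n.+1 (dd n t) = lt u * nun n t - lt u * tt n t - lt u * dd n.-1 (ss n t).
  by rewrite -!mulrBr -(IHn _ _ le st) addrK.
rewrite e; modT.
Qed.

Lemma dd_ins n Ps p t : isg p -> (n <= size Ps)%N -> tspan Ps t ->
  dd n (ins n p t) = ins n.+1 p (dd n t).
Proof.
move=> pg; move: t; elim: n Ps => [|n IHn] Ps.
  by move=> t _ _; rewrite !dd0 (lin0 (ins_is_linear _ _)).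
apply: tspan_eqn; [by lint | by lint | move=> {}Ps u t le st /=].
rewrite insC !ddC (linN (ins_is_linear _ _)) (linD (ins_is_linear _ _)).
rewrite insC (IHn _ _ le st) /rcop !(lin_sub (ins_is_linear _ _)) linear_csum /= !insC.
by congr (- (_ - _ - _ + _)); apply: eq_csum => a b; rewrite !insC.
Qed.

Lemma tt_rcop n u t : tt n.+2 (rcop u t) = rcop u (tt n t).
Proof.
have l0 m x : ins m (euler 1) x = 0 by rewrite euler1 // (lin0 ((ins_bilin m).1 x)).
have sc : csum (fun a b => tt n.+2 (lt a * (lt b * t))) u =
   (-1) ^+ n *: csum (fun a b => lt a * ins n (euler b) t) u
   - (-1) ^+ n *: csum (fun a b => lt b * ins n (euler a) t) u
   + csum (fun a b => lt a * (lt b * tt n t)) u.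
  rewrite -!csumZ -csumN -!csumD; apply: eq_csum => a b.
  by rewrite !ttC insC !mulrDr -!scalerAr; modT.
rewrite /rcop !(lin_sub (@tt_is_linear _)) linear_csum sc.
rewrite (csumC (B := fun a b => lt b * ins n (euler a) t)); last by lint.
rewrite !ttC !insC !l0 !mulrDr -!scalerAr !mulr0; modT.
Qed.

Lemma dd_tt n Ps t : (n <= size Ps)%N -> tspan Ps t ->
  tt n.+1 (dd n t) = dd n.-1 (tt n t).
Proof.
move: t; elim: n Ps => [|n IHn] Ps.
  by move=> t _ _; rewrite !dd0 (lin0 (@tt_is_linear _)).
apply: tspan_eqn; [by lint | by lint | move=> {}Ps u t le st /=].
rewrite ddC ttC (linN (@tt_is_linear _)) (linD (@tt_is_linear _)) tt_rcop ttC.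
rewrite (IHn _ _ le st) (linD (@dd_is_linear _)) (linZ (@dd_is_linear _)).
rewrite (dd_ins (isg_euler char0 u) le st) (@ddC_pred _ _ _ tt) //; modT.
Qed.

End Cobar.

Arguments dd : simpl never.
Arguments lmulp : simpl never.
Arguments ins : simpl never.
Arguments ss : simpl never.
Arguments nun : simpl never.
Arguments tt : simpl never.

#[global] Hint Resolve rcop_bilin lmulp_bilin ins_bilin : bilin.

Section Cohomology.
Variables (k : fieldType) (g : lieAlgebra k).
Hypothesis char0 : [pchar k] =i pred0.
Local Notation U := (ualg g).
Local Notation T := (talg (ualg g)).
Local Notation lt := (@pgen k (ualg g) None).
Local Notation euler := (@euler k g).
Local Notation nu := (@nu k g).
Implicit Types (y : g) (u v : U) (t : T).

Ltac modT := module_in k (T : lmodType k).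

Lemma dd_rcop n u t : dd n.+2 (rcop u t) = rcop u (dd n t).
Proof.
have e1 x : rcop 1 x = - (lt (1 : U) * (lt 1 * x)).
  by rewrite /rcop csum1; [modT | lint].
have sc : csum (fun a b => dd n.+2 (lt a * (lt b * t))) u =
   csum (fun a b => lt a * (lt b * dd n t)) u
   + csum (fun a b => lt 1 * (lt a * (lt b * t))) u
   - csum (fun a b => lt a * (lt b * (lt 1 * t))) u.
  pose C a b c := lt a * (lt b * (lt c * t)) : T.
  have Ct : trilin C by rewrite /C; split=> ? ? /=; lint.
  have -> : csum (fun a b => dd n.+2 (lt a * (lt b * t))) u =
     csum (fun a b => csum (C a) b) u
     - csum (fun a b => csum (fun a' a'' => C a' a'' b) a) u
     + csum (fun a b => lt 1 * (lt a * (lt b * t))) u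
     - csum (fun a b => lt a * (lt b * (lt 1 * t))) u
     + csum (fun a b => lt a * (lt b * dd n t)) u.
    rewrite -!csumN -!csumD; apply: eq_csum => a b.
    rewrite !ddC /rcop !mulrN !mulrDr !mulrN.
    rewrite -(csum_ap (fun b b' => lt b * (lt b' * t)) b (lin_mull (lt a) (@lin_id _ T))).
    modT.
  by rewrite -(csumA u Ct); modT.
rewrite {1}/rcop !(lin_sub (@dd_is_linear _ _ _)) linear_csum sc.
rewrite !ddC !e1 /rcop.
rewrite -(csum_ap (fun b b' => lt b * (lt b' * t)) u (lin_mull (lt 1) (@lin_id _ T))).
rewrite !mulrN !mulrDr !mulrN; modT.
Qed.

Lemma dd_dd n Ps t : (n <= size Ps)%N -> tspan Ps t -> dd n.+1 (dd n t) = 0.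
Proof.
move: t; elim: n Ps => [|n IHn] Ps.
  by move=> t _ _; rewrite (lin0 (@dd_is_linear _ _ _)).
apply: tspan_eqn; [by lint | by lint | move=> {}Ps u t le st /=].
rewrite ddC (linN (@dd_is_linear _ _ _)) (linD (@dd_is_linear _ _ _)) dd_rcop ddC.
by rewrite (IHn _ _ le st) mulr0 addr0 subrr oppr0.
Qed.

(** The adjoint action. *)
Definition adT y : T -> T := der (uad y).

Lemma adT_is_linear y : linear (adT y).
Proof. exact/der_is_linear/uad_is_linear. Qed.
HB.instance Definition _ y := GRing.isLinear.Build k T T _ (adT y) (adT_is_linear y).

Lemma adT1 y : adT y 1 = 0.
Proof. exact/der1/uad_is_linear. Qed.

Lemma adTC y u t : adT y (lt u * t) = lt (uad y u) * t + lt u * adT y t.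
Proof. exact/derC/uad_is_linear. Qed.

Lemma adT_lmulp n Ps y p t : (n <= size Ps)%N -> tspan Ps t ->
  adT y (lmulp n p t) = lmulp n (uad y p) t + lmulp n p (adT y t).
Proof.
move: t; elim: n Ps => [|n IHn] Ps.
  by move=> t _ _; rewrite !lmulp0 (lin0 (@adT_is_linear _)) addr0.
apply: tspan_eqn; [by lint | by lint | move=> {}Ps u t le st /=].
rewrite adTC (linD (@lmulp_is_linear _ _ _ _)) !lmulpC (linD (@adT_is_linear _)) !adTC.
by rewrite uadM linearD /= (IHn _ _ le st) (mulrDl _ _ t) (mulrDr (lt u)); modT.
Qed.

Lemma adT_ins n Ps y p t : (n <= size Ps)%N -> tspan Ps t ->
  adT y (ins n p t) = ins n (uad y p) t + ins n p (adT y t).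
Proof.
move: t; elim: n Ps => [|n IHn] Ps.
  by move=> t _ _; rewrite !ins0 adTC.
apply: tspan_eqn; [by lint | by lint | move=> {}Ps u t le st /=].
rewrite adTC (linD (@ins_is_linear _ _ _ _)) !insC adTC.
by rewrite (IHn _ _ le st) (mulrDr (lt u)); modT.
Qed.

Lemma adT_ss n Ps y t : (n <= size Ps)%N -> tspan Ps t ->
  adT y (ss n t) = ss n (adT y t).
Proof.
move: t; elim: n Ps => [|n IHn] Ps.
  by move=> t _ _; rewrite !ss0 (lin0 (@adT_is_linear _)).
apply: tspan_eqn; [by lint | by lint | move=> {}Ps u t le st /=].
rewrite adTC (linD (@ss_is_linear _ _ _)) !ssC // (linN (@adT_is_linear _)).
rewrite (linD (@adT_is_linear _)) adTC (IHn _ _ le st) (adT_lmulp _ _ le st).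
by rewrite euler_uad //; modT.
Qed.

Lemma adT_nun n Ps y t : (n <= size Ps)%N -> tspan Ps t ->
  adT y (nun n t) = nun n (adT y t).
Proof.
move: t; elim: n Ps => [|n IHn] Ps.
  by move=> t _ _; rewrite !nun0 (lin0 (@adT_is_linear _)).
apply: tspan_eqn; [by lint | by lint | move=> {}Ps u t le st /=].
rewrite adTC (linD (@nun_is_linear _ _ _)) !nunC //.
rewrite (linD (@adT_is_linear _)) !adTC (IHn _ _ le st).
by rewrite nu_uad //; modT.
Qed.

Lemma adT_tt n Ps y t : (n <= size Ps)%N -> tspan Ps t ->
  adT y (tt n t) = tt n (adT y t).
Proof.
move: t; elim: n Ps => [|n IHn] Ps.
  by move=> t _ _; rewrite !tt0 (lin0 (@adT_is_linear _)).
apply: tspan_eqn; [by lint | by lint | move=> {}Ps u t le st /=].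
rewrite adTC (linD (@tt_is_linear _ _ _)) !ttC //.
rewrite (linD (@adT_is_linear _)) (linZ (@adT_is_linear _)) !adTC (IHn _ _ le st).
by rewrite (adT_ins _ _ le st) euler_uad //; modT.
Qed.

Definition augm u : Prop := eps u = 0.

(** [n] letters in the augmentation ideal, followed by [m] primitive ones. *)
Definition cosp n m : T -> Prop :=
  tspan (nseq n augm ++ nseq m (@isg k g)).

Lemma size_cosp n m :
  size (nseq n augm ++ nseq m (@isg k g)) = (n + m)%N.
Proof. by rewrite size_cat !size_nseq. Qed.

Lemma cosp_le n m :
  (n <= size (nseq n augm ++ nseq m (@isg k g)))%N.
Proof. by rewrite size_cosp leq_addr. Qed.
Hint Resolve cosp_le : core.

Lemma cospW n m t : cosp n m.+1 t -> cosp n.+1 m t.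
Proof.
apply: tspan_sub; first by rewrite !size_cosp addnS.
elim: n => [|n IHn] [|i] v //=; first exact: isg_eps.
exact: IHn.
Qed.

Lemma cosp_lmulp n m p t : eps p = 0 -> cosp n m t -> cosp n m (lmulp n p t).
Proof.
move=> ep; move: t; elim: n => [|n IHn] t; first by rewrite lmulp0 => _; apply: ts_zero.
apply: tspan_map => [|u {}t eu st]; first exact: lmulp_is_linear.
rewrite lmulpC; apply: tspanD; apply: ts_cons => //; last exact: IHn.
by rewrite /augm epsM ep mul0r.
Qed.

Lemma cosp_ins n m p t : isg p -> cosp n m t -> cosp n m.+1 (ins n p t).
Proof.
move=> pg; move: t; elim: n => [|n IHn] t; first by rewrite ins0 => st; apply: ts_cons.
apply: tspan_map => [|u {}t eu st]; first exact: ins_is_linear.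
by rewrite insC; apply: ts_cons => //; apply: IHn.
Qed.

Lemma cosp_ss n m t : cosp n.+1 m t -> cosp n m (ss n.+1 t).
Proof.
move: t; elim: n => [|n IHn] t; apply: tspan_map => [|u {}t eu st];
  rewrite ?ssC //; try exact: ss_is_linear; apply: tspanN; apply: tspanD.
- by rewrite lmulp0; apply: ts_zero.
- by rewrite ss0 mulr0; apply: ts_zero.
- by apply: cosp_lmulp => //; apply/isg_eps/isg_euler.
- by apply: ts_cons => //; apply: IHn.
Qed.

Lemma cosp_nun n m t : cosp n m t -> cosp n m (nun n t).
Proof.
move: t; elim: n => [|n IHn] t; first by rewrite nun0 => _; apply: ts_zero.
apply: tspan_map => [|u {}t eu st]; first exact: nun_is_linear.
by rewrite nunC //; apply: tspanD; apply: ts_cons => //; [apply: eps_nu | apply: IHn].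
Qed.

Lemma cosp_tt n m t : cosp n.+1 m t -> cosp n m.+1 (tt n.+1 t).
Proof.
move: t; elim: n => [|n IHn] t; apply: tspan_map => [|u {}t eu st];
  rewrite ?ttC //; try exact: tt_is_linear; apply: tspanD.
- by apply/tspanZ/cosp_ins => //; apply: isg_euler.
- by rewrite tt0 mulr0; apply: ts_zero.
- by apply/tspanZ/cosp_ins => //; apply: isg_euler.
- by apply: ts_cons => //; apply: IHn.
Qed.

Lemma rcop_isg p t : isg p -> rcop p t = 0.
Proof.
case=> y ->; rewrite /rcop csum_gen; last by lint.
modT.
Qed.

Lemma dd_prim n m t : (n <= m)%N -> cosp 0 m t -> dd n t = 0.
Proof.
move: t; elim: n m => [|n IHn] [|m] t // le; rewrite /cosp /= => st.
move: t st; apply: tspan_eq => [|| u t pu st]; [by lint | by lint |].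
by rewrite ddC rcop_isg // (IHn m) // mulr0 addr0 oppr0.
Qed.

Lemma dd_cosp n m j t : (j <= m)%N -> cosp n m t -> dd (n + j) t = dd n t.
Proof.
move=> le; move: t; elim: n => [|n IHn] t st; first by rewrite dd0 (dd_prim le).
move: t st; apply: tspan_eq => [|| u t pu st]; [by lint | by lint |].
by rewrite addSn !ddC IHn.
Qed.

Definition inv t : Prop := forall y, adT y t = 0.

Lemma inv_lin a t t' : inv t -> inv t' -> inv (a *: t + t').
Proof. by move=> it it' y; rewrite (adT_is_linear y) it it' scaler0 addr0. Qed.

(** Sums of eigenvectors of [nun n] with eigenvalues at least [n]. *)
Inductive eigsum n : T -> Prop :=
| es_zero : eigsum n 0
| es_lin a w t t' :
    nun n t = (w + n)%:R *: t -> eigsum n t' -> eigsum n (a *: t + t').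

Lemma eigsum_add n t t' : eigsum n t -> eigsum n t' -> eigsum n (t + t').
Proof.
elim=> [|a w x x' ex _ IHx]; first by rewrite add0r.
by move=> h; rewrite -addrA; apply: es_lin ex _; apply: IHx.
Qed.

Lemma eigsumZ n a t : eigsum n t -> eigsum n (a *: t).
Proof.
elim=> [|b w x x' ex _ IHx]; first by rewrite scaler0; apply: es_zero.
by rewrite scalerDr scalerA; apply: es_lin ex _.
Qed.

Lemma cosp_eigsum n m t : cosp n m t -> eigsum n t.
Proof.
move: t; elim: n => [|n IHn] t st.
  by rewrite -[t]scale1r -[_ *: _]addr0; apply: (@es_lin _ _ 0%N); [rewrite nun0 scale0r | apply: es_zero].
move: t st; apply: tspan_cons_ind; first exact: es_zero.
  by move=> a x x' ex ex'; apply: eigsum_add => //; apply: eigsumZ.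
move=> u t eu /IHn et; have [N fu] := Fl_exists u.
have [f [-> fE]] := nu_eigen char0 (FlW (leqnSn N) fu) eu.
rewrite linear_sum mulr_suml /=; elim/big_rec: _ => [|i x _ ex]; first exact: es_zero.
apply: eigsum_add => {ex}//; elim: et => [|a w z z' ez _ IHz]; first by rewrite mulr0; apply: es_zero.
rewrite mulrDr -scalerAr; apply: (@es_lin _ _ (i + w)) => //.
rewrite nunC // fE ez linearZ /= -scalerAl -scalerAr -scalerDl -natrD.
by rewrite addSn addnA addnS.
Qed.

Fixpoint killn n W t : T :=
  if W is W'.+1 then killn n W' (nun n t - W%:R *: t) else t.

Lemma killn_is_linear n W : linear (killn n W).
Proof.
elim: W => [|W IHW] a x x' //=; rewrite -IHW; congr (killn _ _ _).
by rewrite nun_is_linear; modT.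
Qed.

Lemma killn_eig n w W t : nun n t = w%:R *: t -> (0 < w <= W)%N -> killn n W t = 0.
Proof.
move=> et; elim: W => [|W IHW] /andP [w0 wW] /=; first by move: w0; rewrite ltnNge wW.
rewrite et -scalerBl (linZ (killn_is_linear n W)).
move: wW; rewrite leq_eqVlt => /orP [/eqP ->|wW]; first by rewrite subrr scale0r.
by rewrite IHW ?scaler0 // w0.
Qed.

Lemma eigsum_killn n t : eigsum n.+1 t -> exists W, forall W', (W <= W')%N -> killn n.+1 W' t = 0.
Proof.
elim=> [|a w x x' ex _ [W hW]].
  by exists 0%N => W' _; rewrite (lin0 (killn_is_linear _ _)).
exists (w + n.+1 + W)%N => W' le; rewrite (killn_is_linear _ _ a) hW; last first.
  by apply: leq_trans le; rewrite leq_addl.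
rewrite (killn_eig ex) ?scaler0 ?addr0 // addnS /=.
by apply: leq_trans le; rewrite addnS leq_addr.
Qed.

Lemma nun_surj (S : T -> Prop) n W t :
  (forall a x x', S x -> S x' -> S (a *: x + x')) -> (forall x, S x -> S (nun n x)) ->
  S t -> killn n W t = 0 -> exists2 c, S c & t = nun n c.
Proof.
move=> Sl Sn; elim: W t => [|W IHW] t St /= kt.
  by exists t => //; rewrite kt (lin0 (@nun_is_linear _ _ _)).
have Sv : S (nun n t - W.+1%:R *: t) by rewrite addrC -scaleNr; apply: Sl => //; apply: Sn.
have [c Sc ec] := IHW _ Sv kt.
have S0 : S 0 by rewrite -(addNr t) -scaleN1r; apply: Sl.
exists (W.+1%:R^-1 *: (t - c)).
  rewrite -[_ *: _]addr0; apply: (Sl) => //.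
  by rewrite addrC -scaleN1r; apply: Sl.
rewrite (linZ (@nun_is_linear _ _ _)) (lin_sub (@nun_is_linear _ _ _)) -ec.
rewrite opprB addrC subrK scalerA mulVf ?scale1r //.
by have := natr_neq char0 (m := W.+1) (n := 0); rewrite subr0; apply.
Qed.

Lemma cosp_shift n m t : cosp n.-1 m.+1 t -> inv t ->
  exists c, [/\ cosp n m c, inv c & dd n c = dd n.-1 t].
Proof.
case: n => [|n] /= st it; last first.
  exists t; split=> //; first exact: cospW.
  by have := @dd_cosp n m.+1 1 _ isT st; rewrite addn1.
exists 0; rewrite !dd0; split=> //; first exact: ts_zero.
by move=> y; rewrite (lin0 (@adT_is_linear _)).
Qed.

(** A normalised invariant cocycle is cohomologous to a primitive one. *)
Theorem cocycle_prim n m t : cosp n m t -> dd n t = 0 -> inv t ->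
  exists q c, [/\ t = q + dd n.-1 c, cosp 0 (n + m) q, inv q,
                  cosp n.-1 m c & inv c].
Proof.
elim: n m t => [|n IHn] m t st dt it.
  exists t, 0; split=> //; first by rewrite dd0 addr0.
    exact: ts_zero.
  by move=> y; rewrite (lin0 (@adT_is_linear _)).
pose S (x : T) := [/\ cosp n.+1 m x, dd n.+1 x = 0 & inv x].
have Sl a (x x' : T) : S x -> S x' -> S (a *: x + x').
  move=> [sx dx ix] [sx' dx' ix']; split; first exact: ts_lin.
    by rewrite dd_is_linear dx dx' scaler0 addr0.
  exact: inv_lin.
have ht x : S x -> nun n.+1 x = dd n (ss n.+1 x) + tt n.+1 x.
  move=> [sx dx ix]; have := homotopy char0 (cosp_le n.+1 m) sx.
  by rewrite dx (lin0 (@ss_is_linear _ _ _)) add0r => ->; rewrite subrK.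
have dtt x : S x -> dd n (tt n.+1 x) = 0.
  move=> [sx dx ix]; have := dd_tt char0 (cosp_le n.+1 m) sx.
  by rewrite dx (lin0 (@tt_is_linear _ _ _)).
have Sn x : S x -> S (nun n.+1 x).
  move=> Sx; have [sx dx ix] := Sx; split; first exact: cosp_nun.
    rewrite ht // (linD (@dd_is_linear _ _ _)).
    rewrite (dd_dd _ (cosp_ss sx)) // add0r.
    by have := @dd_cosp n m.+1 1 _ isT (cosp_tt sx); rewrite addn1 dtt.
  by move=> y; rewrite (adT_nun _ _ sx) // ix (lin0 (@nun_is_linear _ _ _)).
have [W hW] := eigsum_killn (cosp_eigsum st).
have St : S t by [].
have [c Sc et] := nun_surj Sl Sn St (hW W (leqnn W)).
have [sc dc ic] := Sc.
have itt : inv (tt n.+1 c).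
  by move=> y; rewrite (adT_tt _ _ sc) // ic (lin0 (@tt_is_linear _ _ _)).
have iss : inv (ss n.+1 c).
  by move=> y; rewrite (adT_ss _ _ sc) // ic (lin0 (@ss_is_linear _ _ _)).
have [q [c' [eq sq iq sc' ic']]] := IHn _ _ (cosp_tt sc) (dtt _ Sc) itt.
have [c'' [sc'' ic'' ec'']] := cosp_shift sc' ic'.
exists q, (ss n.+1 c + c''); split=> //.
- by rewrite et ht // eq (linD (@dd_is_linear _ _ _)) ec''; modT.
- by rewrite addSnnS.
- by apply: tspanD => //; apply: cosp_ss.
- by rewrite -[ss _ _]scale1r; apply: inv_lin.
Qed.

End Cohomology.

(** * Alternation *)

Section Alternation.
Variables (k : fieldType) (g : lieAlgebra k).
Hypothesis char0 : [pchar k] =i pred0.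
Local Notation U := (ualg g).
Local Notation T := (talg (ualg g)).
Local Notation lt := (@pgen k (ualg g) None).
Local Notation euler := (@euler k g).
Implicit Types (y : g) (u v : U) (t : T).

Ltac modT := module_in k (T : lmodType k).

(** The signed sum of the insertions of [p] in all positions of a word of
    length [n]. *)
Fixpoint shp (n : nat) (p : U) (t : T) : T :=
  if n is n'.+1 then
    lt p * t - tcase 0 (fun v t => lt v * shp n' p t) t
  else lt p * t.

Lemma shp_bilin n : bilin (shp n).
Proof.
elim: n => [|n IHn] /=; first by lint.
have h p : bilin (fun v t => lt v * shp n p t) by lint.
by split=> ?; lint.
Qed.
Hint Resolve shp_bilin : bilin.

Lemma shp_is_linear n p : linear (shp n p).
Proof. exact: (shp_bilin n).2. Qed.
HB.instance Definition _ n p := GRing.isLinear.Build k T T _ (shp n p) (shp_is_linear n p).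

Lemma shp0 p t : shp 0 p t = lt p * t. Proof. by []. Qed.

Lemma shpC n p v t : shp n.+1 p (lt v * t) = lt p * (lt v * t) - lt v * shp n p t.
Proof. by rewrite /= tcaseM //; lint. Qed.

Arguments shp : simpl never.

Fixpoint alt (n : nat) : T -> T :=
  if n is n'.+1 then tcase 0 (fun u t => shp n' (euler u) (alt n' t)) else id.

Lemma alt_is_linear n : linear (alt n).
Proof. by case: n => [|n]; [apply: lin_id | apply: tcase_is_linear]. Qed.
HB.instance Definition _ n := GRing.isLinear.Build k T T _ (alt n) (alt_is_linear n).

Lemma alt0 t : alt 0 t = t. Proof. by []. Qed.

Lemma altC n u t : alt n.+1 (lt u * t) = shp n (euler u) (alt n t).
Proof. by rewrite /= tcaseM //; lint. Qed.

Arguments alt : simpl never.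

Lemma shp_anti n Ps p q t : (n <= size Ps)%N -> tspan Ps t ->
  shp n.+1 p (shp n q t) = - shp n.+1 q (shp n p t).
Proof.
move: t; elim: n Ps => [|n IHn] Ps.
  by move=> t _ _; rewrite !shp0 !shpC !shp0; modT.
apply: tspan_eqn; [by lint | by lint | move=> {}Ps u t le st /=].
rewrite !shpC !(lin_sub (@shp_is_linear _ _)) !shpC (IHn _ _ le st) mulrN (mulrBr (lt q)) (mulrBr (lt p)); modT.
Qed.

Lemma cosp_shp n p t : isg p -> cosp 0 n t -> cosp 0 n.+1 (shp n p t).
Proof.
move=> pg; move: t; elim: n => [|n IHn] t; first by rewrite shp0 => st; apply: ts_cons.
apply: tspan_map => [|u {}t eu st]; first exact: shp_is_linear.
rewrite shpC; apply: tspanD; first by apply: ts_cons => //; apply: ts_cons.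
by apply/tspanN/ts_cons => //; apply: IHn.
Qed.

Lemma cosp_homog n m t : cosp n m t -> homog (n + m) t.
Proof. by move/tspan_homog; rewrite size_cosp. Qed.

Lemma cosp_alt n t : homog n t -> cosp 0 n (alt n t).
Proof.
move: t; elim: n => [|n IHn] t; first by rewrite alt0.
apply: tspan_map => [|u {}t _ st]; first exact: alt_is_linear.
by rewrite altC; apply: cosp_shp; [apply: isg_euler | apply: IHn].
Qed.

Lemma alt_dd n t : homog n t -> alt n.+1 (dd n t) = 0.
Proof.
move: t; elim: n => [|n IHn] t st; first by rewrite dd0 (lin0 (@alt_is_linear _)).
move: t st; apply: tspan_eq => [|| u t _ st]; [by lint | by lint |].
rewrite ddC (linN (@alt_is_linear _)) (linD (@alt_is_linear _)).
rewrite [alt _ (lt u * _)]altC (IHn _ st) (lin0 (shp_is_linear _ _)) addr0.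
have s0 m x : shp m (euler 1) x = 0 by rewrite euler1 // (lin0 ((shp_bilin m).1 x)).
rewrite /rcop !(lin_sub (@alt_is_linear _)) !altC !s0 linear_csum /=.
rewrite (lin0 (shp_is_linear _ _)) !subr0.
set X := csum _ _; suff /eqP : X = - X.
  rewrite -subr_eq0 opprK -mulr2n -scaler_nat scaler_eq0 (negPf (two_neq0 char0)).
  by move=> /eqP ->; rewrite oppr0.
rewrite {1}/X csumC; last by split=> ? /=; lint.
rewrite /X -csumN; apply: eq_csum => a b; rewrite !altC.
by rewrite (@shp_anti n _ _ _ _ _ (cosp_alt st)) // size_cosp.
Qed.

Lemma adT_shp n Ps y p t : (n <= size Ps)%N -> tspan Ps t ->
  adT y (shp n p t) = shp n (uad y p) t + shp n p (adT y t).
Proof.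
move: t; elim: n Ps => [|n IHn] Ps.
  by move=> t _ _; rewrite !shp0 adTC.
apply: tspan_eqn; [by lint | by lint | move=> {}Ps u t le st /=].
rewrite adTC (linD (@shp_is_linear _ _)) !shpC (lin_sub (@adT_is_linear _ _ _)) !adTC.
by rewrite (IHn _ _ le st) !mulrDr; modT.
Qed.

Lemma adT_alt n y t : homog n t -> adT y (alt n t) = alt n (adT y t).
Proof.
move: t; elim: n => [|n IHn] t st; first by rewrite !alt0.
move: t st; apply: tspan_eq => [|| u t _ st]; [by lint | by lint |].
rewrite adTC (linD (@alt_is_linear _)) !altC (@adT_shp n _ _ _ _ _ (cosp_alt st)) ?size_cosp //.
by rewrite (IHn _ st) euler_uad.
Qed.

(** The symmetrised product has [v (x) p + p (x) v] as reduced coproduct. *)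
Definition usym v (p : U) : U := 2%:R^-1 *: (v * p + p * v).

Lemma usym_bilin : bilin usym.
Proof. by rewrite /usym; lint. Qed.
Hint Resolve usym_bilin : bilin.

Lemma rcop_usym v p t : isg v -> isg p ->
  rcop (usym v p) t = lt v * (lt p * t) + lt p * (lt v * t).
Proof.
move=> [y ->] [z ->]; rewrite /usym (linZ ((@rcop_bilin _ _).1 t)).
have e a b : rcop (ugen a * ugen b) t =
    lt (ugen a) * (lt (ugen b) * t) + lt (ugen b) * (lt (ugen a) * t).
  rewrite /rcop csumM; last by lint.
  by rewrite csum_gen ?mulr1; [modT | lint].
rewrite (linD ((@rcop_bilin _ _).1 t)) !e [X in _ + X]addrC -mulr2n -scaler_nat.
by rewrite scalerA mulVf ?scale1r //; apply: two_neq0.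
Qed.

Lemma uad_usym y v p : uad y (usym v p) = usym (uad y v) p + usym v (uad y p).
Proof.
rewrite /usym (linZ (@uad_is_linear _ _ y)) (linD (@uad_is_linear _ _ y)) !uadM -scalerDr; congr (_ *: _).
by rewrite [LHS](AC (2*2) ((1*4)*(2*3))).
Qed.

Lemma eps_usym v p : augm v -> augm (usym v p).
Proof.
rewrite /augm /usym => e; rewrite (linZ (@eps_is_linear _ _)) (linD (@eps_is_linear _ _)).
by rewrite !epsM e mul0r mulr0 addr0 scaler0.
Qed.

Fixpoint eta (n : nat) (p : U) : T -> T :=
  if n is n'.+1 then
    tcase 0 (fun v t => lt v * eta n' p t + n%:R *: (lt (usym v p) * t))
  else fun=> 0.

Lemma eta_bilin n : bilin (eta n).
Proof.
elim: n => [|n IHn]; first by split=> ?; apply: lin_zero.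
by split=> [t|p] /=; [lint | apply: tcase_is_linear].
Qed.
Hint Resolve eta_bilin : bilin.

Lemma eta_is_linear n p : linear (eta n p).
Proof. exact: (eta_bilin n).2. Qed.
HB.instance Definition _ n p := GRing.isLinear.Build k T T _ (eta n p) (eta_is_linear n p).

Lemma eta0 p t : eta 0 p t = 0. Proof. by []. Qed.

Lemma etaC n p v t : eta n.+1 p (lt v * t) =
  lt v * eta n p t + n.+1%:R *: (lt (usym v p) * t).
Proof. by rewrite /= tcaseM //; lint. Qed.

Arguments eta : simpl never.

Lemma shp_eta n p t : isg p -> cosp 0 n t ->
  shp n p t = n.+1%:R *: (lt p * t) + dd n (eta n p t).
Proof.
move=> pg; move: t; elim: n => [|n IHn] t st.
  by rewrite shp0 eta0 dd0 scale1r addr0.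
move: t st; apply: tspan_eq => [|| v t vg st]; [by lint | by lint |].
have {}st : cosp 0 n t by [].
rewrite shpC (IHn _ st) etaC (linD (@dd_is_linear _ _ _)) (linZ (@dd_is_linear _ _ _)).
rewrite !ddC rcop_isg // rcop_usym // (dd_prim (leqnn n) st) mulr0 !mulrDr -!scalerAr.
have e2 : n.+2%:R = n.+1%:R + 1 :> k by rewrite natr1.
by rewrite e2; modT.
Qed.

Fixpoint zeta (n : nat) : T -> T :=
  if n is n'.+1 then
    tcase 0 (fun u t => - (n%:R *: (lt u * zeta n' t)) + eta n' u (alt n' t))
  else fun=> 0.

Lemma zeta_is_linear n : linear (zeta n).
Proof. by case: n => [|n]; [apply: lin_zero | apply: tcase_is_linear]. Qed.
HB.instance Definition _ n := GRing.isLinear.Build k T T _ (zeta n) (zeta_is_linear n).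

Lemma zeta0 t : zeta 0 t = 0. Proof. by []. Qed.

Lemma zetaC n u t : zeta n.+1 (lt u * t) =
  - (n.+1%:R *: (lt u * zeta n t)) + eta n u (alt n t).
Proof. by rewrite /= tcaseM //; lint. Qed.

Arguments zeta : simpl never.

Lemma alt_zeta n t : cosp 0 n t ->
  alt n t = n`!%:R *: t + dd n.-1 (zeta n t).
Proof.
move: t; elim: n => [|n IHn] t st; first by rewrite alt0 zeta0 dd0 fact0 scale1r addr0.
move: t st; apply: tspan_eq => [|| v t vg st]; [by lint | by lint |].
have {}st : cosp 0 n t by [].
have ev : euler v = v by case: vg => y ->; rewrite euler_gen.
have ha := cosp_alt (cosp_homog st).
rewrite altC ev (shp_eta vg ha) zetaC (linD (@dd_is_linear _ _ _)) (linN (@dd_is_linear _ _ _)) (linZ (@dd_is_linear _ _ _)).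
rewrite (@ddC_pred _ _ _ _ _ zeta) // rcop_isg // {1}(IHn _ st) factS natrM.
by rewrite (mulrDr (lt v)) -!scalerAr /=; modT.
Qed.

Lemma cosp_eta n p t : isg p -> cosp 0 n t -> cosp n 0 (eta n p t).
Proof.
move=> pg; move: t; elim: n => [|n IHn] t; first by rewrite eta0 => _; apply: ts_zero.
apply: tspan_map => [|u {}t eu st]; first exact: eta_is_linear.
have au : augm u by apply: isg_eps.
rewrite etaC; apply: tspanD; first by apply: ts_cons => //; apply: IHn.
apply/tspanZ/ts_cons; first exact: eps_usym.
move: st; apply: (@tspan_sub _ _ (nseq n (@isg k g)) (nseq n (@augm k g) ++ [::])) => [|i v].
  by rewrite size_cat !size_nseq addn0.
by rewrite cats0 !nth_nseq; case: ifP => // _; apply: isg_eps.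
Qed.

Lemma cosp_zeta n t : cosp 0 n t -> cosp n.-1 0 (zeta n t).
Proof.
move: t; elim: n => [|n IHn] t; first by rewrite zeta0 => _; apply: ts_zero.
apply: tspan_map => [|u {}t eu st]; first exact: zeta_is_linear.
rewrite zetaC; apply: tspanD; last by apply: cosp_eta => //; apply/cosp_alt/(cosp_homog (st : cosp 0 n t)).
apply/tspanN/tspanZ; case: n IHn st => [|n] IHn st.
  by rewrite zeta0 mulr0; apply: ts_zero.
by apply: ts_cons; [apply: isg_eps | apply: IHn].
Qed.

Lemma adT_eta n Ps y p t : (n <= size Ps)%N -> tspan Ps t ->
  adT y (eta n p t) = eta n (uad y p) t + eta n p (adT y t).
Proof.
move: t; elim: n Ps => [|n IHn] Ps.
  by move=> t _ _; rewrite !eta0 (lin0 (@adT_is_linear _ _ _)) addr0.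
apply: tspan_eqn; [by lint | by lint | move=> {}Ps u t le st /=].
rewrite adTC (linD (@eta_is_linear _ _)) !etaC (linD (@adT_is_linear _ _ _)) (linZ (@adT_is_linear _ _ _)) !adTC.
by rewrite (IHn _ _ le st) uad_usym (linD (@pgen_is_linear _ _ None) (usym _ _)) (mulrDl _ _ t) !(mulrDr (lt u)); modT.
Qed.

Lemma adT_zeta n y t : cosp 0 n t -> adT y (zeta n t) = zeta n (adT y t).
Proof.
move: t; elim: n => [|n IHn] t st; first by rewrite !zeta0 (lin0 (@adT_is_linear _ _ _)).
move: t st; apply: tspan_eq => [|| u t _ st]; [by lint | by lint |].
have {}st : cosp 0 n t by [].
have ha := cosp_alt (cosp_homog st).
rewrite adTC (linD (@zeta_is_linear _)) !zetaC (linD (@adT_is_linear _ _ _)) (linN (@adT_is_linear _ _ _)) (linZ (@adT_is_linear _ _ _)) adTC.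
rewrite (@adT_eta n _ _ _ _ _ ha) ?size_cosp // (IHn _ st) (adT_alt _ (cosp_homog st)); modT.
Qed.

(** The cohomology class of a cocycle is determined by its alternation. *)
Theorem cocycle_alt n t : cosp n 0 t -> dd n t = 0 -> inv t ->
  exists c, [/\ n`!%:R *: t = alt n t + dd n.-1 c, cosp n.-1 0 c & inv c].
Proof.
move=> st dt it.
have [q [c [et sq iq sc ic]]] := cocycle_prim char0 st dt it.
rewrite addn0 in sq.
exists (n`!%:R *: c - zeta n q); split.
- have ea : alt n t = alt n q.
    rewrite et (linD (@alt_is_linear _)); case: n {st dt it et sq} sc => [|n] sc.
      by rewrite dd0 (lin0 (@alt_is_linear _)) addr0.
    by rewrite alt_dd ?addr0 //; have := cosp_homog sc; rewrite addn0.
  rewrite ea (alt_zeta sq) et (lin_sub (@dd_is_linear _ _ _)) (linZ (@dd_is_linear _ _ _)); modT.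
- by apply: tspanD; [apply: tspanZ | apply/tspanN/cosp_zeta].
- move=> y; rewrite (lin_sub (@adT_is_linear _ _ _)) (linZ (@adT_is_linear _ _ _)) ic.
  by rewrite (adT_zeta _ sq) iq (lin0 (@zeta_is_linear _)) scaler0 subrr.
Qed.

(** The exchange of the letters [i] and [i + 1]. *)
Fixpoint tau (i : nat) : T -> T :=
  if i is i'.+1 then tcase 0 (fun u t => lt u * tau i' t)
  else tcase 0 (fun u => tcase 0 (fun v t => lt v * (lt u * t))).

Lemma tau_is_linear i : linear (tau i).
Proof. by case: i => [|i]; apply: tcase_is_linear. Qed.
HB.instance Definition _ n := GRing.isLinear.Build k T T _ (tau n) (tau_is_linear n).

Lemma tau0C u v t : tau 0 (lt u * (lt v * t)) = lt v * (lt u * t).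
Proof. by rewrite /= !tcaseM //; lint. Qed.

Lemma tauC i u t : tau i.+1 (lt u * t) = lt u * tau i t.
Proof. by rewrite /= tcaseM //; lint. Qed.

Arguments tau : simpl never.

Lemma tau_ins i Ps p t : (i < size Ps)%N -> tspan Ps t ->
  tau i (ins i p t) = ins i.+1 p t /\ tau i (ins i.+1 p t) = ins i p t.
Proof.
move: t; elim: i Ps => [|i IHi] Ps t le st; split; move: t le st;
  apply: tspan_eqn; try (by lint); move=> {}Ps u t le st /=.
- by rewrite insC !ins0 tau0C.
- by rewrite insC !ins0 tau0C.
- by rewrite !insC tauC (IHi Ps t _ st).1.
- by rewrite !insC tauC (IHi Ps t _ st).2.
Qed.

Lemma tau_ins_lt i j Ps p t : (j <= i)%N -> (j <= size Ps)%N -> tspan Ps t ->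
  tau i.+1 (ins j p t) = ins j p (tau i t).
Proof.
move: t; elim: j i Ps => [|j IHj] i Ps t; first by rewrite !ins0 tauC.
move=> ji; move: t; apply: tspan_eqn; [by lint | by lint | move=> {}Ps u t le st /=].
by case: i ji => // i ji; rewrite insC !tauC insC (IHj _ _ _ ji le st).
Qed.

Lemma tau_ins_gt i j Ps p t : (i.+1 < j)%N -> (j <= size Ps)%N -> tspan Ps t ->
  tau i (ins j p t) = ins j p (tau i t).
Proof.
move: t; elim: i j Ps => [|i IHi] [//|j] Ps t; last first.
  rewrite ltnS => ji; move: t; apply: tspan_eqn; [by lint | by lint | move=> {}Ps u t le st /=].
  by rewrite insC !tauC insC (IHi _ _ _ ji le st).
case: j => // j _; move: t; apply: tspan_eqn; [by lint | by lint | move=> {}Ps u t le st /=].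
rewrite insC; move: t le st; apply: tspan_eqn; [by lint | by lint | move=> {}Ps v t le st /=].
by rewrite insC !tau0C !insC.
Qed.

Lemma shp_ins n Ps p t : (n <= size Ps)%N -> tspan Ps t ->
  shp n p t = \sum_(0 <= j < n.+1) (-1) ^+ j *: ins j p t.
Proof.
move: t; elim: n Ps => [|n IHn] Ps t; first by rewrite big_nat1 expr0 scale1r shp0.
move: t; apply: tspan_eqn; [by lint | by lint | move=> {}Ps u t le st /=].
rewrite shpC (IHn _ _ le st) big_nat_recl // expr0 scale1r ins0; congr (_ + _).
rewrite mulr_sumr -sumrN; apply: eq_bigr => j _; rewrite insC -scalerAr exprS; modT.
Qed.

Definition anti n t : Prop := forall i, (i.+1 < n)%N -> tau i t = - t.

Lemma shp_antisym n p t : homog n t -> anti n t -> anti n.+1 (shp n p t).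
Proof.
move=> st at_ i; rewrite ltnS => lt_in.
have le : (n <= size (nseq n (fun _ : U => True)))%N by rewrite size_nseq.
rewrite (shp_ins _ le st) (lin_sumE _ _ (@tau_is_linear i)).
have zl j : tau i ((-1) ^+ j *: ins j p t) = (-1) ^+ j *: tau i (ins j p t).
  by rewrite (linZ (@tau_is_linear i)).
under eq_bigr do rewrite zl.
have i2 : (i.+2 <= n.+1)%N by [].
have i0 : (i <= n.+1)%N by do 2!apply: ltnW.
have sp (F : nat -> T) : \sum_(0 <= j < n.+1) F j = \sum_(0 <= j < i) F j + \sum_(i <= j < n.+1) F j.
  by rewrite (big_cat_nat (leq0n i)).
rewrite !sp.
have cut (F : nat -> T) : \sum_(i <= j < n.+1) F j = F i + F i.+1 + \sum_(i.+2 <= j < n.+1) F j.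
  rewrite big_ltn; last by apply: ltnW.
  by rewrite big_ltn ?addrA.
rewrite !cut (tau_ins p (i := i) (Ps := nseq n (fun=> True)) _ st).1 ?size_nseq //.
rewrite (tau_ins p (i := i) (Ps := nseq n (fun=> True)) _ st).2 ?size_nseq //.
have e1 : \sum_(0 <= j < i) (-1) ^+ j *: tau i (ins j p t) = - \sum_(0 <= j < i) (-1) ^+ j *: ins j p t.
  rewrite -sumrN; apply: eq_big_nat => j /andP [_ ji]; rewrite -scalerN; congr (_ *: _).
  case: i ji lt_in {zl i2 i0 cut sp} => // i ji lt_in.
  have {}ji : (j <= i)%N by [].
  have jn : (j <= n)%N by apply: leq_trans ji _; do 2!apply: ltnW.
  rewrite (tau_ins_lt p ji _ st) ?size_nseq // at_ ?(linN (ins_is_linear _ _)) //.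
have e2 : \sum_(i.+2 <= j < n.+1) (-1) ^+ j *: tau i (ins j p t) = - \sum_(i.+2 <= j < n.+1) (-1) ^+ j *: ins j p t.
  rewrite -sumrN; apply: eq_big_nat => j /andP [ij jn]; rewrite -scalerN; congr (_ *: _).
  rewrite (tau_ins_gt p ij _ st) ?size_nseq // at_ ?(linN (ins_is_linear _ _)) //.
  by apply: leq_trans ij _.
rewrite e1 e2; modT.
Qed.

Lemma alt_antisym n t : homog n t -> anti n (alt n t).
Proof.
move: t; elim: n => [|n IHn] t st; first by [].
move=> i lt_in; move: t st; apply: tspan_eq => [|| u t _ st]; [by lint | by lint |].
rewrite altC; apply: shp_antisym => //; last exact: IHn.
exact: (cosp_homog (cosp_alt st)).
Qed.

End Alternation.

Arguments shp : simpl never.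
Arguments alt : simpl never.
Arguments tau : simpl never.

(** * The cosimplicial algebra of tensor powers *)

Section Cosimplicial.
Variables (k : fieldType) (g : lieAlgebra k).
Local Notation U := (ualg g).
Local Notation T := (talg (ualg g)).
Local Notation lt := (@pgen k (ualg g) None).
Implicit Types (y : g) (u v : U) (s t : T).

Ltac modT := module_in k (T : lmodType k).

Lemma mul_csum (x : T) (B : U -> U -> T) u :
  x * csum B u = csum (fun a b => x * B a b) u.
Proof. exact: (csum_ap B u (lin_mull x (@lin_id _ T))). Qed.

Fixpoint cof (i : nat) : T -> T :=
  match i with
  | 0%N => fun t => lt 1 * t
  | i'.+1 =>
    match i' with
    | 0%N => tcase (lt 1) (fun u t => csum (fun a b => lt a * (lt b * t)) u)
    | _ => tcase 0 (fun u t => lt u * cof i' t)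
    end
  end.

Lemma cof_is_linear i : linear (cof i).
Proof. by case: i => [|[|i]] /=; lint. Qed.
HB.instance Definition _ i := GRing.isLinear.Build k T T _ (cof i) (cof_is_linear i).

Arguments cof : simpl never.

Lemma cof0 t : cof 0 t = lt 1 * t. Proof. by []. Qed.

Lemma cof11 : cof 1 1 = lt 1.
Proof. by rewrite [LHS]tcase1 //; lint. Qed.

Lemma cof1C u t : cof 1 (lt u * t) = csum (fun a b => lt a * (lt b * t)) u.
Proof. by rewrite [LHS]tcaseM //; lint. Qed.

Lemma cofSC i u t : cof i.+2 (lt u * t) = lt u * cof i.+1 t.
Proof.
have h : bilin (fun v s => lt v * cof i.+1 s) by lint.
exact: (tcaseM 0 u t h).
Qed.

Lemma dd_cof n t : homog n t -> dd n t = \sum_(0 <= i < n.+2) (-1) ^+ i *: cof i t.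
Proof.
move: t; elim: n => [|n IHn] t st.
  have [a ->] := tspan_nil st.
  rewrite !big_nat_recl // big_geq // cof0 (linZ (@cof_is_linear 1)) cof11 dd0.
  by rewrite -scalerAr mulr1; modT.
move: t st; apply: tspan_eq => [|| u t _ st]; [by lint | by lint |].
do 2 rewrite big_nat_recl //; rewrite cof0 cof1C ddC (IHn _ st).
have -> : \sum_(0 <= i < n.+1) (-1) ^+ i.+2 *: cof i.+2 (lt u * t) =
    - (lt u * \sum_(0 <= i < n.+1) (-1) ^+ i.+1 *: cof i.+1 t).
  rewrite mulr_sumr -sumrN; apply: eq_bigr => i _.
  by rewrite cofSC -scalerAr; modT.
rewrite big_nat_recl // cof0 (mulrDr (lt u)) -scalerAr /rcop; modT.
Qed.

Fixpoint sig (i : nat) : T -> T :=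
  if i is i'.+1 then tcase 0 (fun u t => lt u * sig i' t)
  else tcase 0 (fun u (t : T) => (eps u : k) *: t).

Lemma sig_is_linear i : linear (sig i).
Proof. by case: i => [|i] /=; lint. Qed.
HB.instance Definition _ i := GRing.isLinear.Build k T T _ (sig i) (sig_is_linear i).

Arguments sig : simpl never.

Lemma eps_bilin : bilin (fun u (t : T) => (eps u : k) *: t).
Proof. by lint. Qed.

Lemma sig0C u t : sig 0 (lt u * t) = (eps u : k) *: t.
Proof. by rewrite [LHS]tcaseM //; exact: eps_bilin. Qed.

Lemma sigSC i u t : sig i.+1 (lt u * t) = lt u * sig i t.
Proof.
have h : bilin (fun v s => lt v * sig i s) by lint.
exact: (tcaseM 0 u t h).
Qed.

Lemma sig1 i : sig i 1 = 0.
Proof.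
have h j : bilin (fun v s => lt v * sig j s) by lint.
by case: i => [|i]; [exact: (tcase1 0 eps_bilin) | exact: (tcase1 0 (h i))].
Qed.

Definition advn (c : nat) : T -> T := iter c (sig 0).

Lemma advn_is_linear c : linear (advn c).
Proof. by elim: c => // c IHc a s t; rewrite /= IHc sig_is_linear. Qed.
HB.instance Definition _ c := GRing.isLinear.Build k T T _ (advn c) (advn_is_linear c).

Lemma advnS c t : advn c.+1 t = advn c (sig 0 t).
Proof. by rewrite /advn iterSr. Qed.

Lemma advn0 t : advn 0 t = t. Proof. by []. Qed.

Lemma advnC c u t : advn c.+1 (lt u * t) = (eps u : k) *: advn c t.
Proof. by rewrite advnS sig0C (linZ (@advn_is_linear c)). Qed.

Lemma advnD c d t : advn (c + d) t = advn d (advn c t).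
Proof. by rewrite addnC /advn iterD. Qed.

Arguments advn : simpl never.

(** [dist [:: c1; ...; cm]] reads a path through [m] separators: at each of them
    a part of the current letter is output by the coproduct, and then the next
    [ci] letters are discarded by the counit. *)
Fixpoint dist (cs : seq nat) : T -> T :=
  if cs is c :: cs' then
    tcase 0 (fun u t => csum (fun a b => lt a * dist cs' (advn c (lt b * t))) u)
  else sig 0.

Lemma dist_is_linear cs : linear (dist cs).
Proof. by case: cs => [|c cs] /=; [apply: sig_is_linear | apply: tcase_is_linear]. Qed.
HB.instance Definition _ cs := GRing.isLinear.Build k T T _ (dist cs) (dist_is_linear cs).

Arguments dist : simpl never.

Lemma dist_bilin cs c t : bilin (fun a b => lt a * dist cs (advn c (lt b * t))).
Proof. by lint. Qed.

Lemma dist_bilin2 cs c :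
  bilin (fun u t => csum (fun a b => lt a * dist cs (advn c (lt b * t))) u).
Proof. by lint. Qed.

Lemma distC c cs u t : dist (c :: cs) (lt u * t) =
  csum (fun a b => lt a * dist cs (advn c (lt b * t))) u.
Proof. exact: (tcaseM 0 u t (dist_bilin2 cs c)). Qed.

Lemma dist1 cs : dist cs 1 = 0.
Proof. by case: cs => [|c cs]; [apply: sig1 | exact: (tcase1 0 (dist_bilin2 cs c))]. Qed.

Lemma advn1 c : advn c 1 = (c == 0%N)%:R.
Proof. by case: c => [|c] //; rewrite advnS sig1 (lin0 (@advn_is_linear c)). Qed.

Definition pathF (cs : seq nat) (t : T) : T :=
  if cs is c :: cs' then dist cs' (advn c t) else 0.

Lemma pathF_is_linear cs : linear (pathF cs).
Proof.
case: cs => [|c cs] /=; first exact: lin_zero.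
exact: lin_comp (@dist_is_linear cs) (@advn_is_linear c).
Qed.
HB.instance Definition _ cs := GRing.isLinear.Build k T T _ (pathF cs) (pathF_is_linear cs).

Lemma distE c cs u t : dist (c :: cs) (lt u * t) =
  csum (fun a b => lt a * pathF (c :: cs) (lt b * t)) u.
Proof. exact: distC. Qed.

Lemma pathF_bilin cs t : bilin (fun a b => lt a * pathF cs (lt b * t)).
Proof. by lint. Qed.

(** ** Codegeneracies in the target *)

Fixpoint merge (i : nat) (cs : seq nat) : seq nat :=
  match i, cs with
  | 0%N, c :: c' :: cs' => (c + c')%N :: cs'
  | i'.+1, c :: cs' => c :: merge i' cs'
  | _, _ => cs
  end.

Lemma sig0_dist c cs t : sig 0 (dist (c :: cs) t) = pathF (c :: cs) t.
Proof.
elim/palg_rect: t => [|u t _|a s t es et].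
- by rewrite dist1 (lin0 (@sig_is_linear 0)) /= advn1; case: eqP => _; rewrite ?dist1 ?(lin0 (@dist_is_linear cs)).
- rewrite distE linear_csum -[RHS](csum_epsl u (f := fun b => pathF (c :: cs) (lt b * t))); last first.
    by have := (pathF_bilin (c :: cs) t); lint.
  by apply: eq_csum => a b; rewrite /= sig0C.
- by rewrite (@dist_is_linear (c :: cs)) (@sig_is_linear 0) (@pathF_is_linear (c :: cs)) es et.
Qed.

Lemma sig_dist i c cs t : (i < size cs)%N ->
  sig i.+1 (dist (c :: cs) t) = dist (merge i (c :: cs)) t.
Proof.
elim: i c cs t => [|i IHi] c [//|c' cs] t; rewrite /= ?ltnS => lt_i.
  elim/palg_rect: t => [|u t _|a s t es et].
  - by rewrite !dist1 (lin0 (@sig_is_linear 1)).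
  - rewrite !distC linear_csum; apply: eq_csum => a b.
    by rewrite /= sigSC sig0_dist /= advnD.
  - by rewrite !dist_is_linear (@sig_is_linear 1) es et.
elim/palg_rect: t => [|u t _|a s t es et].
- by rewrite !dist1 (lin0 (@sig_is_linear _)).
- rewrite !distC linear_csum; apply: eq_csum => a b.
  by rewrite /= sigSC IHi.
- by rewrite !dist_is_linear (@sig_is_linear _) es et.
Qed.

Lemma sig_pathF i cs t : (i.+1 < size cs)%N ->
  sig i (pathF cs t) = pathF (merge i cs) t.
Proof.
case: cs => [|c [|c' cs]] //; rewrite ltnS; case: i => [|i] lt_i.
  by rewrite [pathF _ t]/= sig0_dist /= advnD.
by rewrite [pathF _ t]/= sig_dist.
Qed.

(** ** Faces in the source *)

Fixpoint dec (i : nat) (cs : seq nat) : seq nat :=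
  if cs is c :: cs' then
    if (i < c)%N then c.-1 :: cs' else c :: dec (i - c) cs'
  else [::].

Lemma advn_span c Ps t : tspan Ps t -> (c <= size Ps)%N -> tspan (drop c Ps) (advn c t).
Proof.
elim: c Ps t => [|c IHc] [|P Ps] t st //; rewrite ?drop0 // ltnS => le.
move: t st; apply: tspan_map; first exact: advn_is_linear.
by move=> u t _ st; rewrite advnC; apply: tspanZ; apply: IHc.
Qed.

Lemma advn_cof_lt i c Ps t : (i < c)%N -> (i < size Ps)%N -> tspan Ps t ->
  advn c (cof i.+1 t) = advn c.-1 t.
Proof.
elim: i c Ps t => [|i IHi] [//|c] Ps t /=; rewrite ?ltnS => ic; move: t; apply: tspan_eqn; try by [apply: (lin_comp (advn_is_linear _) (cof_is_linear _)) | apply: advn_is_linear].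
  move=> {}Ps u t _ st /=; rewrite cof1C linear_csum -[RHS](csum_epsl u (f := fun b => advn c (lt b * t))); last by lint.
  by apply: eq_csum => a b; rewrite /= advnC.
move=> {}Ps u t le st /=; case: c ic => // c ic.
by rewrite cofSC !advnC (IHi _ _ _ ic le st).
Qed.

Lemma advn_cof_ge i c Ps t : (c <= i)%N -> (i < size Ps)%N -> tspan Ps t ->
  advn c (cof i.+1 t) = cof (i - c).+1 (advn c t).
Proof.
elim: c i Ps t => [|c IHc] i Ps t; first by rewrite subn0.
case: i => [//|i]; rewrite ltnS => ci; move: t; apply: tspan_eqn.
- exact: (lin_comp (advn_is_linear _) (cof_is_linear _)).
- exact: (lin_comp (cof_is_linear _) (advn_is_linear _)).
move=> {}Ps u t le st /=.
by rewrite cofSC !advnC (linZ (@cof_is_linear _)) subSS (IHc _ _ _ ci le st).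
Qed.

Lemma dist_cof c cs i u t :
  dist (c :: cs) (cof i.+1 (lt u * t)) =
  csum (fun a b => lt a * pathF (c :: cs) (cof i.+1 (lt b * t))) u.
Proof.
case: i => [|i]; last first.
  by rewrite cofSC distE; apply: eq_csum => a b; rewrite cofSC.
rewrite cof1C linear_csum /=.
pose C a b d := lt a * pathF (c :: cs) (lt b * (lt d * t)) : T.
have Ct : trilin C by rewrite /C; split=> ? ? /=; lint.
transitivity (csum (fun a b => csum (fun a' a'' => C a' a'' b) a) u).
  by apply: eq_csum => a b; rewrite /= distE.
rewrite csumA //; apply: eq_csum => a b.
by rewrite cof1C -[dist _ _]/(pathF (c :: cs) _) (csum_ap _ _ (@pathF_is_linear _)) mul_csum.
Qed.

Lemma dist_dec cs i Ps t : (i < sumn cs)%N -> (i < size Ps)%N -> tspan Ps t ->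
  dist cs (cof i.+1 t) = dist (dec i cs) t.
Proof.
elim: cs i Ps t => [//|c cs IHcs] i Ps t /= lt_i; move: t; apply: tspan_eqn.
- exact: (lin_comp (@dist_is_linear _) (@cof_is_linear _)).
- exact: dist_is_linear.
move=> {}Ps u t le st /=; rewrite dist_cof.
have sb b : tspan ((fun=> True) :: Ps) (lt b * t) by apply: ts_cons.
case: ltnP => ic; rewrite distC; apply: eq_csum => a b.
  by rewrite /= (advn_cof_lt ic _ (sb b)).
rewrite /= (advn_cof_ge ic _ (sb b)) //; congr (_ * _).
apply: IHcs; [by rewrite ltn_subLR | | apply: advn_span (sb b) _].
  by rewrite size_drop /= ltn_sub2r // (leq_ltn_trans ic).
exact: leq_trans ic (leqW le).
Qed.

Lemma pathF_dec cs i Ps t : (i < sumn cs)%N -> (i < size Ps)%N -> tspan Ps t ->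
  pathF cs (cof i.+1 t) = pathF (dec i cs) t.
Proof.
case: cs => [//|c cs] /= lt_i le st; case: ltnP => ic /=.
  by rewrite (advn_cof_lt ic le st).
rewrite (advn_cof_ge ic le st).
apply: (@dist_dec _ _ (drop c Ps)); [by rewrite ltn_subLR | | apply: advn_span st _].
  by rewrite size_drop ltn_sub2r // (leq_ltn_trans ic).
by apply: (leq_trans ic); apply: ltnW.
Qed.

(** ** Cofaces in the target *)

Definition insz (i : nat) (cs : seq nat) : seq nat := take i cs ++ 0%N :: drop i cs.

(* Words of length [n + 1] ending with the letter 1. *)
Definition closed (n : nat) : T -> Prop := tspan (nseq n (fun=> True) ++ [:: eq 1]).

Lemma closed0 t : closed 0 t -> exists a, t = a *: lt 1.
Proof.
rewrite /closed /=; move: t; apply: tspan_cons_ind; first by exists 0; rewrite scale0r.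
  by move=> a x x' [b ->] [c ->]; exists (a * b + c); rewrite scalerDl scalerA.
by move=> u x <- /tspan_nil [a ->]; exists a; rewrite -scalerAr mulr1.
Qed.

Lemma closed_advn c n t : closed (c + n) t -> closed n (advn c t).
Proof.
move=> st; have := advn_span (c := c) st; rewrite size_cat size_nseq /=.
have -> : drop c (nseq (c + n) (fun=> True) ++ [:: eq (1 : U)]) = nseq n (fun=> True) ++ [:: eq 1].
  by rewrite nseqD -catA drop_cat size_nseq ltnn subnn drop0.
by apply; rewrite -addnA leq_addr.
Qed.

Lemma dist_zeros cs : sumn cs = 0%N -> dist cs (lt 1) = lt 1 ^+ size cs.
Proof.
elim: cs => [|c cs IHcs] /=.
  by rewrite -[lt 1]mulr1 /dist sig0C eps1 scale1r.
case: c => // e; rewrite -[lt 1]mulr1 distC csum1; last exact: dist_bilin.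
by rewrite advn0 mulr1 IHcs // exprS.
Qed.

Lemma cof_ones i m : (i <= m)%N -> cof i.+1 (lt 1 ^+ m) = lt 1 ^+ m.+1.
Proof.
elim: i m => [|i IHi] [|m] //; first by rewrite cof11.
  by rewrite [in LHS]exprS cof1C csum1 -?exprS //; lint.
by rewrite ltnS => le; rewrite [in LHS]exprS cofSC IHi // -exprS.
Qed.

Lemma sumn_insz i cs : sumn (insz i cs) = sumn cs.
Proof. by rewrite /insz sumn_cat /= -sumn_cat cat_take_drop. Qed.

Lemma size_insz i cs : size (insz i cs) = (size cs).+1.
Proof. by rewrite /insz size_cat /= addnS -size_cat cat_take_drop. Qed.

Lemma dist_insz i cs t : (i <= size cs)%N -> closed (sumn cs) t ->
  dist (insz i cs) t = cof i.+1 (dist cs t).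
Proof.
elim: cs i t => [|c cs IHcs] i t le st.
  have [a ->] := closed0 st.
  rewrite !(linZ (@dist_is_linear _)) (linZ (@cof_is_linear _)).
  by rewrite !dist_zeros ?sumn_insz // cof_ones // size_insz.
have [e0|s0] := posnP (sumn (c :: cs)).
  move: st; rewrite e0 => /closed0 [a ->].
  rewrite !(linZ (@dist_is_linear _)) (linZ (@cof_is_linear _)).
  by rewrite !dist_zeros ?sumn_insz // cof_ones // size_insz.
case: i le => [|i] le.
  rewrite /insz take0 drop0 cat0s; elim/palg_rect: t {st} => [|u t _|a s t es et].
  - by rewrite !dist1 (lin0 (@cof_is_linear _)).
  - rewrite distE [dist (c :: cs) _]distE linear_csum.
    pose C a b d := lt a * (lt b * pathF (c :: cs) (lt d * t)) : T.
    have Ct : trilin C by rewrite /C; split=> ? ? /=; lint.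
    transitivity (csum (fun a b => csum (C a) b) u).
      by apply: eq_csum => a b; rewrite [pathF _ _]/= advn0 distE mul_csum.
    by rewrite -csumA //; apply: eq_csum => a b; rewrite /= cof1C.
  - by rewrite !dist_is_linear (@cof_is_linear _) es et.
have -> : insz i.+1 (c :: cs) = c :: insz i cs by [].
move: s0 st; rewrite /closed; case e : (sumn (c :: cs)) => [//|m] _.
move: t; apply: tspan_eq.
- exact: dist_is_linear.
- exact: (lin_comp (@cof_is_linear _) (@dist_is_linear _)).
move=> u t _ st; rewrite !distC linear_csum; apply: eq_csum => a b.
rewrite /= cofSC IHcs //; apply: closed_advn.
by move: e => /= ->; apply: ts_cons.
Qed.

Lemma pathF_insz i cs n t : (i <= size cs)%N -> sumn cs = n.+1 -> closed n t ->
  pathF (insz i cs) (lt 1 * t) = cof i (pathF cs (lt 1 * t)).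
Proof.
case: cs => [|c cs] // le e st; case: i le => [|i] le.
  rewrite /insz take0 drop0 cat0s [LHS]/= advn0 distE csum1 ?cof0 //.
  exact: pathF_bilin.
rewrite /= [take _ _ ++ _]/(insz i cs) dist_insz //; apply: closed_advn.
by move: e => /= ->; apply: ts_cons.
Qed.

(** ** Degenerate paths *)

Lemma has2_sumn cs : has (leq 2) cs -> (1 < sumn cs)%N.
Proof.
elim: cs => //= c cs IHcs /orP [le|/IHcs le]; apply: leq_trans le _.
  exact: leq_addr.
exact: leq_addl.
Qed.

Lemma pathF_degenerate n cs u t v : sumn cs = n.+1 -> has (leq 2) cs ->
  cosp n 0 t -> pathF cs (lt u * (t * lt v)) = 0.
Proof.
elim: cs n u t => [//|c cs IHcs] n u t /= e deg st.
have hz w s m : sumn cs = m.+1 -> has (leq 2) cs -> cosp m 0 s ->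
    dist cs (lt w * (s * lt v)) = 0.
  case: cs IHcs {e deg} => // c' cs IHcs em deg ss.
  rewrite distE -[RHS](csum0 _ w); apply: eq_csum => a b.
  by rewrite (IHcs m) // mulr0.
case: c e deg => [|[|c]] e; rewrite ?ltn0 ?orbF.
- by move=> /= deg; rewrite advn0 (hz _ _ n).
- move=> /= deg; rewrite advnC advn0 (linZ (@dist_is_linear _)).
  case: n e st => [|n] e st.
    have z : sumn cs = 0%N by move: e; rewrite add1n => -[].
    by move/has2_sumn: deg; rewrite z.
  move: t st; apply: tspan_eq; [|exact: lin_zero|].
    exact: lin_scale (lin_comp (@dist_is_linear _) (lin_mulr _ (@lin_id _ T))).
  move=> w t _ st; rewrite -mulrA (hz _ _ n) ?scaler0 //.
  by move: e; rewrite add1n => -[].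
move=> _; case: n e st => [|n] e st; first by move: e; rewrite !addSn.
rewrite advnC; move: t st; apply: tspan_eq; [|exact: lin_zero|].
  apply: (lin_comp (@dist_is_linear _)); apply: lin_scale.
  exact: lin_comp (@advn_is_linear _) (lin_mulr _ (@lin_id _ T)).
move=> w t ew st; rewrite -mulrA advnC [eps w]ew scale0r scaler0.
exact: lin0 (@dist_is_linear _).
Qed.

End Cosimplicial.
Arguments cof : simpl never.
Arguments sig : simpl never.
Arguments advn : simpl never.
Arguments dist : simpl never.

Section Product.
Variables (k : fieldType) (g : lieAlgebra k).
Local Notation U := (ualg g).
Local Notation T := (talg (ualg g)).
Local Notation lt := (@pgen k (ualg g) None).
Implicit Types (y : g) (u v : U) (s t : T).

Ltac modT := module_in k (T : lmodType k).

(** The product of the algebra of [n]-fold tensors. *)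
Fixpoint star (n : nat) (s t : T) : T :=
  if n is n'.+1 then
    tcase 0 (fun u s' => tcase 0 (fun v t' => lt (u * v) * star n' s' t') t) s
  else s * t.

Lemma star_bilin n : bilin (star n).
Proof.
elim: n => [|n IHn] /=; first by lint.
by split=> ?; lint.
Qed.
Hint Resolve star_bilin : bilin.

Lemma starC n u v s t :
  star n.+1 (lt u * s) (lt v * t) = lt (u * v) * star n s t.
Proof.
have h1 w r : bilin (fun v t' => lt (w * v) * star n r t') by lint.
have h2 r : bilin (fun u s' => tcase 0 (fun v t' => lt (u * v) * star n s' t') r) by lint.
by rewrite [LHS](tcaseM _ _ _ (h2 _)) (tcaseM _ _ _ (h1 _ _)).
Qed.

Lemma star0 s t : star 0 s t = s * t. Proof. by []. Qed.
Arguments star : simpl never.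

Lemma starl n t : linear (star n ^~ t). Proof. exact: (star_bilin n).1. Qed.
Lemma starr n s : linear (star n s). Proof. exact: (star_bilin n).2. Qed.

(* Induction on two words of the same length. *)
Lemma homog_ind2 n (M : lmodType k) (f h : T -> T -> M) :
  bilin f -> bilin h ->
  (forall u v s t, homog n s -> homog n t ->
     f (lt u * s) (lt v * t) = h (lt u * s) (lt v * t)) ->
  forall s t, homog n.+1 s -> homog n.+1 t -> f s t = h s t.
Proof.
move=> fb hb e s t hs; move: t; apply: tspan_eq; [exact: fb.2 | exact: hb.2 |].
move=> v t _ ht; move: s hs; apply: tspan_eq; [exact: fb.1 | exact: hb.1 |].
by move=> u s _ hs; apply: e.
Qed.

Lemma homog0 t : homog 0 t -> exists a, t = a *: 1.
Proof. exact: tspan_nil. Qed.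

Lemma homogC n u t : homog n t -> homog n.+1 (lt u * t).
Proof. exact: ts_cons. Qed.

Lemma homog_ones n : homog n (lt 1 ^+ n).
Proof. by elim: n => [|n IHn]; [apply: tspan1 | rewrite exprS; apply: homogC]. Qed.

Lemma homog_lt u : homog 1 (lt u).
Proof. by rewrite -[lt u]mulr1; apply/homogC/tspan1. Qed.

Lemma homog_star n s t : homog n s -> homog n t -> homog n (star n s t).
Proof.
move: s t; elim: n => [|n IHn] s t hs ht.
  have [a ->] := homog0 hs; have [b ->] := homog0 ht.
  by rewrite star0 -scalerAl mul1r; do 2!apply: tspanZ; apply: tspan1.
move: t ht; apply: tspan_map; first exact: starr.
move=> v t _ ht; move: s hs; apply: (tspan_map (f := fun s => star n.+1 s _)); first exact: starl.
by move=> u s _ hs; rewrite starC; apply: homogC; apply: IHn.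
Qed.

Lemma star_ones n t : homog n t ->
  star n (lt 1 ^+ n) t = t /\ star n t (lt 1 ^+ n) = t.
Proof.
move=> ht; split; move: t ht; elim: n => [|n IHn] t ht.
- by rewrite star0 mul1r.
- by move: t ht; apply: tspan_eq; [exact: starr | exact: lin_id | move=> u t _ ht; rewrite exprS starC IHn // mul1r].
- by rewrite star0 mulr1.
- by move: t ht; apply: tspan_eq; [exact: starl | exact: lin_id | move=> u t _ ht; rewrite exprS starC IHn // mulr1].
Qed.

Lemma star_cat n m s1 s2 t1 t2 : homog n s1 -> homog n t1 ->
  star (n + m) (s1 * s2) (t1 * t2) = star n s1 t1 * star m s2 t2.
Proof.
move: s1 t1; elim: n => [|n IHn] s1 t1.
  move=> /homog0 [a ->] /homog0 [b ->]; rewrite star0 -!scalerAl !mul1r.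
  by rewrite (linZ (starl _ _)) (linZ (starr _ _)) -!scalerAl mul1r.
move=> h1 h2; move: s1 t1 h1 h2; apply: homog_ind2; [by lint | by lint |].
by move=> u v s t hs ht; rewrite -!mulrA addSn !starC IHn // mulrA.
Qed.

Lemma cof_star n i s t : (i <= n.+1)%N -> homog n s -> homog n t ->
  cof i (star n s t) = star n.+1 (cof i s) (cof i t).
Proof.
move: s t; elim: n i => [|n IHn] [|[|i]] s t le; try by rewrite !cof0 starC mulr1.
- move=> /homog0 [a ->] /homog0 [b ->]; rewrite star0 -!scalerAl mul1r.
  rewrite !(linZ (@cof_is_linear _ _ 1)) cof11 (linZ (starl _ _)) (linZ (starr _ _)).
  by rewrite -[lt 1]mulr1 starC star0 !mulr1.
- by [].
- move=> h1 h2; move: s t h1 h2; apply: homog_ind2; [by lint | by lint |].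
  move=> u v s t hs ht; rewrite starC !cof1C csum_mul; last by lint.
  rewrite (csum_ap _ _ (starl _ _)); apply: eq_csum => a b.
  by rewrite (csum_ap _ _ (starr _ _)); apply: eq_csum => c d; rewrite !starC.
- move=> h1 h2; move: s t h1 h2; apply: homog_ind2; [by lint | by lint |].
  by move=> u v s t hs ht; rewrite starC !cofSC starC IHn.
Qed.

Lemma sig_star n i s t : (i <= n)%N -> homog n.+1 s -> homog n.+1 t ->
  sig i (star n.+1 s t) = star n (sig i s) (sig i t).
Proof.
move: s t; elim: n i => [|n IHn] [|i] s t le h1 h2 //; move: s t h1 h2;
  (apply: homog_ind2; [by lint | by lint | move=> u v s t hs ht]).
- by rewrite starC !sig0C (linZ (starl _ _)) (linZ (starr _ _)) scalerA epsM.
- by rewrite starC !sig0C (linZ (starl _ _)) (linZ (starr _ _)) scalerA epsM.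
- by rewrite starC !sigSC starC IHn.
Qed.

Lemma adT_cat y s t : adT y (s * t) = adT y s * t + s * adT y t.
Proof.
elim/palg_rect: s => [|u s IHs|a s s' es es'].
- by rewrite adT1 !mul1r mul0r add0r.
- by rewrite -mulrA !adTC IHs mulrDl mulrDr !mulrA addrA.
- have al := @adT_is_linear _ _ y.
  by rewrite mulrDl -scalerAl !al es es' !mulrDl -!scalerAl; modT.
Qed.

Lemma adT_lt1 y : adT y (lt 1) = 0.
Proof. by rewrite -[lt 1]mulr1 adTC uad1 linear0 mul0r adT1 mulr0 addr0. Qed.

Lemma homog_adT n y t : homog n t -> homog n (adT y t).
Proof.
move: t; elim: n => [|n IHn] t.
  by move=> /homog0 [a ->]; rewrite (linZ (@adT_is_linear _ _ y)) adT1 scaler0; apply: ts_zero.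
apply: tspan_map; first exact: adT_is_linear.
by move=> u {}t _ ht; rewrite adTC; apply: tspanD; apply: homogC => //; apply: IHn.
Qed.

Lemma adT_star n y s t : homog n s -> homog n t ->
  adT y (star n s t) = star n (adT y s) t + star n s (adT y t).
Proof.
move: s t; elim: n => [|n IHn] s t; first by rewrite !star0 adT_cat.
move=> h1 h2; move: s t h1 h2; apply: homog_ind2; [by lint | by lint |].
move=> u v s t hs ht; rewrite starC !adTC (linD (starl _ _)) (linD (starr _ _)) !starC IHn //.
by rewrite uadM (linD (@pgen_is_linear _ _ None) (uad y u * v)) !mulrDl !mulrDr; modT.
Qed.

Lemma lmulp_star n y s t : homog n s -> homog n t ->
  star n (lmulp n (ugen y) s) t = lmulp n (ugen y) (star n s t) /\
  star n s (lmulp n (ugen y) t) =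
    lmulp n (ugen y) (star n s t) - star n (adT y s) t.
Proof.
move=> hs ht; split; move: s t hs ht; elim: n => [|n IHn] s t.
- by rewrite !lmulp0 star0 mul0r.
- move=> h1 h2; move: s t h1 h2; apply: homog_ind2; [by lint | by lint |].
  by move=> u v s t hs ht; rewrite starC !lmulpC (linD (starl _ _)) !starC IHn // mulrA.
- move=> /homog0 [a ->] _.
  by rewrite !lmulp0 (linZ (@adT_is_linear _ _ y)) adT1 scaler0 !star0 mulr0 mul0r subr0.
- move=> h1 h2; move: s t h1 h2; apply: homog_ind2; [by lint | by lint |].
  move=> u v s t hs ht; rewrite starC !lmulpC adTC (linD (starl _ _)) (linD (starr _ _)) !starC IHn //.
  by rewrite /uad mulrBl (lin_sub (@pgen_is_linear _ _ None) (ugen y * u * v)) !mulrA !mulrDr !mulrDl !mulrN !mulNr; modT.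
Qed.

(** The iterated coproduct. *)
Fixpoint dl (n : nat) (u : U) : T :=
  if n is n'.+1 then csum (fun a b => lt a * dl n' b) u else (eps u : k) *: 1.

Lemma dl_is_linear n : linear (dl n).
Proof.
elim: n => [|n IHn]; first exact: (lin_scal (1 : T) (@eps_is_linear k g)).
have h : bilin (fun a b => lt a * dl n b) by lint.
exact: csum_linear h.
Qed.
HB.instance Definition _ n := GRing.isLinear.Build k U T _ (dl n) (dl_is_linear n).

Lemma dlS n u : dl n.+1 u = csum (fun a b => lt a * dl n b) u. Proof. by []. Qed.

Lemma dl1 n : dl n 1 = lt 1 ^+ n.
Proof.
elim: n => [|n IHn]; first by rewrite /= eps1 scale1r.
by rewrite dlS csum1 ?IHn ?exprS //; lint.
Qed.

Lemma dl_gen n y u : dl n (ugen y * u) = lmulp n (ugen y) (dl n u).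
Proof.
elim: n u => [|n IHn] u; first by rewrite lmulp0 /= eps_gen scale0r.
rewrite !dlS csumM ?(csum_ap _ _ (lmulp_is_linear _ _)); last by lint.
by apply: eq_csum => a b; rewrite lmulpC IHn.
Qed.

Lemma homog_dl n u : homog n (dl n u).
Proof.
elim: n u => [|n IHn] u; first by apply/tspanZ/tspan1.
by rewrite dlS unlock; apply: tspan_sum => p; apply: homogC; apply: IHn.
Qed.

(** An invariant tensor commutes with the iterated coproducts. *)
Lemma star_dl n q u : homog n q -> inv q ->
  star n q (dl n u) = star n (dl n u) q.
Proof.
move=> hq iq; elim/u_ind: u => [|y u IHu|a u v IHu IHv].
- by rewrite dl1 !(star_ones hq).1 (star_ones hq).2.
- rewrite dl_gen (lmulp_star _ hq (homog_dl _ _)).2 (lmulp_star _ (homog_dl _ _) hq).1.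
  by rewrite iq (lin0 (starl _ _)) subr0 IHu.
- by rewrite (dl_is_linear n) (starr n) (starl n) IHu IHv.
Qed.

Lemma dist_const r c e v t : pathF (nseq r 0%N ++ c :: e) (lt v * t) =
  csum (fun a b => dl r a * pathF (c :: e) (lt b * t)) v.
Proof.
elim: r v => [|r IHr] v.
  rewrite /= -[LHS](csum_epsl v (f := fun b => pathF (c :: e) (lt b * t))).
    by apply: eq_csum => a b; rewrite -scalerAl mul1r.
  by have := @pathF_is_linear _ g (c :: e); lint.
have -> : nseq r.+1 0%N ++ c :: e = 0%N :: (nseq r 0%N ++ c :: e) by [].
rewrite [LHS]/= advn0.
have [c' [e' ee]] : exists c' e', nseq r 0%N ++ c :: e = c' :: e' by case: (r) => [|r']; do 2 eexists.
rewrite {1}ee distE -ee.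
pose C a b d := lt a * (dl r b * pathF (c :: e) (lt d * t)) : T.
have Ct : trilin C.
  by have := @pathF_is_linear _ g (c :: e); rewrite /C => hl; split=> ? ? /=; lint.
transitivity (csum (fun a b => csum (C a) b) v).
  by apply: eq_csum => a b; rewrite IHr mul_csum.
rewrite -csumA //; apply: eq_csum => a b.
rewrite dlS (csum_ap _ _ (lin_mulr _ (@lin_id _ T))).
by apply: eq_csum => a' a''; rewrite -mulrA.
Qed.

Lemma dist_tail cs m t : closed (sumn cs) t ->
  dist (cs ++ nseq m 0%N) t = dist cs t * lt 1 ^+ m.
Proof.
elim: cs t => [|c cs IHcs] t st.
  have [a ->] := closed0 st.
  rewrite !(linZ (@dist_is_linear _ _ _)) dist_zeros ?sumn_nseq // size_nseq.
  by rewrite -scalerAl (@dist_zeros k g [::]) // expr0 mul1r.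
have [e0|s0] := posnP (sumn (c :: cs)).
  move: st; rewrite e0 => /closed0 [a ->].
  rewrite !(linZ (@dist_is_linear _ _ _)) !dist_zeros ?sumn_cat ?sumn_nseq ?e0 //.
  by rewrite size_cat size_nseq exprD scalerAl.
move: s0 st; rewrite /closed; case e : (sumn (c :: cs)) => [//|n] _.
move: t; apply: tspan_eq; [exact: dist_is_linear | |].
  exact: lin_mulr (@dist_is_linear _ _ _).
move=> u t _ st; rewrite !distC (csum_ap _ _ (lin_mulr _ (@lin_id _ T))).
apply: eq_csum => a b; rewrite IHcs ?mulrA //; apply: closed_advn.
by move: e => /= ->; apply: ts_cons.
Qed.

Lemma pathF_tail c cs m n t : sumn (c :: cs) = n -> closed n t ->
  pathF (c :: cs ++ nseq m 0%N) t = pathF (c :: cs) t * lt 1 ^+ m.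
Proof. by move=> /= e st; rewrite dist_tail //; apply: closed_advn; rewrite e. Qed.

Lemma homog_dist cs t : homog (sumn cs).+1 t -> homog (size cs) (dist cs t).
Proof.
elim: cs t => [|c cs IHcs] t /=.
  apply: tspan_map; first exact: dist_is_linear.
  move=> u {}t _ ht; have -> : dist [::] (lt u * t) = (eps u : k) *: t by apply: sig0C.
  exact: tspanZ.
apply: tspan_map; first exact: dist_is_linear.
move=> u {}t _ ht; rewrite distC unlock; apply: tspan_sum => p; apply: homogC.
apply: IHcs; have := @advn_span _ _ c _ _ (homogC p.2 ht).
rewrite size_nseq -addnS nseqD.
by rewrite drop_size_cat ?size_nseq //; apply; rewrite leq_addr.
Qed.

Lemma homog_pathF c cs t : homog (sumn (c :: cs)).+1 t -> homog (size cs) (pathF (c :: cs) t).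
Proof.
move=> ht; apply: homog_dist; have := @advn_span _ _ c _ _ ht.
rewrite size_nseq -[sumn _]/(c + sumn cs)%N -addnS nseqD drop_size_cat ?size_nseq //.
by apply; rewrite leq_addr.
Qed.

Lemma adT_advn c y t : adT y (advn c t) = advn c (adT y t).
Proof.
elim: c t => // c IHc t; elim/palg_rect: t => [|u t _|a s t es et].
- by rewrite adT1 !advn1 (lin0 (@adT_is_linear _ _ y)) (lin0 (@advn_is_linear _ _ c.+1)).
- rewrite adTC (linD (@advn_is_linear _ _ _)) !advnC eps_uad scale0r add0r.
  by rewrite (linZ (@adT_is_linear _ _ y)) IHc.
- by rewrite (adT_is_linear y) !(@advn_is_linear _ _ c.+1) (adT_is_linear y) es et.
Qed.

Lemma adT_dist cs y t : adT y (dist cs t) = dist cs (adT y t).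
Proof.
elim: cs t => [|c cs IHcs] t; first exact: (adT_advn 1).
elim/palg_rect: t => [|u t _|a s t es et].
- by rewrite adT1 dist1 (lin0 (@adT_is_linear _ _ y)) (lin0 (@dist_is_linear _ _ _)).
- rewrite adTC (linD (@dist_is_linear _ _ _)) !distC csum_uad; last exact: dist_bilin.
  rewrite -csumD (csum_ap _ _ (@adT_is_linear _ _ y)); apply: eq_csum => a b.
  rewrite adTC IHcs adT_advn adTC (linD (@advn_is_linear _ _ _)) (linD (@dist_is_linear _ _ _)) mulrDr; modT.
- by rewrite (adT_is_linear y) !(@dist_is_linear _ _ (c :: cs)) (adT_is_linear y) es et.
Qed.

Lemma adT_pathF cs y t : adT y (pathF cs t) = pathF cs (adT y t).
Proof.
case: cs => [|c cs] /=; first exact: lin0 (@adT_is_linear _ _ y).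
by rewrite adT_dist adT_advn.
Qed.

End Product.
Arguments star : simpl never.
#[global] Hint Resolve star_bilin : bilin.

(** * Lattice paths *)

Section LatticePaths.
Implicit Types (psi : lpath) (w L : seq bool) (d b : bool).

Definition counts d psi : seq nat := [seq count_mem d w | w <- psi].

Lemma size_counts d psi : size (counts d psi) = size psi.
Proof. exact: size_map. Qed.

Lemma sumn_counts d psi : sumn (counts d psi) = count_mem d (flatten psi).
Proof. by rewrite count_flatten. Qed.

Lemma counts_coface d i psi : counts d (coface i psi) = insz i (counts d psi).
Proof. by rewrite /counts /coface map_cat /= map_take map_drop. Qed.

Lemma flatten_coface i psi : flatten (coface i psi) = flatten psi.
Proof. by rewrite /coface flatten_cat /= -flatten_cat cat_take_drop. Qed.

Lemma size_coface i psi : size (coface i psi) = (size psi).+1.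
Proof. by rewrite /coface size_cat /= addnS -size_cat cat_take_drop. Qed.

Lemma codegenS i w psi : codegen i.+1 (w :: psi) = w :: codegen i psi.
Proof. by []. Qed.

Lemma codegen0 w w' psi : codegen 0 (w :: w' :: psi) = (w ++ w') :: psi.
Proof. by rewrite /codegen /= drop0. Qed.

Lemma counts_codegen d i psi : (i.+1 < size psi)%N ->
  counts d (codegen i psi) = merge i (counts d psi).
Proof.
elim: i psi => [|i IHi] [|w [|w' psi]] //; first by rewrite codegen0 /= count_cat.
by move=> lt_i; rewrite codegenS /= IHi.
Qed.

Lemma flatten_codegen i psi : (i.+1 < size psi)%N ->
  flatten (codegen i psi) = flatten psi.
Proof.
elim: i psi => [|i IHi] [|w [|w' psi]] //; first by rewrite codegen0 /= catA.
by move=> lt_i; rewrite codegenS /= IHi.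
Qed.

Lemma size_codegen i psi : (i.+1 < size psi)%N ->
  size (codegen i psi) = (size psi).-1.
Proof.
elim: i psi => [|i IHi] [|w [|w' psi]] //; first by rewrite codegen0.
by move=> lt_i; rewrite codegenS /= IHi.
Qed.

Lemma count_del d i L : (i < count_mem d L)%N ->
  count_mem d (del_step d i L) = (count_mem d L).-1 /\
  count_mem (~~ d) (del_step d i L) = count_mem (~~ d) L.
Proof.
elim: L i => //= x L IHL i; case: eqP => [->|nx].
  have nd : (d == ~~ d) = false by case: d {IHL}.
  rewrite nd add1n; case: i => [|i]; rewrite //= ?eqxx ?nd ltnS => lt_i.
  have [-> ->] := IHL _ lt_i; split=> //.
  by rewrite add1n prednK // (leq_ltn_trans _ lt_i).
rewrite add0n => lt_i; have [/= -> ->] := IHL _ lt_i; split=> //.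
by move/eqP/negPf: nx => ->.
Qed.

Lemma counts_face d i psi : (i < sumn (counts d psi))%N ->
  counts d (face d i psi) = dec i (counts d psi) /\
  counts (~~ d) (face d i psi) = counts (~~ d) psi.
Proof.
elim: psi i => //= w psi IHpsi i lt_i; case: ltnP => iw /=.
  by have [-> ->] := count_del iw.
by have [|-> ->] := IHpsi (i - count_mem d w)%N; rewrite ?ltn_subLR.
Qed.

Lemma size_face d i psi : size (face d i psi) = size psi.
Proof. by elim: psi i => //= w psi IHpsi i; case: ifP => //= _; rewrite IHpsi. Qed.

Lemma del_step_catl d i L L' : (i < count_mem d L)%N ->
  del_step d i (L ++ L') = del_step d i L ++ L'.
Proof.
elim: L i => //= x L IHL i; case: eqP => [->|nx].
  by rewrite add1n; case: i => //= i; rewrite ltnS => /IHL ->.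
by rewrite add0n => /IHL ->.
Qed.

Lemma del_step_catr d i L L' : (count_mem d L <= i)%N ->
  del_step d i (L ++ L') = L ++ del_step d (i - count_mem d L) L'.
Proof.
elim: L i => [|x L IHL] i /=; first by rewrite subn0.
case: eqP => [->|nx]; last by rewrite add0n => /IHL ->.
by rewrite add1n; case: i => //= i; rewrite ltnS => /IHL ->.
Qed.

Lemma flatten_face d i psi : flatten (face d i psi) = del_step d i (flatten psi).
Proof.
elim: psi i => //= w psi IHpsi i; case: ltnP => iw /=.
  by rewrite del_step_catl.
by rewrite IHpsi del_step_catr.
Qed.

(* The number of changes of direction of [L] read after [b]. *)
Definition changes b L : nat := count id (pairmap addb b L).

Lemma dir_changesE L : dir_changes L = changes (head true L) L.
Proof. by []. Qed.

Lemma changes_cons b x L : changes b (x :: L) = ((b (+) x) + changes x L)%N.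
Proof. by []. Qed.

Lemma changes_triangle b x L : (changes b L <= (b (+) x) + changes x L)%N.
Proof. by case: L => [//|y L]; rewrite !changes_cons addnA leq_add2r; case: b x y => [] [] []. Qed.

Lemma changes_del d i b L : (changes b (del_step d i L) <= changes b L)%N.
Proof.
elim: L i b => //= x L IHL i b; case: eqP => [->|_].
  by case: i => [|i]; rewrite changes_cons; [apply: changes_triangle | rewrite changes_cons leq_add2l].
by rewrite !changes_cons leq_add2l.
Qed.

Lemma dir_changes_le b L : (dir_changes L <= changes b L)%N.
Proof.
by rewrite dir_changesE; case: L => // x L; rewrite /= !changes_cons addbb leq_addl.
Qed.

Lemma dir_changes_del d i L : (dir_changes (del_step d i L) <= dir_changes L)%N.
Proof. by apply: leq_trans (dir_changes_le (head true L) _) _; apply: changes_del. Qed.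

(* [phase1 d L] holds when the steps of direction [d] in [L] are consecutive. *)
Fixpoint phase2 d L : bool :=
  if L is x :: L' then if x == d then phase2 d L' else d \notin L' else true.

Fixpoint phase1 d L : bool :=
  if L is x :: L' then if x == d then phase2 d L' else phase1 d L' else true.

Lemma neq_negb d x : x != d -> x = ~~ d.
Proof. by case: d x => [] []. Qed.

Lemma phase3_changes d L : changes (~~ d) L = 0%N -> d \notin L.
Proof.
elim: L => // x L IHL; rewrite changes_cons inE negb_or => /eqP.
rewrite addn_eq0 => /andP [e1 /eqP e2]; have ex : x = ~~ d by case: x d e1 {IHL e2} => [] [].
by rewrite ex in e2 *; rewrite IHL // andbT; case: d {IHL e1 e2 ex}.
Qed.

Lemma phase2_changes d L : (changes d L <= 1)%N -> phase2 d L.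
Proof.
elim: L => // x L IHL; rewrite changes_cons /=; case: eqP => [->|/eqP/neq_negb ->].
  by rewrite addbb.
have -> : d (+) ~~ d = true by case: d {IHL}.
by rewrite add1n ltnS leqn0 => /eqP; apply: phase3_changes.
Qed.

Lemma phase1_changes d L : (changes (~~ d) L <= 2)%N -> phase1 d L.
Proof.
elim: L => // x L IHL; rewrite changes_cons /=; case: eqP => [->|/eqP/neq_negb ->].
  have -> : ~~ d (+) d = true by case: d {IHL}.
  by rewrite add1n ltnS; apply: phase2_changes.
by rewrite addbb.
Qed.

Lemma head_del d i L : (1 < count_mem d L)%N || (~~ d \in L) ->
  (i < count_mem d L)%N -> (dir_changes L <= 3)%N ->
  head true (del_step d i L) = head true L \/
  phase1 d (del_step d i L) /\ head true (del_step d i L) = ~~ head true L.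
Proof.
case: L => // x L; case: i => [|i] /=; last by case: eqP => [->|_] /=; left.
case: eqP => [->|_] /=; last by left.
case: L => [|y L] /=; first by rewrite inE; case: (d).
move=> _ _; rewrite dir_changesE /= !changes_cons addbb add0n.
have [->|/neq_negb ->] := eqVneq y d; first by left.
move=> le; right; have e1 : d (+) ~~ d = true by case: d {le}.
move: le; rewrite e1 add1n ltnS => le; split=> //.
exact: phase1_changes.
Qed.

Lemma phase2_split d w L : phase2 d (w ++ L) -> d \in L ->
  count_mem (~~ d) w = 0%N /\ phase2 d L.
Proof.
elim: w => //= x w IHw; case: eqP => [->|/eqP/neq_negb ->].
  by move=> p dL; have [-> ->] := IHw p dL; split=> //; case: d {IHw p dL}.
by rewrite mem_cat negb_or => /andP [_ /negPf ->].
Qed.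

Lemma phase1_skip d w L : d \notin w -> phase1 d (w ++ L) = phase1 d L.
Proof.
elim: w => //= x w IHw; rewrite inE negb_or eq_sym => /andP [/negPf -> ].
exact: IHw.
Qed.

Lemma first_split d w : d \in w -> exists w1 w2, w = w1 ++ d :: w2 /\ d \notin w1.
Proof.
elim: w => // x w IHw; rewrite inE; case: eqVneq => [<- _|nx /IHw [w1 [w2 [-> nw]]]].
  by exists [::], w.
by exists (x :: w1), w2; rewrite inE negb_or nx.
Qed.

Lemma counts_notin d psi : d \notin flatten psi -> counts d psi = nseq (size psi) 0%N.
Proof.
elim: psi => //= w psi IHpsi; rewrite mem_cat negb_or => /andP [dw /IHpsi ->].
by congr cons; apply/count_memPn.
Qed.

Lemma phase2_counts d w psi : phase2 d (flatten (w :: psi)) ->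
  exists r l c cs c' e,
    [/\ counts d (w :: psi) = c :: cs ++ nseq l 0%N, size cs = r,
        counts (~~ d) (w :: psi) = nseq r 0%N ++ c' :: e & size e = l].
Proof.
elim: psi w => [|w' psi IHpsi] w p.
  by exists 0%N, 0%N, (count_mem d w), [::], (count_mem (~~ d) w), [::].
have [din|dnin] := boolP (d \in flatten (w' :: psi)); last first.
  exists 0%N, (size psi).+1, (count_mem d w), [::], (count_mem (~~ d) w), (counts (~~ d) (w' :: psi)).
  split=> //; last by rewrite size_counts.
  by rewrite [LHS]/= -[_ :: counts d psi]/(counts d (w' :: psi)) counts_notin.
have [e0 p'] := phase2_split (w := w) (L := flatten (w' :: psi)) p din.
have [r [l [c [cs [c' [e [e1 e2 e3 e4]]]]]]] := IHpsi w' p'.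
exists r.+1, l, (count_mem d w), (c :: cs), c', e; split=> //.
- by rewrite [LHS]/= -[_ :: counts d psi]/(counts d (w' :: psi)) e1.
- by rewrite /= e2.
- by rewrite [LHS]/= -[_ :: counts (~~ d) psi]/(counts (~~ d) (w' :: psi)) e3 e0.
Qed.

End LatticePaths.

Section Commutation.
Variables (k : fieldType) (g : lieAlgebra k).
Local Notation U := (ualg g).
Local Notation T := (talg (ualg g)).
Local Notation lt := (@pgen k (ualg g) None).
Implicit Types (y : g) (u v : U) (s t : T).

Ltac modT := module_in k (T : lmodType k).

Definition wrap t : T := lt 1 * (t * lt 1).

Lemma wrap_is_linear : linear wrap.
Proof. by rewrite /wrap; lint. Qed.
HB.instance Definition _ := GRing.isLinear.Build k T T _ wrap wrap_is_linear.

Lemma closed_wrap n t : homog n t -> closed n.+1 (wrap t).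
Proof.
move=> ht; rewrite /closed [nseq _ _]/=.
have s1 : tspan [:: eq (1 : U)] (lt 1 : T).
  by rewrite -[lt 1]mulr1; apply: ts_cons (erefl _) (tspan1 _).
exact: ts_cons I (tspan_cat ht s1).
Qed.

Lemma closed_homog n t : closed n t -> homog n.+1 t.
Proof. by move/tspan_homog; rewrite size_cat size_nseq addn1. Qed.

Lemma adT_wrap y t : adT y (wrap t) = wrap (adT y t).
Proof.
by rewrite /wrap !adT_cat adT_lt1 mul0r add0r mulr0 addr0.
Qed.

Section Comm.
Variables (n : nat) (x : T).
Hypotheses (hx : homog n x) (ix : inv x).

Lemma inv_wrap cs : inv (pathF cs (wrap x)).
Proof. by move=> y; rewrite adT_pathF adT_wrap ix !linear0. Qed.

Definition comm_at (p : nat) (s t : T) : Prop := star p s t = star p t s.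

Lemma comm_phase2 r l c cs c' e s : size cs = r -> size e = l ->
  sumn (c :: cs) = n.+1 -> homog (sumn (c' :: e)).+1 s ->
  comm_at (r + l) (pathF (c :: cs ++ nseq l 0%N) (wrap x)) (pathF (nseq r 0%N ++ c' :: e) s).
Proof.
move=> sr sl sc hs; rewrite /comm_at (pathF_tail _ sc (closed_wrap hx)).
set Q := pathF _ _; have hQ : homog r Q.
  by rewrite -sr; apply: homog_pathF; rewrite sc; apply: closed_homog (closed_wrap hx).
have iQ : inv Q by apply: inv_wrap.
move: s hs; apply: tspan_eq.
- exact: lin_comp (starr _ _) (@pathF_is_linear _ _ _).
- exact: lin_comp (starl _ _) (@pathF_is_linear _ _ _).
move=> v s _ hs; rewrite dist_const (csum_ap _ _ (starr _ _)) (csum_ap _ _ (starl _ _)).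
apply: eq_csum => a b.
have hb : homog l (pathF (c' :: e) (lt b * s)).
  by rewrite -sl; apply: homog_pathF; apply: homogC.
rewrite !star_cat //; try exact: homog_dl.
by rewrite star_dl // (star_ones hb).1 (star_ones hb).2.
Qed.

Lemma comm_phase1 d psi s : phase1 d (flatten psi) -> d \in flatten psi ->
  sumn (counts d psi) = n.+1 -> homog (sumn (counts (~~ d) psi)).+1 s ->
  comm_at (size psi).-1 (pathF (counts d psi) (wrap x)) (pathF (counts (~~ d) psi) s).
Proof.
elim: psi s => // w psi IHpsi s p1 din sc hs.
have [dw|dw] := boolP (d \in w); last first.
  have cw : count_mem d w = 0%N by apply/count_memPn.
  have dpsi : d \in flatten psi by move: din; rewrite /= mem_cat (negPf dw).
  have p1' : phase1 d (flatten psi) by move: p1; rewrite /= phase1_skip.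
  case: psi IHpsi dpsi p1' hs sc {p1 din} => // w' psi IHpsi dpsi p1' hs sc.
  rewrite [counts d _]/= cw -[_ :: counts d psi]/(counts d (w' :: psi)).
  rewrite [counts (~~ d) _]/= -[_ :: counts (~~ d) psi]/(counts (~~ d) (w' :: psi)).
  set cs := counts d (w' :: psi) in IHpsi *.
  set ds := counts (~~ d) (w' :: psi) in IHpsi *.
  have ecs : pathF (0%N :: cs) (wrap x) = lt 1 * pathF cs (wrap x).
    rewrite /= advn0 /wrap distE csum1 //; exact: pathF_bilin.
  have hs' : homog (sumn ds).+1 (advn (count_mem (~~ d) w) s).
    have := @advn_span _ _ (count_mem (~~ d) w) _ _ hs.
    rewrite size_nseq -[sumn _]/(count_mem (~~ d) w + sumn ds)%N -addnS nseqD.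
    by rewrite drop_size_cat ?size_nseq //; apply; rewrite leq_addr.
  have sc' : sumn cs = n.+1 by move: sc; rewrite /= cw.
  rewrite /comm_at ecs [pathF (_ :: ds) s]/=; move: {s hs}(advn _ s) hs'; apply: tspan_eq.
  - exact: lin_comp (starr _ _) (@dist_is_linear _ _ _).
  - exact: lin_comp (starl _ _) (@dist_is_linear _ _ _).
  move=> v s _ hs; rewrite distE (csum_ap _ _ (starr _ _)) (csum_ap _ _ (starl _ _)).
  apply: eq_csum => a b; rewrite [size _]/= -[size psi]/(size (w' :: psi)).-1.
  rewrite /= !starC mul1r mulr1; congr (_ * _).
  exact: (IHpsi _ p1' dpsi sc' (homogC b hs)).
have [w1 [w2 [ew dw1]]] := first_split dw; move: p1 hs sc; rewrite {}ew {w dw din IHpsi}.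
rewrite /= -catA phase1_skip // [phase1 _ _]/= eqxx => p2.
have cd : count_mem d (w1 ++ d :: w2) = count_mem d (d :: w2).
  by rewrite count_cat (count_memPn dw1).
set c1 := count_mem (~~ d) w1.
have -> : count_mem (~~ d) (w1 ++ d :: w2) = (c1 + count_mem (~~ d) (d :: w2))%N by rewrite count_cat.
rewrite !cd => hs sc; rewrite -[dist _ _]/(pathF (counts d ((d :: w2) :: psi)) (wrap x)) advnD.
set c2 := count_mem _ _ in hs *.
rewrite -[dist _ (advn c2 _)]/(pathF (c2 :: counts (~~ d) psi) (advn c1 s)).
have hs' : homog (sumn (c2 :: counts (~~ d) psi)).+1 (advn c1 s).
  have := @advn_span _ _ c1 _ _ hs.
  rewrite size_nseq -addnA -addnS nseqD drop_size_cat ?size_nseq //; apply; exact: leq_addr.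
move: hs'; rewrite -[c2 :: _]/(counts (~~ d) ((d :: w2) :: psi)) => hs'.
have p2' : phase2 d (flatten ((d :: w2) :: psi)) by rewrite /= eqxx.
have [r [l [c [cs [c' [e [e1 e2 e3 e4]]]]]]] := phase2_counts p2'.
have -> : size psi = (r + l)%N.
  have := congr1 size e1; rewrite size_counts [size (_ :: psi)]/= [size (c :: _)]/=.
  by rewrite size_cat size_nseq e2 => -[].
have sc' : sumn (c :: cs) = n.+1.
  by rewrite -sc -[RHS]/(sumn (counts d ((d :: w2) :: psi))) e1 -cat_cons sumn_cat sumn_nseq mul0n addn0.
have hs2 : homog (sumn (c' :: e)).+1 (advn c1 s).
  by move: hs'; rewrite e3 sumn_cat sumn_nseq mul0n.
rewrite e1 e3; exact: comm_phase2.
Qed.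
End Comm.
End Commutation.

(** * Sums over lattice paths *)

Section LatticeSums.
Local Notation nondegenerate := Defs.nondegenerate.
Implicit Types (psi q : lpath) (d : bool).

Lemma in_L3E n1 n2 m psi : in_L3 n1 n2 m psi =
  [&& size psi == m.+1, sumn (counts true psi) == n1.+1,
      sumn (counts false psi) == n2.+1 & (dir_changes (flatten psi) <= 3)%N].
Proof. by rewrite !sumn_counts. Qed.

Lemma in_L3_coface i n1 n2 m psi : in_L3 n1 n2 m psi -> in_L3 n1 n2 m.+1 (coface i psi).
Proof. by rewrite /in_L3 size_coface flatten_coface eqSS. Qed.

Lemma in_L3_codegen i n1 n2 m psi : (i < m.+1)%N ->
  in_L3 n1 n2 m.+1 psi -> in_L3 n1 n2 m (codegen i psi).
Proof.
move=> lt_i /and4P [/eqP e1 e2 e3 e4].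
have lt : (i.+1 < size psi)%N by rewrite e1.
by rewrite /in_L3 size_codegen // flatten_codegen // e1 eqxx e2 e3 e4.
Qed.

Lemma in_L3_face_true i n1 n2 m psi : (i < n1.+2)%N ->
  in_L3 n1.+1 n2 m psi -> in_L3 n1 n2 m (face true i psi).
Proof.
move=> lt_i /and4P [e1 /eqP e2 e3 e4].
have [|c1 c2] := @count_del true i (flatten psi); first by rewrite e2.
rewrite /in_L3 size_face e1 flatten_face c1 e2 eqxx [count_mem false _]c2 e3 /=.
exact: leq_trans (dir_changes_del _ _ _) e4.
Qed.

Lemma in_L3_face_false i n1 n2 m psi : (i < n2.+2)%N ->
  in_L3 n1 n2.+1 m psi -> in_L3 n1 n2 m (face false i psi).
Proof.
move=> lt_i /and4P [e1 e2 /eqP e3 e4].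
have [|c1 c2] := @count_del false i (flatten psi); first by rewrite e3.
rewrite /in_L3 size_face e1 flatten_face [count_mem true _]c2 e2 c1 e3 eqxx /=.
exact: leq_trans (dir_changes_del _ _ _) e4.
Qed.

Lemma path_of_inj n1 n2 m : injective (@path_of n1 n2 m).
Proof.
move=> p q e; apply: val_inj; apply: val_inj.
exact: (inj_map val_inj e).
Qed.

Lemma path_ofP n1 n2 m (psi : L3 n1 n2 m) :
  in_L3 n1 n2 m (path_of psi) /\ nondegenerate (path_of psi).
Proof. by apply/andP; case: psi. Qed.

Lemma path_of_onto n1 n2 m q : in_L3 n1 n2 m q -> nondegenerate q ->
  exists psi : L3 n1 n2 m, path_of psi = q.
Proof.
move=> inq nd; case/and4P: (inq) => sz c1 c2 _.
have szw w : w \in q -> (size w <= (n1 + n2).+2)%N.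
  move=> wq; apply: (@leq_trans (size (flatten q))).
    case/splitPr: wq => q1 q2; rewrite flatten_cat size_cat /= size_cat.
    by rewrite addnCA leq_addr.
  rewrite -(count_predC (pred1 true) (flatten q)) (eqP c1).
  rewrite (@eq_count _ (predC _) (pred1 false)); last by case.
  by rewrite (eqP c2) addSn addnS.
have szt : size [seq insub_bseq (n1 + n2).+2 w | w <- q] == m.+1 by rewrite size_map.
have e : [seq bseqval w | w <- Tuple szt] = q.
  rewrite /= -map_comp -[RHS]map_id; apply/eq_in_map => w wq /=.
  by rewrite /insub_bseq insubdK //; apply: szw.
have Pt : L3_pred (Tuple szt) by rewrite /L3_pred e inq nd.
by exists (exist _ (Tuple szt) Pt).
Qed.

(** A sum against a function that vanishes on degenerate paths may be pushed
    forward along an operation on all paths. *)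
Lemma pushfwd_sum (k : fieldType) (M : lmodType k) n1 n2 m n1' n2' m' (F : lpath -> lpath)
    (c : pchain k) (h : lpath -> M) :
  (forall psi, in_L3 n1' n2' m' psi -> in_L3 n1 n2 m (F psi)) ->
  (forall psi, in_L3 n1 n2 m psi -> ~~ nondegenerate psi -> h psi = 0) ->
  \sum_(psi : L3 n1 n2 m) pushfwd n1' n2' m' F c (path_of psi) *: h (path_of psi) =
  \sum_(psi : L3 n1' n2' m') c (path_of psi) *: h (F (path_of psi)).
Proof.
move=> FL hdeg; under eq_bigr => psi _ do rewrite /pushfwd scaler_suml.
rewrite (exchange_big_dep predT) //=; apply: eq_bigr => psi _.
have [inp _] := path_ofP psi; have inF := FL _ inp.
have [nd|nd] := boolP (nondegenerate (F (path_of psi))); last first.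
  rewrite (hdeg _ inF nd) scaler0 big1 // => psi' /eqP e.
  by case/negP: nd; rewrite e; case: (path_ofP psi').
have [psi' e] := path_of_onto inF nd.
rewrite (big_pred1 psi') => [|psi'']; first by rewrite e.
by rewrite -e (inj_eq (@path_of_inj _ _ _)) eq_sym.
Qed.

End LatticeSums.

(** * The operation of a lattice path on tensors *)

Section PathOperation.
Variables (k : fieldType) (g : lieAlgebra k).
Local Notation U := (ualg g).
Local Notation T := (talg (ualg g)).
Local Notation lt := (@pgen k (ualg g) None).
Implicit Types (u v : U) (s t x y : T) (psi : lpath) (d : bool).

Ltac modT := module_in k (T : lmodType k).

Lemma cof_lt1 n i t : (i <= n)%N -> homog n t -> cof i.+1 (t * lt 1) = cof i.+1 t * lt 1.
Proof.
elim: n i t => [|n IHn] [|i] t le ht //.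
- have [a ->] := homog0 ht; rewrite -scalerAl mul1r !(linZ (@cof_is_linear _ _ _)) cof11.
  by rewrite -scalerAl -[in LHS](mulr1 (lt 1)) cof1C csum1 ?mulr1 //; lint.
- move: t ht; apply: tspan_eq; [by lint | by lint |] => u t _ ht.
  rewrite -mulrA !cof1C (csum_ap _ _ (lin_mulr (lt 1) (@lin_id _ T))).
  by apply: eq_csum => a b; rewrite !mulrA.
- move: t ht; apply: tspan_eq; [by lint | by lint |] => u t _ ht.
  by rewrite -mulrA !cofSC IHn // mulrA.
Qed.

Lemma cof_wrap n i t : (i <= n.+1)%N -> homog n t -> cof i.+1 (wrap t) = wrap (cof i t).
Proof.
case: i => [|i] le ht; rewrite /wrap; first by rewrite cof1C csum1 ?cof0 ?mulrA //; lint.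
by rewrite cofSC (cof_lt1 (n := n)).
Qed.

(** The tensor by which [joyal d psi] acts on [x]. *)
Definition Fp d psi x : T := pathF (counts d psi) (wrap x).

Lemma Fp_is_linear d psi : linear (Fp d psi).
Proof. exact: lin_comp (@pathF_is_linear _ _ _) (@wrap_is_linear _ _). Qed.

Lemma homog_Fp d psi n x : sumn (counts d psi) = n.+1 -> homog n x ->
  homog (size psi).-1 (Fp d psi x).
Proof.
case: psi => // w psi e hx; rewrite [_.-1]/= -(size_counts d psi); apply: homog_pathF.
by rewrite -/(counts d (w :: psi)) e; apply: closed_homog (closed_wrap hx).
Qed.

Lemma Fp_coface d psi n i x : (i <= size psi)%N -> sumn (counts d psi) = n.+1 ->
  homog n x -> Fp d (coface i psi) x = cof i (Fp d psi x).
Proof.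
move=> le e hx; rewrite /Fp counts_coface; apply: pathF_insz; rewrite ?size_counts //; first exact: e.
apply: tspan_cat hx _; rewrite -[lt 1]mulr1; exact: ts_cons (erefl _) (tspan1 _).
Qed.

Lemma Fp_codegen d psi i x : (i.+1 < size psi)%N ->
  Fp d (codegen i psi) x = sig i (Fp d psi x).
Proof. by move=> le; rewrite /Fp counts_codegen // sig_pathF // size_counts. Qed.

Lemma Fp_face d psi n i x : (i < n.+2)%N -> sumn (counts d psi) = n.+2 ->
  homog n x -> Fp d (face d i psi) x = Fp d psi (cof i x).
Proof.
move=> le e hx; rewrite /Fp (@counts_face d i psi _).1 ?e // -(cof_wrap (n := n)) //.
rewrite (pathF_dec (Ps := nseq n.+2 (fun=> True))) ?e ?size_nseq //.
exact: closed_homog (closed_wrap hx).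
Qed.

Lemma Fp_face_neg d psi i x : (i < sumn (counts d psi))%N ->
  Fp (~~ d) (face d i psi) x = Fp (~~ d) psi x.
Proof. by move=> le; rewrite /Fp (counts_face le).2. Qed.

Definition PA psi x y : T :=
  if head true (flatten psi) then star (size psi).-1 (Fp true psi x) (Fp false psi y)
  else star (size psi).-1 (Fp false psi y) (Fp true psi x).

Lemma PA_bilin psi : bilin (PA psi).
Proof.
by split=> ? a s t; rewrite /PA; case: ifP => _; rewrite Fp_is_linear; first [exact: starl|exact: starr].
Qed.

Section Shape.
Variables (n1 n2 m : nat) (psi : lpath) (x y : T).
Hypotheses (hx : homog n1 x) (hy : homog n2 y).

Lemma homog_PA : in_L3 n1 n2 m psi -> homog m (PA psi x y).
Proof.
rewrite in_L3E => /and4P [/eqP sz /eqP c1 /eqP c2 _].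
have h1 := homog_Fp c1 hx; have h2 := homog_Fp c2 hy; rewrite /PA sz in h1 h2 *.
by case: ifP => _; apply: homog_star.
Qed.

Lemma PA_coface i : in_L3 n1 n2 m psi -> (i <= m.+1)%N ->
  PA (coface i psi) x y = cof i (PA psi x y).
Proof.
rewrite in_L3E => /and4P [/eqP sz /eqP c1 /eqP c2 _] le.
have h1 := homog_Fp c1 hx; have h2 := homog_Fp c2 hy; rewrite sz in h1 h2.
rewrite /PA size_coface flatten_coface sz /= (Fp_coface _ c1) ?(Fp_coface _ c2) ?sz //.
by case: ifP => _; rewrite cof_star.
Qed.

Lemma PA_codegen i : in_L3 n1 n2 m.+1 psi -> (i < m.+1)%N ->
  PA (codegen i psi) x y = sig i (PA psi x y).
Proof.
rewrite in_L3E => /and4P [/eqP sz /eqP c1 /eqP c2 _] le.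
have h1 := homog_Fp c1 hx; have h2 := homog_Fp c2 hy; rewrite sz in h1 h2.
have lt : (i.+1 < size psi)%N by rewrite sz.
rewrite /PA size_codegen // flatten_codegen // sz /= !Fp_codegen //.
by case: ifP => _; rewrite sig_star.
Qed.

Lemma PA_face_true i : inv x -> in_L3 n1.+1 n2 m psi -> (i < n1.+2)%N ->
  PA (face true i psi) x y = PA psi (cof i x) y.
Proof.
move=> ix inp le; have := in_L3_face_true le inp; move: inp; rewrite !in_L3E.
move=> /and4P [/eqP sz /eqP c1 /eqP c2 c3] /and4P [_ /eqP c1' /eqP c2' _].
rewrite /PA size_face sz -(Fp_face _ c1) // -(@Fp_face_neg true psi i) ?c1 //.
have := @head_del true i (flatten psi); rewrite -flatten_face -sumn_counts c1 => /(_ isT le c3).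
case=> [->//|[p1 ->]].
have din : true \in flatten (face true i psi).
  by rewrite -has_pred1 has_count -sumn_counts c1'.
have := comm_phase1 hx ix p1 din c1'; rewrite c2' size_face sz => /(_ (wrap y)).
move/(_ (closed_homog (closed_wrap hy))); rewrite /comm_at /= => e.
by case: (head true (flatten psi)).
Qed.

Lemma PA_face_false i : inv y -> in_L3 n1 n2.+1 m psi -> (i < n2.+2)%N ->
  PA (face false i psi) x y = PA psi x (cof i y).
Proof.
move=> iy inp le; have := in_L3_face_false le inp; move: inp; rewrite !in_L3E.
move=> /and4P [/eqP sz /eqP c1 /eqP c2 c3] /and4P [_ /eqP c1' /eqP c2' _].
rewrite /PA size_face sz -(Fp_face _ c2) // -(@Fp_face_neg false psi i) ?c2 //.
have := @head_del false i (flatten psi); rewrite -flatten_face -sumn_counts c2 => /(_ isT le c3).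
case=> [->//|[p1 ->]].
have din : false \in flatten (face false i psi).
  by rewrite -has_pred1 has_count -sumn_counts c2'.
have := comm_phase1 hy iy p1 din c2'; rewrite c1' size_face sz => /(_ (wrap x)).
move/(_ (closed_homog (closed_wrap hx))); rewrite /comm_at /= => e.
by case: (head true (flatten psi)).
Qed.

Lemma PA_inv : in_L3 n1 n2 m psi -> inv x -> inv y -> inv (PA psi x y).
Proof.
rewrite in_L3E => /and4P [/eqP sz /eqP c1 /eqP c2 _] ix iy z.
have h1 := homog_Fp c1 hx; have h2 := homog_Fp c2 hy; rewrite sz in h1 h2.
have e1 : adT z (Fp true psi x) = 0 by apply: inv_wrap.
have e2 : adT z (Fp false psi y) = 0 by apply: inv_wrap.
rewrite /PA sz; case: ifP => _; rewrite adT_star // e1 e2.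
  by rewrite (lin0 (starl _ _)) (lin0 (starr _ _)) addr0.
by rewrite (lin0 (starl _ _)) (lin0 (starr _ _)) addr0.
Qed.

End Shape.

Lemma degenerate_counts psi : ~~ Defs.nondegenerate psi ->
  has (leq 2) (counts true psi) || has (leq 2) (counts false psi).
Proof.
rewrite -has_predC has_map has_map -has_predU; apply: sub_has => w /=.
have step (b : bool) (l : seq bool) : ~~ path (fun x y : bool => x != y) b l ->
    (1 < count_mem true (b :: l))%N || (1 < count_mem false (b :: l))%N.
  elim: l b => // c l IHl b /=; rewrite negb_and negbK; case: eqP => [->|ne] /=.
    by case: c; rewrite /= ?orbT.
  move/IHl; case/orP => /= h; apply/orP; [left|right];
    exact: leq_trans h (leq_addl _ _).
by case: w => // b l; apply: step.
Qed.

Lemma PA_degenerate n1 n2 m psi x y : in_L3 n1 n2 m psi -> cosp n1 0 x -> cosp n2 0 y ->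
  ~~ Defs.nondegenerate psi -> PA psi x y = 0.
Proof.
rewrite in_L3E => /and4P [_ /eqP c1 /eqP c2 _] sx sy /degenerate_counts/orP [h|h].
  have e : Fp true psi x = 0 by apply: pathF_degenerate c1 h sx.
  by rewrite /PA e (lin0 (starl _ _)) (lin0 (starr _ _)) if_same.
have e : Fp false psi y = 0 by apply: pathF_degenerate c2 h sy.
by rewrite /PA e (lin0 (starl _ _)) (lin0 (starr _ _)) if_same.
Qed.

End PathOperation.

(** * The bracket on tensors *)

Section TensorBracket.
Variables (k : fieldType) (g : lieAlgebra k) (z : pchain k).
Local Notation U := (ualg g).
Local Notation T := (talg (ualg g)).
Local Notation lt := (@pgen k (ualg g) None).
Implicit Types (u v : U) (s t x y : T) (psi : lpath).

Definition tbT n1 n2 m x y : T :=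
  \sum_(psi : L3 n1 n2 m) z (path_of psi) *: PA (path_of psi) x y.

Lemma tbT_bilin n1 n2 m : bilin (tbT n1 n2 m).
Proof.
split=> w a s t; rewrite /tbT scaler_sumr -big_split; apply: eq_bigr => psi _ /=.
  by rewrite (PA_bilin _ _).1 scalerDr !scalerA mulrC.
by rewrite (PA_bilin _ _).2 scalerDr !scalerA mulrC.
Qed.

Lemma homog_tbT n1 n2 m x y : homog n1 x -> homog n2 y -> homog m (tbT n1 n2 m x y).
Proof.
move=> hx hy; apply: tspan_sum => psi; apply: tspanZ.
exact: homog_PA hx hy (path_ofP psi).1.
Qed.

Lemma inv_sum (I : finType) (f : I -> T) : (forall i, inv (f i)) -> inv (\sum_i f i).
Proof. by move=> fi w; rewrite linear_sum big1 // => i _; apply: fi. Qed.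

Lemma tbT_inv n1 n2 m x y : homog n1 x -> homog n2 y -> inv x -> inv y ->
  inv (tbT n1 n2 m x y).
Proof.
move=> hx hy ix iy; apply: inv_sum => psi w; rewrite linearZ /=.
by rewrite (PA_inv hx hy (path_ofP psi).1 ix iy) scaler0.
Qed.

Section Normal.
Variables (n1 n2 : nat) (x y : T).
Hypotheses (sx : cosp n1 0 x) (sy : cosp n2 0 y).

Let hx : homog n1 x. Proof. by have := cosp_homog sx; rewrite addn0. Qed.
Let hy : homog n2 y. Proof. by have := cosp_homog sy; rewrite addn0. Qed.

Lemma sig_tbT m i : is_tot 2 z -> (n1 + n2 = m.+1 + 2)%N -> (i < m.+1)%N ->
  sig i (tbT n1 n2 m.+1 x y) = 0.
Proof.
move=> zt e lt_i; rewrite /tbT linear_sum /=.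
transitivity (\sum_(psi : L3 n1 n2 m.+1) z (path_of psi) *: PA (codegen i (path_of psi)) x y).
  apply: eq_bigr => psi _; rewrite linearZ /=; congr (_ *: _).
  by rewrite (PA_codegen hx hy (path_ofP psi).1).
rewrite -(@pushfwd_sum k T n1 n2 m _ _ _ (codegen i) z (fun psi => PA psi x y)).
- by apply: big1 => psi _; rewrite zt // scale0r.
- by move=> psi; apply: in_L3_codegen.
- by move=> psi inp; apply: PA_degenerate inp sx sy.
Qed.

(** The cycle condition on [z] makes the operation a chain map. *)
Lemma tbT_diff m : tot_cycle2 z -> (n1 + n2 = m.+1)%N -> inv x -> inv y ->
  tbT n1.+1 n2 m (dd n1 x) y + (-1) ^+ n1 *: tbT n1 n2.+1 m x (dd n2 y) =
  if m is m'.+1 then dd m' (tbT n1 n2 m' x y) else 0.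
Proof.
case=> _ zc e ix iy.
pose h psi := PA psi x y.
have hdeg m1 psi : in_L3 n1 n2 m1 psi -> ~~ Defs.nondegenerate psi -> h psi = 0.
  by move=> inp; apply: PA_degenerate inp sx sy.
have Z : \sum_(psi : L3 n1 n2 m) tot_diff 2 n1 n2 m z (path_of psi) *: h (path_of psi) = 0.
  by apply: big1 => psi _; rewrite zc // scale0r.
have e1 : \sum_(psi : L3 n1 n2 m) (\sum_(i < n1.+2) (-1) ^+ i *
    pushfwd n1.+1 n2 m (face true i) z (path_of psi)) *: h (path_of psi) =
    tbT n1.+1 n2 m (dd n1 x) y.
  under eq_bigr => psi _ do rewrite scaler_suml.
  rewrite exchange_big /= (dd_cof hx) big_mkord (lin_sumE _ _ ((tbT_bilin _ _ _).1 _)).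
  apply: eq_bigr => i _; rewrite (linZ ((tbT_bilin _ _ _).1 _)).
  under eq_bigr => psi _ do rewrite -scalerA.
  rewrite -scaler_sumr pushfwd_sum; last exact: hdeg.
    congr (_ *: _); apply: eq_bigr => psi _; congr (_ *: _).
    by rewrite /h (PA_face_true hx hy ix (path_ofP psi).1).
  by move=> psi; apply: in_L3_face_true.
have e2 : \sum_(psi : L3 n1 n2 m) (\sum_(i < n2.+2) (-1) ^+ i *
    pushfwd n1 n2.+1 m (face false i) z (path_of psi)) *: h (path_of psi) =
    tbT n1 n2.+1 m x (dd n2 y).
  under eq_bigr => psi _ do rewrite scaler_suml.
  rewrite exchange_big /= (dd_cof hy) big_mkord (lin_sumE _ _ ((tbT_bilin _ _ _).2 _)).
  apply: eq_bigr => i _; rewrite (linZ ((tbT_bilin _ _ _).2 _)).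
  under eq_bigr => psi _ do rewrite -scalerA.
  rewrite -scaler_sumr pushfwd_sum; last exact: hdeg.
    congr (_ *: _); apply: eq_bigr => psi _; congr (_ *: _).
    by rewrite /h (PA_face_false hx hy iy (path_ofP psi).1).
  by move=> psi; apply: in_L3_face_false.
have e3 : \sum_(psi : L3 n1 n2 m) cosimp_diff n1 n2 m z (path_of psi) *: h (path_of psi) =
    if m is m'.+1 then dd m' (tbT n1 n2 m' x y) else 0.
  case: m {Z e1 e2} e => [|m] e; first by apply: big1 => psi _; rewrite scale0r.
  under eq_bigr => psi _ do rewrite scaler_suml.
  rewrite exchange_big /= (dd_cof (homog_tbT m hx hy)) big_mkord.
  apply: eq_bigr => i _.
  under eq_bigr => psi _ do rewrite -scalerA.
  rewrite -scaler_sumr pushfwd_sum; last exact: hdeg.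
    congr (_ *: _); rewrite /tbT linear_sum; apply: eq_bigr => psi _; rewrite linearZ /=; congr (_ *: _).
    by rewrite /h (PA_coface hx hy (path_ofP psi).1) // -ltnS.
  by move=> psi; apply: in_L3_coface.
move: Z; rewrite /tot_diff /int_diff.
under eq_bigr => psi _ do rewrite expr2 mulrNN mul1r mul1r scalerBl scalerDl -scalerA.
by rewrite sumrB big_split /= -scaler_sumr e1 e2 e3 => /subr0_eq.
Qed.

End Normal.

Lemma sig_cosp_step a Ps t : tspan (nseq a (@augm k g) ++ (fun=> True) :: Ps) t ->
  sig a t = 0 -> tspan (nseq a (@augm k g) ++ (@augm k g) :: Ps) t.
Proof.
move=> st e; have -> : t = t - ins a 1 (sig a t) by rewrite e linear0 subr0.
elim: a t st {e} => [|a IHa]; apply: tspan_map; try by lint.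
- move=> u t _ st; rewrite sig0C ins0 -scalerAr scalerAl -linearZ -mulrBl -linearB /=.
  by apply: ts_cons st; rewrite /augm linearB linearZ /= eps1 /GRing.scale /= mulr1 subrr.
- move=> u t au st; rewrite sigSC insC -mulrBr; apply: ts_cons au _; exact: IHa.
Qed.

Lemma sig_cosp n t : homog n t -> (forall i, (i < n)%N -> sig i t = 0) -> cosp n 0 t.
Proof.
move=> ht e; have H a : (a <= n)%N -> tspan (nseq a (@augm k g) ++ nseq (n - a) (fun=> True)) t.
  elim: a => [|a IHa] le; first by rewrite subn0.
  have := IHa (ltnW le); rewrite -[(n - a)%N]prednK ?subn_gt0 // -subnS => st.
  have := sig_cosp_step st (e _ le); rewrite -[_ :: nseq _ _]/(nseq 1 _ ++ _) catA -nseqD addn1.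
  by [].
by have := H n (leqnn n); rewrite subnn.
Qed.

End TensorBracket.

(** * Alternating the operation of a lattice path *)

Section Placements.
Variables (k : fieldType) (g : lieAlgebra k).
Hypothesis char0 : [pchar k] =i pred0.
Local Notation U := (ualg g).
Local Notation T := (talg (ualg g)).
Local Notation lt := (@pgen k (ualg g) None).
Local Notation euler := (@euler k g).
Implicit Types (u v : U) (t : T) (w : seq U) (s : seq bool) (pi : seq (bool * bool)).

Definition word w : T := foldr (fun u t => lt u * t) 1 w.

Lemma tspan_words (P : U -> Prop) n (M : lmodType k) (f h : T -> M) :
  linear f -> linear h ->
  (forall w, size w = n -> {in w, forall u, P u} -> f (word w) = h (word w)) ->
  forall t, tspan (nseq n P) t -> f t = h t.
Proof.
elim: n f h => [|n IHn] f h fl hl e t.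
  move/tspan_nil => [a ->]; rewrite (linZ fl) (linZ hl).
  by have /= -> := e [::] erefl (fun _ => ltac:(done)).
move: t; apply: tspan_eq => // u t Pu.
apply: (IHn (fun t => f (lt u * t)) (fun t => h (lt u * t))).
- exact: lin_comp fl (lin_mull _ (@lin_id _ _)).
- exact: lin_comp hl (lin_mull _ (@lin_id _ _)).
move=> w sw Pw; apply: (e (u :: w)); first by rewrite /= sw.
by move=> v; rewrite inE => /predU1P [->|/Pw].
Qed.

(** The next letter, which is [1] unless one is to be taken from the word. *)
Definition letter (h : bool) w : option (U * seq U) :=
  if h then (if w is u :: w' then Some (u, w') else None) else Some (1, w).

Fixpoint placew (s : seq bool) w : T :=
  if s is h :: s' then oapp (fun p => lt p.1 * placew s' p.2) 0 (letter h w)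
  else (w == [::])%:R.

Fixpoint Plw pi w w' : T :=
  if pi is x :: pi' then
    oapp (fun p => oapp (fun q => shp (size pi') (euler (p.1 * q.1)) (Plw pi' p.2 q.2))
      0 (letter x.2 w')) 0 (letter x.1 w)
  else ((w == [::]) && (w' == [::]))%:R.

Lemma homog_shp n u t : homog n t -> homog n.+1 (shp n u t).
Proof.
move: t; elim: n => [|n IHn] t; first by rewrite shp0; apply: homogC.
apply: tspan_map => [|v {}t _ st]; first exact: shp_is_linear.
rewrite shpC; apply: tspanD; first by do 2!apply: homogC.
by apply/tspanN/homogC/IHn.
Qed.

Lemma homog_Plw pi w w' : homog (size pi) (Plw pi w w').
Proof.
elim: pi w w' => [|x pi IH] w w'; first by rewrite /= -scaler_nat; apply: ts_nil.
rewrite /=; case: (letter _ w) => [p|]; last exact: ts_zero.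
case: (letter _ w') => [q|]; last exact: ts_zero.
exact: homog_shp.
Qed.

Lemma alt_star_placew s s' w w' : size s' = size s ->
  alt (size s) (star (size s) (placew s w) (placew s' w')) = Plw (zip s s') w w'.
Proof.
elim: s s' w w' => [|h s IHs] [|h' s'] w w' //= e.
  by rewrite alt0 star0 -natrM mulnb.
case: e => e; have l0 n : alt n (0 : T) = 0 by apply: linear0.
case: (letter h w) => [p|] /=; last by rewrite (lin0 (starl _ _)) l0.
case: (letter h' w') => [q|] /=; last by rewrite (lin0 (starr _ _)) l0.
by rewrite starC (altC char0) (IHs _ _ _ e) size_zip e minnn.
Qed.

Lemma placew_ones n : placew (nseq n false) [::] = lt 1 ^+ n.
Proof. by elim: n => [|n IHn] //=; rewrite IHn exprS. Qed.

Lemma sum_placew_cons h u w w' (S : seq (seq bool)) : letter h w' = Some (u, w) ->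
  \sum_(s <- [seq h :: s | s <- S]) placew s w' = lt u * \sum_(s <- S) placew s w.
Proof. by move=> e; rewrite big_map mulr_sumr; apply: eq_bigr => s _; rewrite /= e. Qed.

(** A word of primitive letters is distributed over the slots between the
    separators with at most one letter in each slot. *)
Definition placeable (n m : nat) (f : seq U -> T) : Prop :=
  exists2 S : seq (seq bool), {in S, forall s, size s = n} & forall w, size w = m ->
     {in w, forall u, isg u} -> f w = \sum_(s <- S) placew s w.

Lemma placeable0 n m f : (forall w, size w = m -> {in w, forall u, isg u} -> f w = 0) ->
  placeable n m f.
Proof. by move=> f0; exists [::] => // w sw gw; rewrite big_nil f0. Qed.

Lemma placeableD n m f1 f2 : placeable n m f1 -> placeable n m f2 ->
  placeable n m (fun w => f1 w + f2 w).
Proof.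
move=> [S1 s1 e1] [S2 s2 e2]; exists (S1 ++ S2) => [s|w sw gw].
  by rewrite mem_cat => /orP [/s1|/s2].
by rewrite big_cat /= e1 // e2.
Qed.

Lemma placeableS (h : bool) n m f : placeable n m f ->
  placeable n.+1 (h + m) (fun w => oapp (fun p => lt p.1 * f p.2) 0 (letter h w)).
Proof.
move=> [S sS e]; exists [seq h :: s | s <- S] => [s /mapP [s' s'S ->]|w sw gw].
  by rewrite /= sS.
case: h sw => [|] /= sw; last by rewrite (sum_placew_cons (u := 1) (w := w)) // e.
case: w sw gw => // u w [sw] gw; rewrite (sum_placew_cons (u := u) (w := w)) //= e //.
by move=> v vw; apply: gw; rewrite inE vw orbT.
Qed.

Lemma eq_placeable n m f1 f2 : (forall w, size w = m -> {in w, forall u, isg u} -> f1 w = f2 w) ->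
  placeable n m f1 -> placeable n m f2.
Proof. by move=> e [S sS eS]; exists S => // w sw gw; rewrite -e // eS. Qed.

Lemma pathF_placeable_aux c cs m :
  (forall m, sumn cs = m.+1 ->
     placeable (size cs) m (fun w => dist cs (wrap (word w))) /\
     placeable (size cs) m.+1 (fun w => dist cs (word w * lt 1))) ->
  sumn (c :: cs) = m.+1 ->
  placeable (size cs) m (fun w => pathF (c :: cs) (wrap (word w))).
Proof.
move=> IHcs; case: c => [|[|c]] /= e.
- by apply: eq_placeable (IHcs m e).1 => w _ _; rewrite advn0.
- case: m e => [|m] [e].
    exists [:: nseq (size cs) false] => [s|[]//]; first by rewrite inE => /eqP ->; rewrite size_nseq.
    by rewrite big_seq1 placew_ones /wrap advnC eps1 scale1r advn0 mul1r dist_zeros.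
  by apply: eq_placeable (IHcs m e).2 => w _ _; rewrite /wrap advnC eps1 scale1r advn0.
- case: m e => [|m] [e] //; apply: placeable0 => -[//|u w] [_] gw.
  rewrite /wrap advnC /= -mulrA advnC (isg_eps (gw u _)) ?mem_head // scale0r scaler0.
  exact: lin0 (@dist_is_linear _ _ _).
Qed.

Lemma dist_placeable cs m : sumn cs = m.+1 ->
  placeable (size cs) m (fun w => dist cs (wrap (word w))) /\
  placeable (size cs) m.+1 (fun w => dist cs (word w * lt 1)).
Proof.
elim: cs m => [//|c cs IHcs] m e.
have P : placeable (size cs) m (fun w => pathF (c :: cs) (wrap (word w))).
  exact: pathF_placeable_aux IHcs e.
split.
  apply: eq_placeable (placeableS false P) => w _ _.
  by rewrite /= /wrap distE csum1 //; exact: pathF_bilin.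
have Q : placeable (size cs) m.+1 (fun w => pathF (c :: cs) (word w * lt 1)).
  case: c e {P} => [|c] e; first by apply: eq_placeable (IHcs m e).2 => w _ _ /=; rewrite advn0.
  apply: placeable0 => -[//|u w] _ gw.
  rewrite /= -mulrA advnC (isg_eps (gw u _)) ?mem_head // scale0r.
  exact: lin0 (@dist_is_linear _ _ _).
apply: eq_placeable (placeableD (placeableS true P) (placeableS false Q)) => -[//|u w] _ gw /=.
have [y ->] := gw u (mem_head _ _); rewrite -mulrA distE csum_gen; last exact: pathF_bilin.
by [].
Qed.

Lemma pathF_placeable c cs m : sumn (c :: cs) = m.+1 ->
  placeable (size cs) m (fun w => pathF (c :: cs) (wrap (word w))).
Proof. exact/pathF_placeable_aux/dist_placeable. Qed.

(** ** Interchanging two slots *)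

Fixpoint swp (i : nat) w : seq U :=
  match i, w with
  | 0, u :: v :: w' => v :: u :: w'
  | i'.+1, u :: w' => u :: swp i' w'
  | _, _ => w
  end.

Lemma tau_word i w : (i.+1 < size w)%N -> tau i (word w) = word (swp i w).
Proof.
elim: i w => [|i IHi] [|u [|v w]] //= lt_i; first by rewrite tau0C.
by rewrite tauC -IHi.
Qed.

Definition cA pi := count fst pi.
Definition cB pi := count snd pi.

Lemma Plw_mismatch pi w w' : ~~ ((size w == cA pi) && (size w' == cB pi)) -> Plw pi w w' = 0.
Proof.
elim: pi w w' => [|[h h'] pi IH] w w' /=.
  by case: w w' => [|? ?] [|? ?].
rewrite /letter; case: h h' => [] []; case: w => [|u w] //; case: w' => [|u' w'] //=;
  rewrite ?add1n ?add0n ?eqSS => H; rewrite IH ?(lin0 (@shp_is_linear _ _ _ _)) //.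
Qed.

Lemma Plw_swap pi1 x y pi2 w w' :
  Plw (pi1 ++ x :: y :: pi2) w w' =
  - Plw (pi1 ++ y :: x :: pi2) (if x.1 && y.1 then swp (cA pi1) w else w)
                               (if x.2 && y.2 then swp (cB pi1) w' else w').
Proof.
elim: pi1 w w' => [|x0 pi1 IH] w w'; last first.
  rewrite /= !size_cat /=; set n := (_ + _)%N.
  have lN a t : shp n a (- t) = - shp n a t by apply: linN; apply: shp_is_linear.
  rewrite /cA /cB /=; case: x0 => -[] [] /=; case: x IH => -[] [] IH; case: y IH => -[] [] IH;
  case: w => [|u w] /=; rewrite ?oppr0 //; case: w' => [|u' w'] /=; rewrite ?oppr0 //= [in LHS]IH ?lN //.
rewrite /=; set n := size pi2.
have H a b : homog n (Plw pi2 a b) by rewrite /n; exact: homog_Plw.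
have S u v t : homog n t -> shp n.+1 u (shp n v t) = - shp n.+1 v (shp n u t).
  by move=> ht; apply: shp_anti ht; rewrite size_nseq.
by case: x => -[] [] /=; case: y => -[] [] /=; case: w => [|u [|v w]] /=; rewrite ?oppr0 //;
 case: w' => [|u' [|v' w']] /=; rewrite ?(lin0 (@shp_is_linear _ _ _ _)) ?oppr0 // [in LHS]S //; exact: H.
Qed.

(** ** The bilinear extension *)

Definition ext (M : lmodType k) (h : bool) (F : U -> T -> M) t : M :=
  if h then tcase 0 F t else F 1 t.

Lemma ext_is_linear (M : lmodType k) h (F : U -> T -> M) : bilin F -> linear (ext h F).
Proof. by case: h => -[_ F2]; [apply: tcase_is_linear | apply: F2]. Qed.

Lemma ext_lin (M N : lmodType k) h (G : N -> U -> T -> M) t :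
  (forall z, bilin (G z)) -> (forall v x, linear (fun z => G z v x)) ->
  linear (fun z => ext h (G z) t).
Proof. by case: h => Gb Gl; [apply: tcase_linF | apply: Gl]. Qed.

Lemma ext_word (M : lmodType k) h (F : U -> T -> M) w : bilin F ->
  ext h F (word w) = oapp (fun p => F p.1 (word p.2)) 0 (letter h w).
Proof. by move=> Fb; case: h => //=; case: w => [|u w] /=; rewrite ?tcase1 ?tcaseM. Qed.

Let el : linear euler. Proof. exact: euler_is_linear char0. Qed.

Fixpoint Pl pi t t' : T :=
  if pi is x :: pi' then
    ext x.1 (fun u t1 => ext x.2 (fun v t2 => shp (size pi') (euler (u * v)) (Pl pi' t1 t2)) t') t
  else tcase (1 : T) (fun _ _ => 0) t * tcase (1 : T) (fun _ _ => 0) t'.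

Lemma Pl_bilin pi : bilin (Pl pi).
Proof.
elim: pi => [|x pi IH] /=; first by lint.
have F2 u t1 : bilin (fun v t2 => shp (size pi) (euler (u * v)) (Pl pi t1 t2)).
  split=> z; first by apply: (lin_comp ((shp_bilin _ _).1 _)); apply: lin_comp el _; lint.
  exact: lin_comp ((shp_bilin _ _).2 _) (IH.2 _).
have F1 t' : bilin (fun u t1 => ext x.2 (fun v t2 => shp (size pi) (euler (u * v)) (Pl pi t1 t2)) t').
  split=> z; apply: ext_lin => // v t2; last exact: lin_comp ((shp_bilin _ _).2 _) (IH.1 _).
  by apply: (lin_comp ((shp_bilin _ _).1 _)); apply: lin_comp el _; lint.
split=> z; first exact: ext_is_linear.
by apply: ext_lin => // v t1; apply: ext_is_linear.
Qed.

Lemma PlE pi w w' : Pl pi (word w) (word w') = Plw pi w w'.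
Proof.
elim: pi w w' => [|x pi IH] w w' /=.
  have e (v : seq U) : tcase (1 : T) (fun _ _ => 0) (word v) = (v == [::])%:R.
    by case: v => [|u v] /=; rewrite ?tcase1 ?tcaseM //; lint.
  by rewrite !e -natrM mulnb.
have F2 u t1 : bilin (fun v t2 => shp (size pi) (euler (u * v)) (Pl pi t1 t2)).
  split=> z; first by apply: (lin_comp ((shp_bilin _ _).1 _)); apply: lin_comp el _; lint.
  exact: lin_comp ((shp_bilin _ _).2 _) ((Pl_bilin pi).2 _).
have F1 t' : bilin (fun u t1 => ext x.2 (fun v t2 => shp (size pi) (euler (u * v)) (Pl pi t1 t2)) t').
  split=> z; apply: ext_lin => // v t2; last exact: lin_comp ((shp_bilin _ _).2 _) ((Pl_bilin pi).1 _).
  by apply: (lin_comp ((shp_bilin _ _).1 _)); apply: lin_comp el _; lint.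
rewrite ext_word //; case: (letter _ w) => [p|] //=.
by rewrite ext_word //; case: (letter _ w') => [q|] //=; rewrite IH.
Qed.

Lemma Pl_words m n (M : lmodType k) (f h : T -> T -> T) : bilin f -> bilin h ->
  (forall w w', size w = m -> size w' = n -> f (word w) (word w') = h (word w) (word w')) ->
  forall t t', homog m t -> homog n t' -> f t t' = h t t'.
Proof.
move=> fb hb e t t' ht ht'; move: t ht; apply: tspan_words; [exact: fb.1 | exact: hb.1 |].
move=> w sw _; move: t' ht'; apply: tspan_words; [exact: fb.2 | exact: hb.2 |].
by move=> w' sw' _; apply: e.
Qed.

Lemma Pl_swap pi1 x y pi2 t t' (pi := pi1 ++ x :: y :: pi2) :
  homog (cA pi) t -> homog (cB pi) t' ->
  Pl pi t t' = - Pl (pi1 ++ y :: x :: pi2)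
    (iter (x.1 && y.1) (@tau k g (cA pi1)) t)
    (iter (x.2 && y.2) (@tau k g (cB pi1)) t').
Proof.
have lE (b : bool) i : linear (iter b (@tau k g i)).
  by case: b; [apply: tau_is_linear | apply: lin_id].
move: t t'; apply: (Pl_words T) => [||w w' sw sw']; first exact: Pl_bilin.
  have [b1 b2] := Pl_bilin (pi1 ++ y :: x :: pi2).
  by split=> z; [exact: lin_opp (lin_comp (b1 _) (lE _ _)) | exact: lin_opp (lin_comp (b2 _) (lE _ _))].
have ew (b : bool) i (v : seq U) : (b -> i.+1 < size v)%N ->
    iter b (@tau k g i) (word v) = word (if b then swp i v else v).
  by case: b => //= le; rewrite tau_word ?le.
rewrite !ew ?PlE; first exact: Plw_swap.
  by rewrite sw' /pi /cB count_cat /=; case: x y {sw sw' pi} => [a []] [c []] //= _; rewrite !addnS ltnS leq_addr.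
by rewrite sw /pi /cA count_cat /=; case: x y {sw sw' pi} => [[] a] [[] c] //= _; rewrite !addnS !ltnS leq_addr.
Qed.

Lemma Pl_mismatch pi t t' m n : homog m t -> homog n t' ->
  ~~ ((m == cA pi) && (n == cB pi)) -> Pl pi t t' = 0.
Proof.
move=> ht ht' ne; move: t t' ht ht'; apply: (Pl_words T) => [||w w' sw sw']; first exact: Pl_bilin.
  by split=> z; apply: lin_zero.
by rewrite PlE Plw_mismatch // sw sw'.
Qed.

(** Two doubly occupied slots can be made adjacent and then exchanged. *)
Lemma Pl_two pi1 pi2 pi3 t t' (AB := (true, true)) (pi := pi1 ++ AB :: pi2 ++ AB :: pi3) :
  homog (cA pi) t -> homog (cB pi) t' -> anti (cA pi) t -> anti (cB pi) t' ->
  Pl pi t t' = 0.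
Proof.
rewrite /pi; clear pi; elim: pi2 pi1 pi3 => [|x pi2 IH] pi1 pi3; set pi := pi1 ++ _ => ht ht' at_ at'.
  have /= := @Pl_swap pi1 AB AB pi3 t t' ht ht'.
  rewrite at_ ?at' /cA /cB ?count_cat /= ?addnS ?ltnS ?leq_addr //.
  rewrite (linN ((Pl_bilin _).1 _)) (linN ((Pl_bilin _).2 _)) opprK => /eqP.
  by rewrite -subr_eq0 opprK -mulr2n -scaler_nat scaler_eq0 (negPf (two_neq0 char0)) => /eqP.
have eA : cA (rcons pi1 x ++ AB :: pi2 ++ AB :: pi3) = cA pi.
  by rewrite /pi /cA -cats1 !count_cat /= !count_cat /= addn0; ring.
have eB : cB (rcons pi1 x ++ AB :: pi2 ++ AB :: pi3) = cB pi.
  by rewrite /pi /cB -cats1 !count_cat /= !count_cat /= addn0; ring.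
have := IH (rcons pi1 x) pi3; rewrite eA eB => /(_ ht ht' at_ at') e.
rewrite /pi [_ ++ AB :: _]/= Pl_swap // -cat_rcons.
have -> : iter (true && x.1) (@tau k g (cA pi1)) t = (-1) ^+ x.1 *: t.
  case: x {IH eA eB e} @pi ht ht' at_ at' => [[] b] pi ht ht' at_ at' /=; rewrite ?scale1r // scaleN1r.
  by apply: at_; rewrite /pi /cA count_cat /= !addnS !ltnS leq_addr.
have -> : iter (true && x.2) (@tau k g (cB pi1)) t' = (-1) ^+ x.2 *: t'.
  case: x {IH eA eB e} @pi ht ht' at_ at' => [b []] pi ht ht' at_ at' /=; rewrite ?scale1r // scaleN1r.
  by apply: at'; rewrite /pi /cB count_cat /= !addnS !ltnS leq_addr.
by rewrite (linZ ((Pl_bilin _).1 _)) (linZ ((Pl_bilin _).2 _)) e !scaler0 oppr0.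
Qed.

Lemma has_split (A : Type) (P : pred A) (l : seq A) : has P l ->
  exists l1 x l2, [/\ l = l1 ++ x :: l2, P x & count P l1 = 0%N].
Proof.
elim: l => //= x l IHl; case: (boolP (P x)) => [Px _|nPx /= /IHl [l1 [y [l2 [-> Py e]]]]].
  by exists [::], x, l.
by exists (x :: l1), y, l2; rewrite /= (negPf nPx) e.
Qed.

Lemma Pl_vanish pi m n t t' : homog m t -> homog n t' -> anti m t -> anti n t' ->
  (m + n = size pi + 2)%N -> Pl pi t t' = 0.
Proof.
move=> ht ht' at_ at' e.
have [/andP [/eqP e1 /eqP e2]|ne] := boolP ((m == cA pi) && (n == cB pi)); last exact: Pl_mismatch ne.
rewrite {}e1 {}e2 in ht ht' at_ at' e.
pose P (x : bool * bool) := x.1 && x.2.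
have c2 : (1 < count P pi)%N.
  have : (cA pi + cB pi <= size pi + count P pi)%N.
    elim: pi {ht ht' at_ at' e} => //= -[[] []] pi; rewrite /cA /cB /= ?add1n ?add0n ?addSn ?addnS ?ltnS // => IH;
      by [|apply: leqW|do 2!apply: leqW].
  by rewrite e leq_add2l.
have PE (x : bool * bool) : P x -> x = (true, true) by case: x => -[] [].
have [|s1 [x [s2 [e1 /PE ex c1]]]] := @has_split _ P pi; first by rewrite has_count (ltnW c2).
have [|s3 [y [s4 [e3 /PE ey c3]]]] := @has_split _ P s2.
  by move: c2; rewrite e1 count_cat c1 /= ex has_count.
by move: ht ht' at_ at' {e c2}; rewrite e1 e3 ex ey; apply: Pl_two.
Qed.

Lemma alt_placeable p m n (f f' : T -> T) t t' : linear f -> linear f' ->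
  placeable p m (fun w => f (word w)) -> placeable p n (fun w => f' (word w)) ->
  cosp 0 m t -> cosp 0 n t' -> anti m t -> anti n t' -> (m + n = p + 2)%N ->
  alt p (star p (f t) (f' t')) = 0.
Proof.
move=> fl fl' [S sS eS] [S' sS' eS'] ct ct' at_ at' e.
have ht := cosp_homog ct; have ht' := cosp_homog ct'.
have -> : alt p (star p (f t) (f' t')) = \sum_(s <- S) \sum_(s' <- S') Pl (zip s s') t t'.
  have lsum (N : lmodType k) (I : Type) (r : seq I) (F : I -> N -> T) :
      (forall i, linear (F i)) -> linear (fun x => \sum_(i <- r) F i x).
    by move=> Fl a x y; rewrite scaler_sumr -big_split; apply: eq_bigr => i _; rewrite Fl.
  move: t ct {ht at_}; apply: tspan_words.
  - exact: lin_comp (@alt_is_linear _ _ _) (lin_comp (starl _ _) fl).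
  - by apply: (@lsum) => s; apply: (@lsum) => s'; apply: (Pl_bilin _).1.
  move=> w sw gw; move: t' ct' {ht' at'}; apply: tspan_words.
  - exact: lin_comp (@alt_is_linear _ _ _) (lin_comp (starr _ _) fl').
  - by apply: (@lsum) => s; apply: (@lsum) => s'; apply: (Pl_bilin _).2.
  move=> w' sw' gw'; rewrite eS // eS' //.
  rewrite (lin_sumE _ _ (starl _ _)) linear_sum /=; apply: eq_big_seq => s sIn.
  rewrite (lin_sumE _ _ (starr _ _)) linear_sum /=; apply: eq_big_seq => s' s'In.
  by have := @alt_star_placew s s' w w'; rewrite PlE (sS _ sIn) (sS' _ s'In) => ->.
rewrite big_seq big1 // => s sIn; rewrite big_seq big1 // => s' s'In.
by apply: Pl_vanish ht ht' at_ at' _; rewrite size_zip (sS _ sIn) (sS' _ s'In) minnn.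
Qed.

Theorem alt_PA m n p psi (a b : T) : (m + n = p + 2)%N -> in_L3 m n p psi ->
  cosp 0 m a -> cosp 0 n b -> anti m a -> anti n b -> alt p (PA psi a b) = 0.
Proof.
move=> e; rewrite in_L3E => /and4P [/eqP sz /eqP c1 /eqP c2 _] ca cb aa ab.
have pl d j : sumn (counts d psi) = j.+1 -> placeable p j (fun w => Fp d psi (word w)).
  case: psi sz {c1 c2} => [//|w psi] [sz] c.
  by have := pathF_placeable c; rewrite size_counts sz.
have l1 d : linear (@Fp k g d psi) by apply: Fp_is_linear.
rewrite /PA sz; case: ifP => _.
  exact: alt_placeable (l1 _) (l1 _) (pl _ _ c1) (pl _ _ c2) ca cb aa ab e.
by apply: alt_placeable (l1 _) (l1 _) (pl _ _ c2) (pl _ _ c1) cb ca ab aa _; rewrite addnC.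
Qed.

End Placements.

Section Exactness.
Variables (k : fieldType) (g : lieAlgebra k) (z : pchain k).
Hypotheses (char0 : [pchar k] =i pred0) (zc : tot_cycle2 z).
Local Notation U := (ualg g).
Local Notation T := (talg (ualg g)).
Local Notation tb := (@tbT k g z).
Implicit Types (t a b x y : T).

Lemma cosp_prim n t : cosp 0 n t -> cosp n 0 t.
Proof.
move=> ct; have H i : (i <= n)%N -> cosp i (n - i) t.
  elim: i => [|i IHi] le; first by rewrite subn0.
  by apply: cospW; rewrite -subSn // subSS; apply/IHi/ltnW.
by have := H n (leqnn n); rewrite subnn.
Qed.

Lemma cosp0_homog n t : cosp n 0 t -> homog n t.
Proof. by move/cosp_homog; rewrite addn0. Qed.

Lemma inv_alt n t : homog n t -> inv t -> inv (alt n t).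
Proof. by move=> ht it y; rewrite (adT_alt char0 _ ht) it linear0. Qed.

Lemma alt_tbT_ddl m n p x b : (m + n = p + 2)%N -> cosp m.-1 0 x -> inv x ->
  cosp n 0 b -> inv b -> dd n b = 0 -> alt p (tb m n p (dd m.-1 x) b) = 0.
Proof.
case: m => [|m] e cx ix cb ib db.
  by rewrite dd0 (lin0 ((tbT_bilin _ _ _ _ _).1 _)) linear0.
have e' : (m + n = p.+1)%N by move: e; rewrite addSn addn2 => -[].
have := tbT_diff cx cb zc e' ix ib.
rewrite db (lin0 ((tbT_bilin _ _ _ _ _).2 _)) scaler0 addr0 => ->.
case: p {e e'} => [|p]; first exact: linear0.
by apply: (alt_dd char0); apply: homog_tbT; apply: cosp0_homog.
Qed.

Lemma alt_tbT_ddr m n p a y : (m + n = p + 2)%N -> cosp m 0 a -> inv a -> dd m a = 0 ->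
  cosp n.-1 0 y -> inv y -> alt p (tb m n p a (dd n.-1 y)) = 0.
Proof.
case: n => [|n] e ca ia da cy iy.
  by rewrite dd0 (lin0 ((tbT_bilin _ _ _ _ _).2 _)) linear0.
have e' : (m + n = p.+1)%N by move: e; rewrite addnS addn2 => -[].
have := tbT_diff ca cy zc e' ia iy.
rewrite da (lin0 ((tbT_bilin _ _ _ _ _).1 _)) add0r => H.
have {H} : alt p ((-1) ^+ m *: tb m n.+1 p a (dd n y)) = 0.
  rewrite H; case: p {e e' H} => [|p]; first exact: linear0.
  by apply: (alt_dd char0); apply: homog_tbT; apply: cosp0_homog.
by rewrite linearZ /= => /eqP; rewrite scaler_eq0 signr_eq0 => /eqP.
Qed.

Lemma fact_neq0 n : n`!%:R != 0 :> k.
Proof.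
rewrite -[_%:R]subr0; apply: (natr_neq char0 (n := 0)).
by apply/eqP; rewrite -lt0n fact_gt0.
Qed.

(** The bracket of two cocycles is exact. *)
Theorem tbT_exact m n p a b : (m + n = p + 2)%N ->
  cosp m 0 a -> dd m a = 0 -> inv a -> cosp n 0 b -> dd n b = 0 -> inv b ->
  exists c, [/\ tb m n p a b = dd p.-1 c, cosp p.-1 0 c & inv c].
Proof.
move=> e ca da ia cb db ib.
have ha := cosp0_homog ca; have hb := cosp0_homog cb.
have hB := homog_tbT z p ha hb; have iB := tbT_inv z p ha hb ia ib.
have cB : cosp p 0 (tb m n p a b).
  apply: sig_cosp hB _ => i; case: p e {iB} => // p e lt_i.
  exact: (sig_tbT ca cb zc.1 e lt_i).
have dB : dd p (tb m n p a b) = 0.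
  have e' : (m + n = p.+2)%N by rewrite e addn2.
  have <- := tbT_diff ca cb zc e' ia ib.
  by rewrite da db (lin0 ((tbT_bilin _ _ _ _ _).1 _)) (lin0 ((tbT_bilin _ _ _ _ _).2 _)) scaler0 addr0.
have [c [Ec cc ic]] := cocycle_alt char0 cB dB iB.
suff aB : alt p (tb m n p a b) = 0.
  exists ((p`!%:R : k)^-1 *: c); split; last 2 first.
  - exact: tspanZ.
  - by rewrite -[_ *: c]addr0; apply: inv_lin ic _ => y; rewrite linear0.
  rewrite (linZ (@dd_is_linear _ _ _)); apply: (scalerI (fact_neq0 p)).
  by rewrite Ec aB add0r scalerA divff ?fact_neq0 // scale1r.
have [x [Ea cx ix]] := cocycle_alt char0 ca da ia.
have [y [Eb cy iy]] := cocycle_alt char0 cb db ib.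
have caa := cosp_alt char0 ha; have cab := cosp_alt char0 hb.
have e1 : alt p (tb m n p (alt m a) (alt n b)) = 0.
  rewrite /tbT linear_sum big1 // => psi _; rewrite linearZ /=.
  rewrite (alt_PA char0 e (path_ofP psi).1 caa cab) ?scaler0 //; exact: alt_antisym.
have e2 : alt p (tb m n p (alt m a) (dd n.-1 y)) = 0.
  by apply: alt_tbT_ddr => //; [apply: cosp_prim | apply: inv_alt | apply: dd_prim caa].
have e3 : alt p (tb m n p (dd m.-1 x) b) = 0 by apply: alt_tbT_ddl.
have L1 w := (@tbT_bilin k g z m n p).1 w.
have L2 w := (@tbT_bilin k g z m n p).2 w.
have E : n`!%:R *: (m`!%:R *: tb m n p a b) = tb m n p (alt m a) (alt n b) +
    tb m n p (alt m a) (dd n.-1 y) + n`!%:R *: tb m n p (dd m.-1 x) b.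
  by rewrite -(linZ (L1 _)) Ea (linD (L1 _)) scalerDr -(linZ (L2 _)) Eb (linD (L2 _)).
apply: (scalerI (fact_neq0 m)); apply: (scalerI (fact_neq0 n)); rewrite !scaler0.
have la := @alt_is_linear k g p.
by rewrite -(linZ la) -(linZ la) E !(linD la) (linZ la) e1 e2 e3 scaler0 !addr0.
Qed.

End Exactness.

(** * Natural endomorphisms as tensors *)

Section TensorMaps.
Variables (k : fieldType) (g : lieAlgebra k).
Local Notation "X ** Y" := (rep_tens X Y) (at level 40, left associativity).
Implicit Types X Y Z : rep g.

Lemma tens_ext (V W M : lmodType k) (f h : tens V W -> M) : linear f -> linear h ->
  (forall v w, f (v *t w) = h (v *t w)) -> forall x, f x = h x.
Proof.
move=> fl hl e x; rewrite (tens_pure_sum x) (lin_sumE _ _ fl) (lin_sumE _ _ hl).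
by apply: eq_bigr => p _; apply: e.
Qed.

Section Tmap.
Variables (X X' Y Y' : rep g) (f : X -> X') (h : Y -> Y').
Hypotheses (fl : linear f) (hl : linear h).

Let bl w : linear (fun v => f v *t h w).
Proof. exact: lin_comp (pure_linl _) fl. Qed.

Let br v : linear (fun w => f v *t h w).
Proof. exact: lin_comp (pure_linr _) hl. Qed.

Lemma tmap_linear : linear (tmap f h).
Proof. exact: tlift_linear bl br. Qed.

Lemma tmap_pure v w : tmap f h (v *t w) = f v *t h w.
Proof. exact: tlift_pure bl br _ _. Qed.

End Tmap.

Lemma tassoc_linear X Y Z : linear (@tassoc k g X Y Z).
Proof.
have l1 (a : X) (c : Z) : linear (fun b : Y => a *t b *t c) by exact: lin_comp (pure_linl _) (pure_linr _).
have l2 (a : X) (b : Y) : linear (fun c : Z => a *t b *t c) by exact: pure_linr.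
apply: tlift_linear => [x|u]; last exact: tlift_linear.
have l3 (c : Y * Z) : linear (fun a : X => a *t c.1 *t c.2).
  exact: lin_comp (pure_linl _) (pure_linl _).
by move=> a b1 b2; rewrite /tlift scaler_sumr -big_split; apply: eq_bigr => c _; apply: (l3 c).
Qed.

Lemma tassoc_pure X Y Z (u : X) (v : Y) (w : Z) : tassoc (u *t (v *t w)) = u *t v *t w.
Proof.
have l1 (a : X) (c : Z) : linear (fun b : Y => a *t b *t c) by exact: lin_comp (pure_linl _) (pure_linr _).
have l2 (a : X) (b : Y) : linear (fun c : Z => a *t b *t c) by exact: pure_linr.
have l3 (c : Y * Z) : linear (fun a : X => a *t c.1 *t c.2).
  exact: lin_comp (pure_linl _) (pure_linl _).
rewrite /tassoc tlift_pure ?tlift_pure // => [x|x]; last exact: tlift_linear.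
by move=> a b1 b2; rewrite /tlift scaler_sumr -big_split; apply: eq_bigr => c _; apply: (l3 c).
Qed.

Lemma tassoc_inv_linear X Y Z : linear (@tassoc_inv k g X Y Z).
Proof.
have l1 (b : Y) (c : Z) : linear (fun a : X => a *t (b *t c)) by exact: pure_linl.
have l2 (a : X) (c : Z) : linear (fun b : Y => a *t (b *t c)) by exact: lin_comp (pure_linr _) (pure_linl _).
apply: tlift_linear => [w|x]; first exact: tlift_linear.
have l3 (c : X * Y) : linear (fun b : Z => c.1 *t (c.2 *t b)).
  exact: lin_comp (pure_linr _) (pure_linr _).
by move=> a b1 b2; rewrite /tlift scaler_sumr -big_split; apply: eq_bigr => c _; apply: (l3 c).
Qed.

Lemma tassoc_inv_pure X Y Z (u : X) (v : Y) (w : Z) : tassoc_inv (u *t v *t w) = u *t (v *t w).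
Proof.
have l1 (b : Y) (c : Z) : linear (fun a : X => a *t (b *t c)) by exact: pure_linl.
have l2 (a : X) (c : Z) : linear (fun b : Y => a *t (b *t c)) by exact: lin_comp (pure_linr _) (pure_linl _).
have l3 (c : X * Y) : linear (fun b : Z => c.1 *t (c.2 *t b)).
  exact: lin_comp (pure_linr _) (pure_linr _).
rewrite /tassoc_inv tlift_pure ?tlift_pure // => [x|x]; first exact: tlift_linear.
by move=> a b1 b2; rewrite /tlift scaler_sumr -big_split; apply: eq_bigr => c _; apply: (l3 c).
Qed.

Lemma tassocK X Y Z (x : X ** (Y ** Z)) : tassoc_inv (tassoc x) = x.
Proof.
have L : linear (fun x : X ** (Y ** Z) => tassoc_inv (tassoc x)).
  exact: lin_comp (@tassoc_inv_linear _ _ _) (@tassoc_linear _ _ _).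
apply: (tens_ext L (@lin_id _ _)) => u; apply: tens_ext.
- exact: lin_comp L (pure_linr _).
- exact: pure_linr.
by move=> v w; rewrite tassoc_pure tassoc_inv_pure.
Qed.

Lemma tlunit_linear X : linear (@tlunit k g X).
Proof.
apply: tlift_linear => [v a c d|c]; last exact: lin_scale (@lin_id _ _).
by rewrite scalerDl scalerA.
Qed.

Lemma tlunit_pure X (c : k^o) (v : X) : tlunit (c *t v : rep_unit g ** X) = c *: v.
Proof.
apply: tlift_pure => [w a b d|b]; last exact: lin_scale (@lin_id _ _).
by rewrite scalerDl scalerA.
Qed.

Lemma tlunit_inv_linear X : linear (@tlunit_inv k g X).
Proof. exact: pure_linr. Qed.

Lemma tsplit_linear i (Xs : seq (rep g)) : linear (@tsplit k g i Xs).
Proof.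
elim: Xs i => [|X Xs IH] [|i]; try exact: tlunit_inv_linear.
exact: lin_comp (@tassoc_linear _ _ _) (tmap_linear (@lin_id _ _) (IH i)).
Qed.

Lemma tjoin_linear i (Xs : seq (rep g)) : linear (@tjoin k g i Xs).
Proof.
elim: Xs i => [|X Xs IH] [|i]; try exact: tlunit_linear.
exact: lin_comp (tmap_linear (@lin_id _ _) (IH i)) (@tassoc_inv_linear _ _ _).
Qed.

Lemma tsplitK i (Xs : seq (rep g)) (t : Tpow Xs) : tjoin (tsplit i t) = t.
Proof.
elim: Xs i t => [|X Xs IH] [|i] t; try by rewrite [LHS]tlunit_pure scale1r.
rewrite /= tassocK.
have L1 : linear (tmap (@id X) (@tjoin k g i Xs)) by exact: tmap_linear (@lin_id _ _) (@tjoin_linear _ _).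
have L2 : linear (tmap (@id X) (@tsplit k g i Xs)) by exact: tmap_linear (@lin_id _ _) (@tsplit_linear _ _).
move: t; apply: (tens_ext (lin_comp L1 L2) (@lin_id _ _)) => x t.
rewrite (tmap_pure (@lin_id _ _) (@tsplit_linear i Xs)).
by rewrite (tmap_pure (@lin_id _ _) (@tjoin_linear i Xs)) IH.
Qed.

Lemma tjoinS i X Xs (x : X) (y : Tpow (take i Xs)) (q : Tpow (drop i Xs)) :
  @tjoin k g i.+1 (X :: Xs) (x *t y *t q) = x *t @tjoin k g i Xs (y *t q).
Proof.
by rewrite /= tassoc_inv_pure (tmap_pure (@lin_id _ _) (@tjoin_linear i Xs)).
Qed.

End TensorMaps.

Section Action.
Variables (k : fieldType) (g : lieAlgebra k).
Local Notation U := (ualg g).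
Local Notation T := (talg (ualg g)).
Local Notation lt := (@pgen k (ualg g) None).
Local Notation urep := (@urep k g).
Implicit Types (X Y : rep g) (Xs Ys : seq (rep g)) (u v : U) (c t : T).

Lemma ev_mul X (x : X) u v : ev x (u * v) = ev (ev x v) u.
Proof.
elim/u_ind: u => [|y u IHu|a u u' IHu IHu']; first by rewrite mul1r ev1.
  by rewrite -mulrA !evM IHu.
by rewrite mulrDl -scalerAl !ev_is_linear IHu IHu'.
Qed.

Lemma hom_ev X Y (f : rep_hom X Y) (x : X) u : f (ev x u) = ev (f x) u.
Proof.
elim/u_ind: u => [|y u IHu|a u u' IHu IHu']; first by rewrite !ev1.
  by rewrite !evM hom_act IHu.
by rewrite !ev_is_linear (hom_linear f) IHu IHu'.
Qed.

Definition head_coef (t : T) : k := tcase (1 : k^o) (fun _ _ => 0) t.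

Lemma head_coef_linear : linear (head_coef : T -> k^o).
Proof. exact: tcase_is_linear. Qed.

Lemma head_coef1 : head_coef 1 = 1.
Proof. by rewrite /head_coef tcase1 //; split=> ? ? ? ?; rewrite scaler0 addr0. Qed.

Lemma head_coef_scal a : head_coef (a *: 1) = a.
Proof. by have := head_coef_linear a 1 0; rewrite !addr0 head_coef1 (lin0 head_coef_linear) addr0 => ->; exact: mulr1. Qed.

(** The letters of a tensor act on the factors of a tensor product. *)
Fixpoint act Xs (t : T) : Tpow Xs -> Tpow Xs :=
  match Xs return Tpow Xs -> Tpow Xs with
  | [::] => fun y => head_coef t *: y
  | X :: Xs' => tlift (fun x y => tcase 0 (fun u c => ev x u *t act c y) t)
  end.

Definition act_good Xs : Prop :=
  (forall t, linear (@act Xs t)) /\ (forall y, linear (fun t => @act Xs t y)).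

Lemma act_letter_bilin X Xs (x : X) (y : Tpow Xs) : act_good Xs ->
  bilin (fun u (c : T) => ev x u *t act c y).
Proof.
move=> [_ a2]; split=> z.
  exact: lin_comp (pure_linl _) (@ev_is_linear _ _ _ _).
exact: lin_comp (pure_linr _) (a2 _).
Qed.

Lemma act_pair_bilin X Xs t : act_good Xs ->
  (forall y : Tpow Xs, linear (fun x : X => tcase 0 (fun u (c : T) => ev x u *t act c y) t)) /\
  (forall x : X, linear (fun y : Tpow Xs => tcase 0 (fun u (c : T) => ev x u *t act c y) t)).
Proof.
move=> ag; split=> [y|x]; apply: tcase_linF => [x'|u c]; try exact: act_letter_bilin.
- exact: lin_comp (pure_linl _) (@ev_linr _ _ _ _).
- exact: lin_comp (pure_linr _) (ag.1 _).
Qed.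

Lemma act_goodP Xs : act_good Xs.
Proof.
elim: Xs => [|X Xs IH].
  split=> [t|y a t s]; first exact: lin_scale (@lin_id _ _).
  by rewrite /= head_coef_linear scalerDl scalerA.
split=> [t|y].
  by have [b1 b2] := @act_pair_bilin X Xs t IH; apply: tlift_linear.
by move=> a t s; rewrite /= /tlift scaler_sumr -big_split; apply: eq_bigr => p _; rewrite linearP.
Qed.

Lemma act_linear Xs t : linear (@act Xs t). Proof. exact: (act_goodP Xs).1. Qed.
Lemma act_linl Xs (y : Tpow Xs) : linear (fun t => act t y). Proof. exact: (act_goodP Xs).2. Qed.

Lemma act0E (y : Tpow ([::] : seq (rep g))) t : act t y = head_coef t *: y.
Proof. by []. Qed.

Lemma actE X Xs u c (x : X) (y : Tpow Xs) :
  @act (X :: Xs) (lt u * c) (x *t y) = ev x u *t act c y.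
Proof.
have [b1 b2] := @act_pair_bilin X Xs (lt u * c) (act_goodP Xs).
rewrite [LHS](tlift_pure b1 b2) tcaseM //; exact/act_letter_bilin/act_goodP.
Qed.

Lemma act_ones Xs (y : Tpow Xs) : act (lt 1 ^+ size Xs) y = y.
Proof.
elim: Xs y => [|X Xs IH]; first by move=> y; rewrite act0E head_coef1 scale1r.
apply: tens_ext => [||x y]; [exact: (@act_linear (X :: Xs)) | exact: lin_id |].
by rewrite [size _]/= exprS actE ev1 IH.
Qed.

Lemma act_star Xs s t (y : Tpow Xs) : homog (size Xs) s -> homog (size Xs) t ->
  act s (act t y) = act (star (size Xs) s t) y.
Proof.
elim: Xs s t y => [|X Xs IH] s t.
  move=> y /homog0 [a ->] /homog0 [b ->]; rewrite star0 -scalerAl mul1r !act0E.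
  by rewrite !scalerA !head_coef_scal.
move=> y hs ht; move: s t hs ht.
apply: (homog_ind2 (f := fun s t => act s (act t y)) (h := fun s t => act (star (size Xs).+1 s t) y)).
- split=> z; first exact: act_linl.
  exact: lin_comp (@act_linear (X :: Xs) _) (@act_linl (X :: Xs) _).
- by split=> z; [exact: lin_comp (@act_linl (X :: Xs) _) (starl _ _) | exact: lin_comp (@act_linl (X :: Xs) _) (starr _ _)].
move=> u v s t hs ht; rewrite starC; move: y; apply: tens_ext.
- exact: lin_comp (@act_linear (X :: Xs) _) (@act_linear (X :: Xs) _).
- exact: (@act_linear (X :: Xs)).
by move=> x y; rewrite !actE ev_mul IH.
Qed.

Lemma act_lmulp Xs z t (y : Tpow Xs) : homog (size Xs) t ->
  rep_act z (act t y) = act (lmulp (size Xs) (ugen z) t) y.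
Proof.
elim: Xs t y => [|X Xs IH] t y ht; first by rewrite lmulp0 (lin0 (act_linl y)).
move: t ht y; have L := @act_linear (X :: Xs); have R := @act_linl (X :: Xs) => t ht y.
move: t ht; apply: tspan_eq.
- exact: lin_comp (act_linr _) (R _).
- exact: lin_comp (R _) (@lmulp_is_linear _ _ _ _).
move=> u c _ hc; rewrite lmulpC; move: y; apply: tens_ext.
- exact: lin_comp (act_linr (r := rep_tens X (Tpow Xs)) _) (L _).
- exact: L.
move=> x y; rewrite (linD (R _)) !actE evM -IH //; exact: tact_pure.
Qed.

Lemma act_adT Xs z t (y : Tpow Xs) : homog (size Xs) t ->
  rep_act z (act t y) = act (adT z t) y + act t (rep_act z y).
Proof.
elim: Xs t y => [|X Xs IH] t y ht.
  have [a ->] := homog0 ht; rewrite (linZ (@adT_is_linear _ _ _)) adT1 scaler0 (lin0 (@act_linl [::] y)) add0r.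
  by rewrite [RHS](lin0 (@act_linear [::] _)).
move: t ht y; have L := @act_linear (X :: Xs); have R := @act_linl (X :: Xs) => t ht y.
have rl : linear (@rep_act k g (rep_tens X (Tpow Xs)) z) by apply: act_linr.
move: t ht; apply: tspan_eq.
- exact: lin_comp (act_linr _) (R _).
- by apply: lin_add; [exact: lin_comp (R _) (@adT_is_linear _ _ _) | exact: R].
move=> u c _ hc; rewrite adTC; move: y; apply: tens_ext.
- exact: lin_comp rl (L _).
- by apply: lin_add; [exact: L | exact: lin_comp (L _) rl].
move=> x y; rewrite (linD (R _)) !actE.
have -> : rep_act z (x *t y : rep_tens X (Tpow Xs)) = rep_act z x *t y + x *t rep_act z y.
  exact: tact_pure.
rewrite (linD (L _)) !actE /uad (lin_sub (@ev_is_linear _ _ _ _)) evM ev_mul.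
have -> : ev x (ugen z) = rep_act z x by rewrite -[ugen z]mulr1 evM ev1.
rewrite (lin_sub (pure_linl _)).
have -> : rep_act z (ev x u *t act c y : rep_tens X (Tpow Xs)) =
  rep_act z (ev x u) *t act c y + ev x u *t rep_act z (act c y) by exact: tact_pure.
rewrite IH // (linD (pure_linr _)).
by rewrite [RHS]addrACA subrK.
Qed.

Lemma ev_dl Xs (y : Tpow Xs) u : ev y u = act (dl (size Xs) u) y.
Proof.
elim/u_ind: u => [|z u IHu|a u u' IHu IHu']; first by rewrite ev1 dl1 act_ones.
  by rewrite evM IHu dl_gen act_lmulp //; apply: homog_dl.
by rewrite ev_is_linear IHu IHu' dl_is_linear act_linl.
Qed.

Lemma Tpow_map_linear Xs Ys (fs : rep_homs Xs Ys) : linear (Tpow_map fs).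
Proof.
elim: Xs Ys fs => [|X Xs IH] [|Y Ys] // fs.
exact: tmap_linear (hom_linear fs.1) (IH _ fs.2).
Qed.

Lemma Tpow_map_pure X Y Xs Ys (f : rep_hom X Y) (fs : rep_homs Xs Ys) x y :
  @Tpow_map k g (X :: Xs) (Y :: Ys) (f, fs) (x *t y) = f x *t Tpow_map fs y.
Proof. exact: tmap_pure (hom_linear f) (Tpow_map_linear fs) x y. Qed.

Lemma act_natural Xs Ys (fs : rep_homs Xs Ys) t y : homog (size Xs) t ->
  Tpow_map fs (act t y) = act t (Tpow_map fs y).
Proof.
elim: Xs Ys fs t y => [|X Xs IH] [|Y Ys] // [f fs] t y ht.
have L Xs' := @act_linear Xs'; have R Xs' := @act_linl Xs'.
have M := @Tpow_map_linear (X :: Xs) (Y :: Ys) (f, fs).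
move: t ht; apply: tspan_eq.
- exact: lin_comp M (R (X :: Xs) _).
- exact: (R (Y :: Ys)).
move=> u c _ hc.
pose F y := @Tpow_map k g (X :: Xs) (Y :: Ys) (f, fs) (@act (X :: Xs) (lt u * c) y).
pose H y := @act (Y :: Ys) (lt u * c) (@Tpow_map k g (X :: Xs) (Y :: Ys) (f, fs) y).
have Fl : linear F by exact: lin_comp M (L (X :: Xs) _).
have Hl : linear H by exact: lin_comp (L (Y :: Ys) _) M.
suff P x y' : F (x *t y') = H (x *t y') by exact: (tens_ext Fl Hl P).
by rewrite /F /H actE !Tpow_map_pure actE IH // hom_ev.
Qed.

(** ** Tensors of the universal representation *)

Fixpoint ones n : Tpow (nseq n urep) :=
  if n is n'.+1 return Tpow (nseq n urep) then (1 : urep) *t ones n' else (1 : k^o).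

Fixpoint kap n : Tpow (nseq n urep) -> T :=
  if n is n'.+1 return Tpow (nseq n urep) -> T
  then tlift (fun (u : urep) y => lt u * kap y) else fun r => (r : k) *: 1.

Lemma kap_linear n : linear (@kap n).
Proof.
elim: n => [|n IH]; first by move=> a c d /=; rewrite scalerDl scalerA.
apply: tlift_linear => [y|u]; first by lint.
exact: lin_comp (lin_mull _ (@lin_id _ _)) IH.
Qed.

Lemma kap_pure n (u : urep) (y : Tpow (nseq n urep)) :
  @kap n.+1 (u *t y) = lt u * kap y.
Proof.
apply: tlift_pure => [z|v]; first by lint.
exact: lin_comp (lin_mull _ (@lin_id _ _)) (@kap_linear n).
Qed.

Lemma homog_kap n (y : Tpow (nseq n urep)) : homog n (kap y).
Proof.
elim: n y => [|n IH] y; first exact: ts_nil.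
rewrite (tens_pure_sum y) (lin_sumE _ _ (@kap_linear n.+1)).
by apply: tspan_sum => p; rewrite kap_pure; apply: homogC.
Qed.

Lemma kap_act n t : homog n t -> kap (act t (ones n)) = t.
Proof.
elim: n t => [|n IH] t; first by move=> /homog0 [a ->]; rewrite act0E head_coef_scal; congr (_ *: _); apply: mulr1.
have L : linear (fun t => kap (act t (ones n.+1))).
  exact: lin_comp (@kap_linear n.+1) (@act_linl (nseq n.+1 urep) (ones n.+1)).
move: t; apply: (tspan_eq L (@lin_id _ _)) => u c _ hc.
have -> : act (lt u * c) (ones n.+1) = ev (1 : urep) u *t act c (ones n) by apply: actE.
by rewrite kap_pure IH // ev_urep mulr1.
Qed.

Lemma act_kap n (y : Tpow (nseq n urep)) : act (kap y) (ones n) = y.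
Proof.
elim: n y => [|n IH]; first by move=> y; rewrite act0E head_coef_scal [LHS]mulr1.
have L : linear (fun y => act (@kap n.+1 y) (ones n.+1)).
  exact: lin_comp (@act_linl (nseq n.+1 urep) _) (@kap_linear _).
apply: (tens_ext L (@lin_id _ _)) => u y; rewrite kap_pure.
have -> : act (lt u * kap y) (ones n.+1) = ev (1 : urep) u *t act (kap y) (ones n) by apply: actE.
by rewrite IH ev_urep mulr1.
Qed.

Lemma act_faithful n t : homog n t ->
  (forall y : Tpow (nseq n urep), act t y = 0) -> t = 0.
Proof. by move=> ht t0; rewrite -(kap_act ht) t0 (lin0 (@kap_linear n)). Qed.

Lemma Tpow_ext Xs (M : lmodType k) (f h : Tpow Xs -> M) : linear f -> linear h ->
  (forall fs : rep_homs (nseq (size Xs) urep) Xs,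
     f (Tpow_map fs (ones (size Xs))) = h (Tpow_map fs (ones (size Xs)))) ->
  forall y, f y = h y.
Proof.
elim: Xs M f h => [|X Xs IH] M f h fl hl e.
  move=> y; have -> : y = (y : k) *: (1 : k^o) by rewrite [RHS]mulr1.
  have e0 : f (1 : k^o) = h (1 : k^o) := e Datatypes.tt.
  by rewrite (linZ fl) (linZ hl) e0.
apply: tens_ext => // x; apply: IH.
- exact: lin_comp fl (pure_linr _).
- exact: lin_comp hl (pure_linr _).
move=> fs; have := e (ev_hom x, fs).
by rewrite [Tpow_map _ _](Tpow_map_pure (ev_hom x) fs) [ev_hom x _]ev1.
Qed.

(** The tensor by which a natural endomorphism acts. *)
Definition tens_of n (a : endofam g) : T := kap (a (nseq n urep) (ones n)).

Lemma homog_tens_of n a : homog n (tens_of n a).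
Proof. exact: homog_kap. Qed.

Lemma natEnd_act n a : natEnd n a -> forall Xs (y : Tpow Xs), size Xs = n ->
  a Xs y = act (tens_of n a) y.
Proof.
move=> [al _ an] Xs y sX; move: (al Xs sX) => aXl; move: y.
apply: Tpow_ext => // [|fs]; first exact: act_linear.
rewrite an ?size_nseq //; rewrite sX in fs *.
by rewrite -act_natural ?size_nseq ?act_kap //; apply: homog_tens_of.
Qed.

Lemma natEnd_inv n a : natEnd n a -> inv (tens_of n a).
Proof.
move=> na z; apply: (@act_faithful n); first exact/homog_adT/homog_tens_of.
move=> y; have sz := size_nseq n urep.
have h : homog (size (nseq n urep)) (tens_of n a) by rewrite sz; apply: homog_tens_of.
have := act_adT z y h; rewrite -!(natEnd_act na) //; case: na => _ ae _.
by rewrite ae // => /eqP; rewrite -subr_eq subrr eq_sym => /eqP.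
Qed.

Lemma act_natEnd n c : homog n c -> inv c -> natEnd n (fun Xs => @act Xs c).
Proof.
move=> hc ic; split=> [Xs _|Xs z t sX|Xs Ys fs t sX]; first exact: act_linear.
  by rewrite act_adT ?sX // ic (lin0 (act_linl _)) add0r.
by rewrite act_natural ?sX.
Qed.

End Action.

(** * Change of variables *)

Section Blocks.
Variables (k : fieldType) (g : lieAlgebra k).
Local Notation U := (ualg g).
Local Notation T := (talg (ualg g)).
Local Notation lt := (@pgen k (ualg g) None).
Local Notation "X ** Y" := (rep_tens X Y) (at level 40, left associativity).
Implicit Types (X Y : rep g) (Xs Ys : seq (rep g)) (u v : U) (c t : T) (bs cs : seq nat).

(** The [j]-th letter is spread over [nth 0 bs j] slots. *)
Fixpoint bmap bs (c : T) : T :=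
  if bs is b :: bs' then tcase 0 (fun u c' => dl b u * bmap bs' c') c else c.

Lemma bmap_is_linear bs : linear (bmap bs).
Proof. by case: bs => [|b bs]; [apply: lin_id | apply: tcase_is_linear]. Qed.
HB.instance Definition _ bs := GRing.isLinear.Build k T T _ (bmap bs) (bmap_is_linear bs).

Lemma bmap_bilin b bs : bilin (fun u c => dl b u * bmap bs c).
Proof. by lint. Qed.

Lemma bmapC b bs u c : bmap (b :: bs) (lt u * c) = dl b u * bmap bs c.
Proof. exact: tcaseM (bmap_bilin b bs). Qed.

Lemma bmap0 c : bmap [::] c = c. Proof. by []. Qed.
Arguments bmap : simpl never.

Lemma bmap_cat bs bs' s t : homog (size bs) s ->
  bmap (bs ++ bs') (s * t) = bmap bs s * bmap bs' t.
Proof.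
elim: bs s => [|b bs IH] s.
  by move=> /homog0 [a ->]; rewrite -scalerAl mul1r bmap0 -scalerAl mul1r linearZ.
move: s; apply: tspan_eq; [by lint | by lint |] => u s _ hs.
by rewrite -mulrA /= !bmapC IH // mulrA.
Qed.

Lemma bmap_wrap f0 bs r c : homog (size bs) c ->
  bmap (f0 :: bs ++ [:: r]) (wrap c) = lt 1 ^+ f0 * (bmap bs c * lt 1 ^+ r).
Proof.
move=> hc; rewrite bmapC dl1 bmap_cat //; congr (_ * (_ * _)).
by rewrite -[X in bmap _ X]mulr1 bmapC dl1 bmap0 mulr1.
Qed.

Lemma tjoin_act_pure i Xs c1 c2 (p : Tpow (take i Xs)) (q : Tpow (drop i Xs)) :
  (i <= size Xs)%N -> homog i c1 ->
  tjoin (act c1 p *t act c2 q) = act (c1 * c2) (@tjoin k g i Xs (p *t q)).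
Proof.
have L Ys c : linear (@act k g Ys c) := @act_linear k g Ys c.
have R Ys y : linear ((@act k g Ys)^~ y) := @act_linl k g Ys y.
have base Ys c (r : k^o) (y : Tpow Ys) : homog 0 c ->
    tlunit (((head_coef c : k) *: r : k^o) *t act c2 y : rep_unit g ** Tpow Ys) =
    act (c * c2) (tlunit (r *t y : rep_unit g ** Tpow Ys)).
  move=> /homog0 [a ->]; rewrite head_coef_scal !tlunit_pure -scalerAl mul1r.
  by rewrite (linZ (R _ _)) (linZ (L _ _)) scalerA.
elim: Xs i c1 p q => [|X Xs IH] [|i] c1 p q // le h1; try exact: base.
pose F c := @tjoin k g i.+1 (X :: Xs) (act c p *t act c2 q).
pose H c := act (c * c2) (@tjoin k g i.+1 (X :: Xs) (p *t q)).
have JL := @tjoin_linear k g i.+1 (X :: Xs).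
have Fl : linear F by exact: lin_comp JL (lin_comp (pure_linl _) (R _ p)).
have Hl : linear H by exact: lin_comp (R _ _) (lin_mulr _ (@lin_id _ _)).
suff E u c : homog i c -> F (lt u * c) = H (lt u * c).
  by move: c1 h1; apply: (tspan_eq Fl Hl) => u c _; apply: E.
move=> hc.
pose F' p := @tjoin k g i.+1 (X :: Xs) (act (lt u * c) p *t act c2 q).
pose H' p := act (lt u * c * c2) (@tjoin k g i.+1 (X :: Xs) (p *t q)).
have Fl' : linear F' by exact: lin_comp JL (lin_comp (pure_linl _) (L (X :: take i Xs) _)).
have Hl' : linear H' by exact: lin_comp (L _ _) (lin_comp JL (pure_linl _)).
suff E x p' : F' (x *t p') = H' (x *t p') by exact: (tens_ext Fl' Hl' E p).
by rewrite /F' /H' actE !tjoinS -mulrA actE IH.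
Qed.

Lemma tjoin_act i Xs c1 c2 (w : Tpow (take i Xs) ** Tpow (drop i Xs)) :
  (i <= size Xs)%N -> homog i c1 ->
  tjoin (tmap (@act k g _ c1) (@act k g _ c2) w) = act (c1 * c2) (tjoin w).
Proof.
move=> le h1; have L Ys c : linear (@act k g Ys c) := @act_linear k g Ys c.
have LJ := @tjoin_linear k g i Xs.
pose F w := tjoin (tmap (@act k g (take i Xs) c1) (@act k g (drop i Xs) c2) w).
pose H w := act (c1 * c2) (@tjoin k g i Xs w).
have Fl : linear F by exact: lin_comp LJ (tmap_linear (L _ _) (L _ _)).
have Hl : linear H by exact: lin_comp (L _ _) LJ.
suff E p q : F (p *t q) = H (p *t q) by exact: (tens_ext Fl Hl E w).
rewrite /F /H (tmap_pure (L _ _) (L _ _)); exact: tjoin_act_pure.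
Qed.

Lemma tgroup_linear bs Xs : linear (@tgroup k g bs Xs).
Proof.
elim: bs Xs => [|b bs IH] Xs; first exact: tlunit_inv_linear.
exact: lin_comp (@tassoc_linear _ _ _ _ _) (lin_comp (tmap_linear (@lin_id _ _) (IH _)) (@tsplit_linear _ _ _ _)).
Qed.

Lemma tungroup_linear bs Xs : linear (@tungroup k g bs Xs).
Proof.
elim: bs Xs => [|b bs IH] Xs; first exact: tlunit_linear.
exact: lin_comp (@tjoin_linear _ _ _ _) (lin_comp (tmap_linear (@lin_id _ _) (IH _)) (@tassoc_inv_linear _ _ _ _ _)).
Qed.

Lemma size_blocks bs Xs : size (blocks bs Xs) = size bs.
Proof. by elim: bs Xs => //= b bs IH Xs; rewrite IH. Qed.

(** Grouping the factors into blocks turns the action on the blocks into the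
    action of the iterated coproducts. *)
Lemma tungroup_act bs Xs r c (y : Tpow Xs) : (sumn bs + r = size Xs)%N -> homog (size bs) c ->
  tungroup (tmap (@act k g (blocks bs Xs) c) id (tgroup bs y)) = act (bmap bs c * lt 1 ^+ r) y.
Proof.
have L Ys c' : linear (@act k g Ys c') := @act_linear k g Ys c'.
have R Ys y' : linear ((@act k g Ys)^~ y') := @act_linl k g Ys y'.
elim: bs Xs c y => [|b bs IH] Xs c y e.
  move=> /homog0 [a ->]; rewrite bmap0 -scalerAl mul1r (linZ (R _ _)).
  have -> : r = size Xs by [].
  rewrite act_ones; transitivity (tlunit ((a : k^o) *t y : rep_unit g ** Tpow Xs)).
    congr tlunit; rewrite /= /tlunit_inv (tmap_pure (L [::] _) (@lin_id _ _)).
    by rewrite act0E head_coef_scal; congr (_ *t _); exact: mulr1.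
  by rewrite tlunit_pure.
have le : (b <= size Xs)%N by rewrite -e -addnA leq_addr.
have e' : (sumn bs + r = size (drop b Xs))%N by rewrite size_drop -e -addnA addKn.
have TL := @tungroup_linear (b :: bs) Xs.
have ML c' := tmap_linear (L (blocks (b :: bs) Xs) c') (@lin_id _ (Tpow (remainder (b :: bs) Xs))).
pose z := tgroup (b :: bs) y.
pose F c := tungroup (tmap (@act k g (blocks (b :: bs) Xs) c) id z).
have Fl : linear F.
  apply: (lin_comp TL) => a c1 c2; rewrite /tmap /tlift scaler_sumr -big_split.
  by apply: eq_bigr => p _; rewrite (R _ _ a) (pure_linl _ a).
pose H c := act (bmap (b :: bs) c * lt 1 ^+ r) y.
have Hl : linear H.
  by apply: lin_comp (R _ _) _; apply: lin_mulr; apply: bmap_is_linear.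
suff E u c' : homog (size bs) c' -> F (lt u * c') = H (lt u * c').
  by move: c; apply: (tspan_eq Fl Hl) => u c' _; apply: E.
move=> hc; rewrite /H bmapC -mulrA -[y in RHS](tsplitK b).
rewrite -tjoin_act //; last exact: homog_dl.
rewrite /F /z /=; congr tjoin.
set c2 := bmap bs c' * _.
have GL := @tgroup_linear bs (drop b Xs); have UL := @tungroup_linear bs (drop b Xs).
move: (tsplit b y) => w.
pose F1 w := tmap id (@tungroup k g bs (drop b Xs)) (tassoc_inv
  (tmap (@act k g (blocks (b :: bs) Xs) (lt u * c')) id (tassoc (tmap id (@tgroup k g bs (drop b Xs)) w)))).
pose H1 w := tmap (@act k g (take b Xs) (dl b u)) (@act k g (drop b Xs) c2) w.
have F1l : linear F1.
  apply: (lin_comp (tmap_linear (@lin_id _ _) UL)); apply: (lin_comp (@tassoc_inv_linear _ _ _ _ _)).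
  apply: (lin_comp (ML _)); apply: (lin_comp (@tassoc_linear _ _ _ _ _)).
  exact: tmap_linear (@lin_id _ _) GL.
have H1l : linear H1 by exact: tmap_linear.
suff E p q : F1 (p *t q) = H1 (p *t q) by exact: (tens_ext F1l H1l E w).
rewrite /F1 /H1 (tmap_pure (@lin_id _ _) GL) (tmap_pure (L _ _) (L _ _)).
have -> : act (dl b u) p = ev p u by rewrite ev_dl size_takel.
rewrite -(IH _ _ _ e' hc).
move: (tgroup bs q) => z1.
pose F2 z := tmap (@id (Tpow (take b Xs))) (@tungroup k g bs (drop b Xs)) (tassoc_inv
  (tmap (@act k g (blocks (b :: bs) Xs) (lt u * c')) id (tassoc (p *t z)))).
pose H2 z := ev p u *t tungroup (tmap (@act k g (blocks bs (drop b Xs)) c') id z).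
have F2l : linear F2.
  apply: (lin_comp (tmap_linear (@lin_id _ _) UL)); apply: (lin_comp (@tassoc_inv_linear _ _ _ _ _)).
  apply: (lin_comp (ML _)); apply: (lin_comp (@tassoc_linear _ _ _ _ _)).
  exact: pure_linr.
have H2l : linear H2.
  exact: lin_comp (pure_linr _) (lin_comp UL (tmap_linear (L _ _) (@lin_id _ _))).
suff E p1 q1 : F2 (p1 *t q1) = H2 (p1 *t q1) by exact: (tens_ext F2l H2l E z1).
rewrite /F2 /H2 tassoc_pure (tmap_pure (L (blocks (b :: bs) Xs) _) (@lin_id _ _)).
rewrite actE tassoc_inv_pure (tmap_pure (@lin_id _ _) UL).
by rewrite (tmap_pure (L _ _) (@lin_id _ _)).
Qed.

End Blocks.
Arguments bmap : simpl never.

Section EmapTensor.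
Variables (k : fieldType) (g : lieAlgebra k).
Local Notation U := (ualg g).
Local Notation T := (talg (ualg g)).
Local Notation lt := (@pgen k (ualg g) None).
Implicit Types (X Y : rep g) (Xs Ys : seq (rep g)) (u v : U) (c t : T) (bs cs : seq nat) (f : nat -> nat).

Definition steps n f : seq nat := [seq (f j.+1 - f j)%N | j <- iota 0 n].

Lemma stepsS n f : steps n.+1 f = (f 1%N - f 0%N)%N :: steps n (fun j => f j.+1).
Proof. by rewrite /steps /= -[iota 1 n]/(iota (1 + 0) n) iotaDl -map_comp. Qed.

Lemma eq_steps n f h : f =1 h -> steps n f = steps n h.
Proof. by move=> e; apply: eq_map => j; rewrite !e. Qed.

Lemma steps_shift n f : steps n (fun j => (f j).+1) = steps n f.
Proof. by apply: eq_map => j; rewrite subSS. Qed.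

Lemma steps_succ n : steps n succn = nseq n 1%N.
Proof.
rewrite /steps; move: (iota 0 n) (size_iota 0 n) => s <-.
by elim: s => //= j s ->; rewrite subSn // subnn.
Qed.

Lemma size_steps n f : size (steps n f) = n.
Proof. by rewrite size_map size_iota. Qed.

Lemma sum_steps n f : (forall j, (j < n)%N -> (f j <= f j.+1)%N) ->
  (f 0%N + sumn (steps n f) = f n)%N.
Proof.
elim: n f => [|n IHn] f mono; first by rewrite addn0.
rewrite stepsS /= addnA subnKC ?mono //.
by rewrite (IHn (fun j => f j.+1)) // => j lt_j; apply: mono.
Qed.

Lemma Emap_act n f a Xs (y : Tpow Xs) : natEnd n a ->
  (forall j, (j < n)%N -> (f j <= f j.+1)%N) -> (f n <= size Xs)%N ->
  Emap n f a y = act (bmap (f 0%N :: steps n f ++ [:: (size Xs - f n)%N]) (wrap (tens_of n a))) y.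
Proof.
move=> na mono le; have sm := sum_steps mono.
have hc := homog_tens_of n a.
rewrite bmap_wrap ?size_steps // -[y in RHS](tsplitK (f 0%N)).
have le0 : (f 0%N <= size Xs)%N by apply: leq_trans le; rewrite -sm leq_addr.
rewrite -tjoin_act //; last exact: homog_ones.
rewrite /Emap -/(steps n f); congr tjoin.
have -> : @act k g (take (f 0%N) Xs) (lt 1 ^+ f 0%N) = id.
  by apply/funext => p; have := act_ones p; rewrite size_takel.
congr (tmap id _ _); apply/funext => q.
rewrite -tungroup_act ?size_steps //; last first.
  by rewrite size_drop -sm subnDA subnKC // leq_subRL // sm.
congr (tungroup (tmap _ id _)); apply/funext => p.
by apply: natEnd_act na _ _ _; rewrite size_blocks size_steps.
Qed.

Lemma dl1E u : dl 1 u = lt u.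
Proof.
rewrite dlS -[RHS](csum_epsr _ (@pgen_is_linear _ _ None)); apply: eq_csum => a b.
by rewrite /= -scalerAr mulr1.
Qed.

Lemma bmap_ones n c : homog n c -> bmap (nseq n 1%N) c = c.
Proof.
elim: n c => [|n IHn] c //; move: c; apply: tspan_eq; [by lint | exact: lin_id |].
by move=> u c _ hc; rewrite [nseq _ _]/= bmapC dl1E IHn.
Qed.

Lemma bmap_bump n i c : (i <= n)%N -> homog n c ->
  bmap (steps n (bump i.+1)) c * lt 1 ^+ (n.+1 - bump i.+1 n) = cof i.+1 c.
Proof.
elim: n i c => [|n IHn] [|i] c // le.
- by move=> /homog0 [a ->]; rewrite bmap0 -scalerAl mul1r linearZ /= cof11.
- have -> : steps n.+1 (bump 1) = 2%N :: nseq n 1%N.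
    by rewrite stepsS; congr cons; rewrite -steps_succ -[RHS]steps_shift; apply: eq_steps.
  rewrite [bump 1 n.+1]/= subnn mulr1.
  move: c; apply: tspan_eq; [by lint | by lint |] => u c _ hc.
  rewrite bmapC cof1C bmap_ones // dlS (csum_ap _ _ (lin_mulr c (@lin_id _ T))).
  by apply: eq_csum => a b; rewrite dl1E mulrA.
have -> : steps n.+1 (bump i.+2) = 1%N :: steps n (bump i.+1).
  by rewrite stepsS; congr cons; rewrite -[RHS]steps_shift; apply: eq_steps => j; rewrite /bump ltnS addnS.
have -> : (n.+2 - bump i.+2 n.+1 = n.+1 - bump i.+1 n)%N by rewrite /bump ltnS addnS subSS.
move: c; apply: tspan_eq; [by lint | by lint |] => u c _ hc.
by rewrite bmapC cofSC dl1E -IHn // mulrA.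
Qed.

Lemma bump_mono i j : (bump i j <= bump i j.+1)%N.
Proof. by apply: (@leq_trans (1 + j)); rewrite /bump ?leq_add2r ?leq_b1 // add1n leq_addl. Qed.

Lemma Ecoface_act n i a Xs (y : Tpow Xs) : natEnd n a -> (i <= n.+1)%N -> size Xs = n.+1 ->
  Ecoface n i a y = act (cof i (tens_of n a)) y.
Proof.
move=> na le sX; have hc := homog_tens_of n a.
have le' : (bump i n <= size Xs)%N by rewrite sX /bump -add1n leq_add2r leq_b1.
rewrite /Ecoface (Emap_act y na (fun j _ => bump_mono i j) le').
rewrite sX bmap_wrap ?size_steps //; case: i le {le'} => [|i] le; last first.
  by rewrite expr0 mul1r bmap_bump.
have -> : steps n (bump 0) = nseq n 1%N by rewrite -steps_succ; apply: eq_steps => j; rewrite /bump add1n.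
by rewrite bmap_ones // /bump add1n subnn mulr1 cof0.
Qed.

Lemma bmap_unbump n i c : (i <= n)%N -> homog n.+1 c ->
  bmap (steps n.+1 (unbump i)) c = sig i c.
Proof.
elim: n i c => [|n IHn] [|i] c // le.
- move: c; apply: tspan_eq; [by lint | by lint |] => u c _ hc.
  by rewrite /steps /= bmapC sig0C /= bmap0 -scalerAl mul1r.
- have -> : steps n.+2 (unbump 0) = 0%N :: nseq n.+1 1%N.
    by rewrite stepsS; congr cons; rewrite -steps_succ steps_shift; apply: eq_steps => j; rewrite /unbump subn1.
  move: c; apply: tspan_eq; [by lint | by lint |] => u c _ hc.
  by rewrite bmapC sig0C bmap_ones //= -scalerAl mul1r.
have -> : steps n.+2 (unbump i.+1) = 1%N :: steps n.+1 (unbump i).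
  rewrite stepsS; congr cons; rewrite -[RHS]steps_shift; apply: eq_steps => j.
  by rewrite /unbump ltnS; case: ltnP => // lt_ij; rewrite ?subn1 ?subn0 ?prednK //; exact: leq_ltn_trans lt_ij.
move: c; apply: tspan_eq; [by lint | by lint |] => u c _ hc.
by rewrite bmapC sigSC dl1E IHn.
Qed.

Lemma Ecodegen_act n i a Xs (y : Tpow Xs) : natEnd n a -> (i < n)%N -> (size Xs).+1 = n ->
  Ecodegen n i a y = act (sig i (tens_of n a)) y.
Proof.
move=> na lt_i sX; have hc := homog_tens_of n a.
have mono j : (unbump i j <= unbump i j.+1)%N.
  rewrite /unbump; case: (ltnP i j) => lt1; case: (ltnP i j.+1) => lt2; rewrite ?subn1 ?subn0 //.
  - exact: leq_pred.
  - exact: leq_trans (leq_pred _) (leqnSn _).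
have un : unbump i n = n.-1 by rewrite /unbump lt_i subn1.
have le : (unbump i n <= size Xs)%N by rewrite un -sX.
rewrite /Ecodegen (Emap_act y na (fun j _ => mono j) le).
rewrite bmap_wrap ?size_steps // un -sX subnn !mulr1.
have -> : unbump i 0 = 0%N by rewrite /unbump ltn0.
rewrite expr0 mul1r bmap_unbump //; first by rewrite -ltnS sX.
by rewrite sX.
Qed.

End EmapTensor.

Section Joyal.
Implicit Types (psi : lpath) (cs s : seq nat) (d : bool).

Fixpoint jl cs j : nat :=
  if cs is c :: cs' then if (j < c)%N then 0%N else (jl cs' (j - c)%N).+1 else 0%N.

Lemma joyal_jl d psi j : joyal d psi j = jl (counts d psi) j.
Proof.
have cS w psi' l : Defs.coord d (w :: psi') l.+1 = (count_mem d w + Defs.coord d psi' l)%N.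
  by rewrite /Defs.coord /= count_cat.
have c0 psi' : Defs.coord d psi' 0 = 0%N by rewrite /Defs.coord take0.
elim: psi j => // w psi IH j.
transitivity (if (Defs.coord d (w :: psi) 0 <= j < Defs.coord d (w :: psi) 1)%N then 0%N
  else (find (fun l => (Defs.coord d (w :: psi) l <= j < Defs.coord d (w :: psi) l.+1)%N)
    (iota (1 + 0) (size psi))).+1); first by [].
rewrite cS !c0 addn0 leq0n /=; case: ltnP => // le; congr S.
rewrite -[iota 1 _]/(iota (1 + 0) _) -IH /joyal iotaDl find_map; apply: eq_find => l /=.
by rewrite add1n !cS leq_subRL // ltn_subLR.
Qed.

(** The number of slots over which each letter is spread. *)
Fixpoint gaps cs : seq nat :=
  if cs is c :: cs' then
    nseq c 0%N ++ (if cs' is [::] then [:: 0%N]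
                   else (head 0%N (gaps cs')).+1 :: behead (gaps cs'))
  else [::].

Lemma gapsS c c' cs : gaps (c :: c' :: cs) =
  nseq c 0%N ++ (head 0%N (gaps (c' :: cs))).+1 :: behead (gaps (c' :: cs)).
Proof. by []. Qed.

Lemma size_gaps c cs : size (gaps (c :: cs)) = (sumn (c :: cs)).+1.
Proof.
elim: cs c => [|c' cs IH] c; first by rewrite /= size_cat size_nseq addn0 addn1.
by rewrite gapsS size_cat size_nseq [size (_ :: _)]/= size_behead IH /= addnS.
Qed.

Lemma gaps_cons c cs : gaps (c :: cs) = head 0%N (gaps (c :: cs)) :: behead (gaps (c :: cs)).
Proof. by have := size_gaps c cs; case: (gaps _). Qed.

Lemma sumn_gaps c cs : sumn (gaps (c :: cs)) = size cs.
Proof.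
elim: cs c => [|c' cs IH] c; first by rewrite /= sumn_cat sumn_nseq mul0n.
by rewrite gapsS sumn_cat sumn_nseq mul0n add0n /= addSn -(IH c') [in RHS]gaps_cons.
Qed.

Lemma jl_gaps cs j : (j < sumn cs)%N -> jl cs j = sumn (take j.+1 (gaps cs)).
Proof.
have s0 i c : sumn (take i (nseq c 0%N)) = 0%N by elim: c i => [|c IH] [|i] //=; apply: IH.
elim: cs j => // c cs IH j lt_j; rewrite [LHS]/=; case: ltnP => le.
  by case: cs {IH lt_j} => [|c' cs]; rewrite ?gapsS [gaps _]/= takel_cat ?s0 ?size_nseq.
case: cs lt_j IH => [|c' cs] lt_j IH; first by move: lt_j; rewrite /= addn0 ltnNge le.
have lt_j' : (j - c < sumn (c' :: cs))%N by rewrite ltn_subLR.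
rewrite (IH _ lt_j') gapsS; have := gaps_cons c' cs; move: (gaps (c' :: cs)) => s es.
rewrite {1}es take_cat size_nseq ltnNge (leqW le) /= subSn //.
by rewrite sumn_cat sumn_nseq mul0n add0n /= addSn.
Qed.

Lemma steps_prefix n s f : size s = n.+2 ->
  (forall j, (j <= n)%N -> f j = sumn (take j.+1 s)) ->
  f 0%N :: steps n f ++ [:: (sumn s - f n)%N] = s.
Proof.
case: s => [//|x s] [sz] fE.
have nx j : (j < size s)%N -> sumn (take j.+2 (x :: s)) = (sumn (take j.+1 (x :: s)) + nth 0 s j)%N.
  by move=> lt_j; rewrite /= (take_nth 0 lt_j) sumn_rcons addnA.
rewrite fE // [X in X :: _]/= take0 addn0; congr cons.
rewrite -[RHS](mkseq_nth 0) /mkseq sz -[in RHS]addn1 iotaD map_cat /= add0n; congr (_ ++ _).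
  rewrite /steps; apply/eq_in_map => j; rewrite mem_iota /= add0n => lt_j.
  by rewrite fE // nx ?sz ?leqW // fE ?(ltnW lt_j) // addKn.
congr cons; rewrite fE //.
have -> : (x + sumn s)%N = sumn (take n.+2 (x :: s)) by rewrite take_oversize //= sz.
by rewrite nx ?sz // addKn.
Qed.

End Joyal.

Section Final.
Variables (k : fieldType) (g : lieAlgebra k).
Local Notation U := (ualg g).
Local Notation T := (talg (ualg g)).
Local Notation lt := (@pgen k (ualg g) None).
Implicit Types (Xs Ys : seq (rep g)) (u v : U) (t : T) (cs : seq nat).

Lemma bmap_zeros c bs n t : homog (c + n) t ->
  bmap (nseq c 0%N ++ bs) t = bmap bs (advn c t).
Proof.
elim: c t => // c IH t; rewrite addSn; move: t; apply: tspan_eq.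
- exact: bmap_is_linear.
- exact: lin_comp (@bmap_is_linear _ _ _) (@advn_is_linear _ _ _).
move=> u t _ ht; rewrite advnC linearZ /= bmapC IH //.
by rewrite /= -scalerAl mul1r.
Qed.

Lemma pathF_bmap c cs t : homog (sumn (c :: cs)).+1 t ->
  pathF (c :: cs) t = bmap (gaps (c :: cs)) t.
Proof.
elim: cs c t => [|c' cs IH] c t ht.
  have ht' : homog (c + 1) t by move: ht; rewrite /= addn0 addn1.
  rewrite [gaps _]/= (bmap_zeros _ ht').
  have : homog 1 (advn c t).
    have := @advn_span _ _ c _ _ ht'; rewrite size_nseq nseqD drop_size_cat ?size_nseq //.
    by apply; rewrite leq_addr.
  rewrite /pathF; move: (advn c t); apply: tspan_eq.
  - exact: dist_is_linear.
  - exact: bmap_is_linear.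
  move=> u s _ _; rewrite bmapC bmap0 /= -scalerAl mul1r; exact: sig0C.
have ht' : homog (c + (sumn (c' :: cs)).+1) t by rewrite addnS.
rewrite gapsS (bmap_zeros _ ht').
have : homog (sumn (c' :: cs)).+1 (advn c t).
  have := @advn_span _ _ c _ _ ht'; rewrite size_nseq nseqD.
  by rewrite drop_size_cat ?size_nseq //; apply; rewrite leq_addr.
rewrite {1}/pathF; move: (advn c t); apply: tspan_eq.
- exact: dist_is_linear.
- exact: bmap_is_linear.
move=> u s _ hs; rewrite distE bmapC dlS (csum_ap _ _ (lin_mulr _ (@lin_id _ T))).
apply: eq_csum => a b; rewrite -mulrA -bmapC -gaps_cons; congr (_ * _).
by apply: IH; apply: homogC.
Qed.

Section PathAct.
Variables (p : nat) (psi : lpath) (sz : size psi = p.+1).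

Lemma joyal_act d n a Xs (y : Tpow Xs) : sumn (counts d psi) = n.+1 -> natEnd n a ->
  size Xs = p -> Emap n (joyal d psi) a y = act (Fp d psi (tens_of n a)) y.
Proof.
move=> sc na sX; case: psi sz sc => [//|w psi'] sz' sc; set cs := counts d _ in sc *.
have szg : size (gaps cs) = n.+2 by rewrite size_gaps -/cs sc.
have jE j : (j <= n)%N -> joyal d (w :: psi') j = sumn (take j.+1 (gaps cs)).
  by move=> le; rewrite joyal_jl jl_gaps // sc.
have sg : sumn (gaps cs) = p by rewrite sumn_gaps size_map; case: sz'.
have le : (joyal d (w :: psi') n <= size Xs)%N.
  by rewrite jE // sX -sg -{2}(cat_take_drop n.+1 (gaps cs)) sumn_cat leq_addr.
have mono j : (j < n)%N -> (joyal d (w :: psi') j <= joyal d (w :: psi') j.+1)%N.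
  move=> lt_j; rewrite !jE ?(ltnW lt_j) // (take_nth 0 (n := j.+1)) ?sumn_rcons ?leq_addr //.
  by rewrite szg ltnS ltnW.
rewrite (Emap_act y na mono le).
rewrite sX -sg steps_prefix // /Fp -/cs pathF_bmap // -/cs sc.
exact/closed_homog/closed_wrap/homog_tens_of.
Qed.

End PathAct.

Lemma path_act_act m n p psi a b Xs (y : Tpow Xs) : in_L3 m n p psi ->
  natEnd m a -> natEnd n b -> size Xs = p ->
  path_act m n psi a b y = act (PA psi (tens_of m a) (tens_of n b)) y.
Proof.
rewrite in_L3E => /and4P [/eqP sz /eqP c1 /eqP c2 _] na nb sX.
have h1 := homog_Fp c1 (homog_tens_of m a); have h2 := homog_Fp c2 (homog_tens_of n b).
rewrite sz /= -sX in h1 h2.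
rewrite /path_act /PA sz /= -sX; case: ifP => _.
  by rewrite (joyal_act sz _ c1) // (joyal_act sz _ c2) // act_star.
by rewrite (joyal_act sz _ c1) // (joyal_act sz _ c2) // act_star.
Qed.

Lemma sig_cosp0 n i t : cosp n 0 t -> (i < n)%N -> sig i t = 0.
Proof.
elim: n i t => // n IH [|i] t ct lt_i; move: t ct; apply: tspan_eq; try exact: sig_is_linear; try exact: lin_zero.
- by move=> u t au _; rewrite sig0C [eps u]au scale0r.
- by move=> u t _ ct; rewrite sigSC (IH _ _ ct lt_i) mulr0.
Qed.

Lemma homog_cof n i t : (i <= n.+1)%N -> homog n t -> homog n.+1 (cof i t).
Proof.
elim: n i t => [|n IH] [|[|i]] t // le ht; try by rewrite cof0; apply: homogC.
- by have [a ->] := homog0 ht; rewrite linearZ /= cof11; apply/tspanZ/homog_lt.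
- move: t ht; apply: tspan_map => [|u t _ ht]; first exact: cof_is_linear.
  by rewrite cof1C unlock; apply: tspan_sum => q; do 2!apply: homogC.
- move: t ht; apply: tspan_map => [|u t _ ht]; first exact: cof_is_linear.
  by rewrite cofSC; apply/homogC/IH.
Qed.

Lemma homog_dd n t : homog n t -> homog n.+1 (dd n t).
Proof.
move=> ht; rewrite (dd_cof ht) big_mkord; apply: tspan_sum => i; apply: tspanZ.
by apply: homog_cof ht; rewrite -ltnS.
Qed.

Lemma homog_sig n i t : (i <= n)%N -> homog n.+1 t -> homog n (sig i t).
Proof.
elim: n i t => [|n IH] [|i] t // le; apply: tspan_map; try exact: sig_is_linear.
- by move=> u s _ hs; rewrite sig0C; apply: tspanZ.
- by move=> u s _ hs; rewrite sig0C; apply: tspanZ.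
- by move=> u s _ hs; rewrite sigSC; apply/homogC/IH.
Qed.

Lemma Ediff_act n a Xs (y : Tpow Xs) : natEnd n a -> size Xs = n.+1 ->
  Ediff n a y = act (dd n (tens_of n a)) y.
Proof.
move=> na sX; have hc := homog_tens_of n a.
rewrite /Ediff (dd_cof hc) big_mkord (lin_sumE _ _ (act_linl y)); apply: eq_bigr => i _.
by rewrite (linZ (act_linl y)) (Ecoface_act _ na) // -ltnS.
Qed.

(** Cocycles are cocycles in the cobar complex. *)
Lemma cocycle_tens n (a : endofam g) : cocycle n a ->
  [/\ cosp n 0 (tens_of n a), dd n (tens_of n a) = 0 & inv (tens_of n a)].
Proof.
move=> [[na nrm] cyc]; have hc := homog_tens_of n a; split; last exact: natEnd_inv.
- apply: (sig_cosp hc) => i lt_i; case: n na nrm cyc hc lt_i => // n na nrm cyc hc lt_i.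
  apply: (@act_faithful k g n); first by apply: (homog_sig _ hc).
  by move=> y; rewrite -(Ecodegen_act _ na) ?size_nseq // nrm ?size_nseq.
apply: (@act_faithful k g n.+1); first exact: homog_dd.
by move=> y; rewrite -(Ediff_act _ na) ?size_nseq // cyc ?size_nseq.
Qed.

Lemma tens_of_act n t : homog n t -> tens_of n (fun Xs => @act k g Xs t) = t.
Proof. exact: kap_act. Qed.

Lemma act_cochain n t : cosp n 0 t -> inv t -> cochain n (fun Xs => @act k g Xs t).
Proof.
move=> ct it; have ht := cosp0_homog ct; have na := act_natEnd ht it; split=> // i Xs y lt_i sX.
by rewrite (Ecodegen_act _ na) // tens_of_act // (sig_cosp0 ct lt_i) (lin0 (act_linl y)).
Qed.

End Final.

Lemma two_bracket_coboundary (k : fieldType) (k_char0 : [pchar k] =i pred0)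
    (g : lieAlgebra k) (z : pchain k) (zc : tot_cycle2 z)
    (m n p : nat) (mnp : (m + n = p + 2)%N) (a b : endofam g)
    (a_cocycle : cocycle m a) (b_cocycle : cocycle n b) :
  coboundary p (two_bracket z m n p a b).
Proof.
have [ca da ia] := cocycle_tens a_cocycle; have [cb db ib] := cocycle_tens b_cocycle.
have [c [Ec cc ic]] := tbT_exact k_char0 zc mnp ca da ia cb db ib.
have na := a_cocycle.1.1; have nb := b_cocycle.1.1.
have E Xs (y : Tpow Xs) : size Xs = p ->
    two_bracket z m n p a b y = act (dd p.-1 ((-1) ^+ (m * n) *: c)) y.
  move=> sX; rewrite linearZ /= -Ec (linZ (act_linl y)) /two_bracket; congr (_ *: _).
  rewrite /tbT (lin_sumE _ _ (act_linl y)); apply: eq_bigr => psi _.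
  by rewrite (linZ (act_linl y)) (path_act_act _ (path_ofP psi).1).
have cc' : cosp p.-1 0 ((-1) ^+ (m * n) *: c) by apply: tspanZ.
have ic' : inv ((-1) ^+ (m * n) *: c) by move=> y; rewrite linearZ /= ic scaler0.
case: p mnp c {Ec cc ic} E cc' ic' => [|p] _ c E cc ic.
  by move=> Xs y sX; rewrite E // dd0 (lin0 (act_linl y)).
have hc := cosp0_homog cc.
exists (fun Xs => @act k g Xs ((-1) ^+ (m * n) *: c)); split; first exact: act_cochain.
move=> Xs y sX; rewrite E // (Ediff_act _ (act_natEnd hc ic)) //.
by rewrite tens_of_act.
Qed.

Local Close Scope ring_scope.

Theorem theorem4p14 (k : fieldType) (k_char0 : [pchar k]%R =i pred0)
    (g : lieAlgebra k) (z : pchain k) (z_gen : H2_generator z)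
    (m n p : nat) (mnp : m + n = p + 2) (a b : endofam g)
    (a_cocycle : cocycle m a) (b_cocycle : cocycle n b) :
  coboundary p (two_bracket z m n p a b).
Proof. exact: (two_bracket_coboundary k_char0 z_gen.1 mnp a_cocycle b_cocycle). Qed.
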